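(* Let $(M,g,J)$ be an almost Hermitian manifold of real dimension $6$ of type $W_1\oplus W_4$. Then $(M,g,J)$ is locally conformal to a nearly Kähler manifold: every point of $M$ has an open neighbourhood $U$ and a smooth function $f:U\to(0,\infty)$ such that $(U,fg,J)$ is nearly Kähler.
   Context: An almost Hermitian manifold $(M,g,J)$ is a Riemannian manifold $(M,g)$ with an almost complex structure $J$ that is orthogonal, $g(JX,JY)=g(X,Y)$; its Kähler form is $\omega(X,Y)=g(JX,Y)$. Let $\nabla$ be the Levi-Civita connection of $g$. Gray-Hervella types. At each point $\nabla\omega$ lies in $\Lambda^1\otimes[[\lambda^{2,0}]]$, where $[[\lambda^{2,0}]]$ is the space of real 2-forms $\beta$ of type $(2,0)+(0,2)$, i.e. $\beta(JX,JY)=-\beta(X,Y)$. In real dimension $2n\ge 6$ this $U(n)$-module is the direct sum of four irreducible, pairwise inequivalent submodules $W_1\oplus W_2\oplus W_3\oplus W_4$, with $W_1\cong[[\lambda^{3,0}]]$ (real 3-forms of type $(3,0)+(0,3)$; these are the totally antisymmetric tensors), $W_2\cong[[U^1]]$ where $\lambda^{1,0}\otimes\lambda^{2,0}\cong\lambda^{3,0}\oplus U^1$, $W_3\cong[[\lambda^{2,1}_0]]$ (real primitive 3-forms of type $(2,1)+(1,2)$), and $W_4\cong\Lambda^1$. For $I\subset\{1,2,3,4\}$, $(M,g,J)$ is of type $\bigoplus_{i\in I}W_i$ if $\nabla\omega$ is a section of the corresponding subbundle. Nearly Kähler (NK) means type $W_1$, equivalently $(\nabla_XJ)X=0$ for all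 $X$; Kähler manifolds are included. *)

(* Defs.v *)
From HB Require Import structures.
From mathcomp Require Import all_boot all_order all_algebra.
From mathcomp Require Import all_classical all_reals all_analysis.
From mathcomp Require Import lra.

Set Implicit Arguments.
Unset Strict Implicit.
Unset Printing Implicit Defensive.

Import Order.TTheory GRing.Theory Num.Theory.
Import numFieldNormedType.Exports.

Local Open Scope classical_set_scope.
Local Open Scope ring_scope.

(* Vectors are rows, as in mathcomp's 'J: an endomorphism A sends X to *)
(* X *m A, and the differential of f at x sends X to X *m 'J f x.  A bilinear *)
(* form is given by its Gram matrix, a covector by a column. *)

Section Smooth.
Context {R : realType} {m : nat} {W : normedModType R}.

(* C^k on a set A, meant for A open: the derivatives of order at most k along *)
(* constant vector fields exist and are continuous on A. *)
Fixpoint Ck (k : nat) (A : set 'rV[R]_m) (f : 'rV[R]_m -> W) : Prop :=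
  (forall x, A x -> {for x, continuous f}) /\
  (if k is k'.+1 then
     forall v : 'rV[R]_m,
       (forall x, A x -> derivable f x v) /\ Ck k' A ('D_v f)
   else True).

Definition smooth (A : set 'rV[R]_m) (f : 'rV[R]_m -> W) : Prop :=
  forall k, Ck k A f.

End Smooth.

(* Both maps of a chart are total; the values of chart_map outside chart_dom *)
(* and of chart_inv outside the image of chart_dom are irrelevant. *)
Record chart (R : realType) (m : nat) (M : topologicalType) := Chart {
  chart_dom : set M;
  chart_map : M -> 'rV[R]_m;
  chart_inv : 'rV[R]_m -> M;
  chart_dom_open : open chart_dom;
  chart_image_open : open (chart_map @` chart_dom);
  chart_mapK : forall p, chart_dom p -> chart_inv (chart_map p) = p;
  chart_map_continuous : forall p, chart_dom p -> {for p, continuous chart_map};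
  chart_inv_continuous :
    forall x, (chart_map @` chart_dom) x -> {for x, continuous chart_inv} }.

Definition transition (R : realType) (m : nat) (M : topologicalType)
    (c d : chart R m M) : 'rV[R]_m -> 'rV[R]_m :=
  chart_map d \o chart_inv c.

Record manifold (R : realType) (m : nat) := Manifold {
  carrier :> topologicalType;
  manifold_hausdorff : hausdorff_space carrier;
  manifold_second_countable : @second_countable carrier;
  atlas : set (chart R m carrier);
  atlas_cover : forall p : carrier, exists2 c, atlas c & chart_dom c p;
  atlas_smooth : forall c d, atlas c -> atlas d ->
    smooth (chart_map c @` (chart_dom c `&` chart_dom d)) (transition c d) }.

Arguments atlas {R m} M : rename.

Section PointwiseAlgebra.
Context {R : realType} {m : nat}.
Local Notation V := 'rV[R]_m.
Implicit Types (g J A : 'M[R]_m) (X Y Z : V) (alpha : V -> V -> V -> R).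

Definition bilin g X Y : R := (X *m g *m Y^T) 0 0.

(* g is an inner product and J an orthogonal complex structure *)
Definition hermitian_pair g J : Prop :=
  [/\ forall X Y, bilin g X Y = bilin g Y X,
      forall X, X != 0 -> 0 < bilin g X X,
      J *m J = - 1%:M &
      forall X Y, bilin g (X *m J) (Y *m J) = bilin g X Y].

Definition unitary_endo g J A : Prop :=
  (forall X Y, bilin g (X *m A) (Y *m A) = bilin g X Y) /\ A *m J = J *m A.

(* the U(n)-module Lambda^1 (x) [[lambda^{2,0}]] *)
Definition GH_space J alpha : Prop :=
  [/\ [/\ forall Y Z, scalar (fun X => alpha X Y Z),
          forall X Z, scalar (fun Y => alpha X Y Z) &
          forall X Y, scalar (fun Z => alpha X Y Z)],
      forall X Y Z, alpha X Z Y = - alpha X Y Z &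
      forall X Y Z, alpha X (Y *m J) (Z *m J) = - alpha X Y Z].

(* An injective U(n)-equivariant linear map from Lambda^1 into *)
(* Lambda^1 (x) [[lambda^{2,0}]].  The group acts on both sides by pullback: *)
(* the pullback by A of the covector theta is A *m theta. *)
Definition Lambda1_embedding g J (F : 'cV[R]_m -> V -> V -> V -> R) : Prop :=
  [/\ forall theta, GH_space J (F theta),
      forall X Y Z, scalar (fun theta => F theta X Y Z),
      forall theta, (forall X Y Z, F theta X Y Z = 0) -> theta = 0 &
      forall A, unitary_endo g J A -> forall theta X Y Z,
        F (A *m theta) X Y Z = F theta (X *m A) (Y *m A) (Z *m A)].

(* the totally antisymmetric elements, GH_space giving the antisymmetry in the *)
(* last two arguments; g is kept as a parameter to match W4 *)
Definition W1 g J alpha : Prop :=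
  GH_space J alpha /\ forall X Y Z, alpha Y X Z = - alpha X Y Z.

(* The submodule isomorphic to Lambda^1.  It has multiplicity one for m >= 6, *)
(* so that all Lambda1_embeddings have the same image. *)
Definition W4 g J alpha : Prop :=
  exists F theta, Lambda1_embedding g J F /\
    forall X Y Z, alpha X Y Z = F theta X Y Z.

Definition W1_plus_W4 g J alpha : Prop :=
  exists beta gamma, [/\ W1 g J beta, W4 g J gamma &
    forall X Y Z, alpha X Y Z = beta X Y Z + gamma X Y Z].

End PointwiseAlgebra.

Section LeviCivita.
Context {R : realType} {m : nat}.
Local Notation V := 'rV[R]_m.
Implicit Types (G J : V -> 'M[R]_m) (x X Y Z : V).

(* nabla_X Y at x, for the Levi-Civita connection of the metric G on an open *)
(* subset of R^m and constant vector fields X and Y (Koszul formula); see *)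
(* levi_civita_unique below. *)
Definition christoffel G x X Y : V :=
  (2^-1 *: (Y *m 'D_X G x + X *m 'D_Y G x
            - \row_k bilin ('D_(delta_mx 0 k) G x) X Y)) *m invmx (G x).

(* the Kaehler form omega(X,Y) = g(JX,Y) *)
Definition kahler_form G J x : 'M[R]_m := J x *m G x.

(* (nabla_X omega)(Y,Z) at x *)
Definition nabla_kahler G J x X Y Z : R :=
  bilin ('D_X (kahler_form G J) x) Y Z
  - bilin (kahler_form G J x) (christoffel G x X Y) Z
  - bilin (kahler_form G J x) Y (christoffel G x X Z).

Lemma christoffelK G x X Y Z : G x \in unitmx -> differentiable G x ->
  bilin (G x) (christoffel G x X Y) Z =
  2^-1 * (bilin ('D_X G x) Y Z + bilin ('D_Y G x) X Z - bilin ('D_Z G x) X Y).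
Proof.
move=> Gu dG; rewrite /christoffel /bilin mulmxKV// -scalemxAl mxE.
congr (_ * _); rewrite !mulmxDl mulNmx [in LHS]mxE [in LHS]mxE [X in _ + X]mxE.
congr (_ + _ - _).
rewrite [in RHS](row_sum_delta Z) deriveE// linear_sum/=.
rewrite mulmx_sumr mulmx_suml summxE mxE; apply: eq_bigr => k _.
rewrite linearZ/= -scalemxAr -scalemxAl [RHS]mxE mulrC.
by congr (_ * _); rewrite mxE// [in LHS]deriveE.
Qed.

Lemma derive_sym G x X : differentiable G x ->
  (\forall y \near x, (G y)^T = G y) -> ('D_X G x)^T = 'D_X G x.
Proof.
move=> dG sG; rewrite derive_mx; last exact: diff_derivable.
apply/matrixP => i j; rewrite [LHS]mxE [LHS]mxE [RHS]mxE; apply: near_eq_derive.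
by apply: filterS sG => y E; rewrite -[in RHS]E [RHS]mxE.
Qed.

Lemma bilin_sym (B : 'M[R]_m) X Y : B^T = B -> bilin B X Y = bilin B Y X.
Proof.
move=> BT; rewrite /bilin -[in LHS](trmxK (X *m B *m Y^T)) [LHS]mxE.
by rewrite !trmx_mul trmxK BT mulmxA.
Qed.

Lemma bilin_inj (B : 'M[R]_m) X Y : B \in unitmx ->
  (forall Z, bilin B X Z = bilin B Y Z) -> X = Y.
Proof.
move=> Bu XY; rewrite -(mulmxK Bu X) -(mulmxK Bu Y); congr (_ *m _).
apply/rowP => k; have := XY (delta_mx 0 k).
by rewrite /bilin trmx_delta -!colE !mxE.
Qed.

Lemma koszul (T : Type) (h : T -> T -> R) (D : T -> T -> T -> R)
    (Chr Gam : T -> T -> T) :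
  (forall X Y : T, h X Y = h Y X) -> (forall X Y Z : T, D X Y Z = D X Z Y) ->
  (forall X Y : T, (forall Z : T, h X Z = h Y Z) -> X = Y) ->
  (forall X Y Z : T, h (Chr X Y) Z = 2^-1 * (D X Y Z + D Y X Z - D Z X Y)) ->
  ((forall X Y : T, Gam X Y = Gam Y X) /\
   (forall X Y Z : T, D X Y Z = h (Gam X Y) Z + h Y (Gam X Z)))
  <-> (forall X Y : T, Gam X Y = Chr X Y).
Proof.
move=> hC DC hI hChr; split=> [[tf mc] X Y|GamE].
  apply: hI => Z; rewrite hChr !mc (tf Y X) (tf Z X) (tf Z Y).
  by rewrite (hC (Gam X Z) Y); lra.
split=> [X Y|X Y Z]; rewrite !GamE.
  by apply: hI => Z; rewrite !hChr (DC Z X Y); lra.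
by rewrite (hC Y) !hChr (DC Y X Z) (DC Z X Y) (DC X Z Y); lra.
Qed.

(* christoffel is the only connection that is torsion-free and compatible *)
(* with the metric *)
Lemma levi_civita_unique G x (Gam : V -> V -> V) :
  G x \in unitmx -> differentiable G x ->
  (\forall y \near x, (G y)^T = G y) ->
  ((forall X Y, Gam X Y = Gam Y X) /\
   (forall X Y Z, bilin ('D_X G x) Y Z
                  = bilin (G x) (Gam X Y) Z + bilin (G x) Y (Gam X Z)))
  <-> (forall X Y, Gam X Y = christoffel G x X Y).
Proof.
move=> Gu dG sG; apply: (koszul (D := fun X => bilin ('D_X G x))).
- by move=> X Y; apply: bilin_sym; exact: nbhs_singleton sG.
- by move=> X Y Z; apply: bilin_sym; exact: derive_sym.
- by move=> X Y; exact: bilin_inj.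
- by move=> X Y Z; exact: christoffelK.
Qed.

End LeviCivita.

Section AlmostHermitian.
Context {R : realType} {m : nat} (M : manifold R m).

(* components, in each chart, of a bilinear form or of an endomorphism of TM *)
Definition components := chart R m M -> 'rV[R]_m -> 'M[R]_m.

(* (U, g, J) is an almost Hermitian manifold, for U an open subset of M; the *)
(* last two conditions are the tensor transformation laws. *)
Record almost_hermitian (U : set M) (g J : components) : Prop := {
  metric_smooth : forall c, atlas M c ->
    smooth (chart_map c @` (chart_dom c `&` U)) (g c);
  acs_smooth : forall c, atlas M c ->
    smooth (chart_map c @` (chart_dom c `&` U)) (J c);
  fiber_hermitian : forall c p, atlas M c -> chart_dom c p -> U p ->
    hermitian_pair (g c (chart_map c p)) (J c (chart_map c p));
  metric_change : forall c d p, atlas M c -> atlas M d ->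
    chart_dom c p -> chart_dom d p -> U p ->
    let T := 'J (transition c d) (chart_map c p) in
    g c (chart_map c p) = T *m g d (chart_map d p) *m T^T;
  acs_change : forall c d p, atlas M c -> atlas M d ->
    chart_dom c p -> chart_dom d p -> U p ->
    let T := 'J (transition c d) (chart_map c p) in
    J c (chart_map c p) *m T = T *m J d (chart_map d p) }.

(* nabla omega is, over U, a section of the subbundle with fibres W g_p J_p *)
Definition of_type
    (W : 'M[R]_m -> 'M[R]_m ->
         ('rV[R]_m -> 'rV[R]_m -> 'rV[R]_m -> R) -> Prop)
    (U : set M) (g J : components) : Prop :=
  forall c p, atlas M c -> chart_dom c p -> U p ->
    W (g c (chart_map c p)) (J c (chart_map c p))
      (nabla_kahler (g c) (J c) (chart_map c p)).

Definition nearly_kahler (U : set M) (g J : components) : Prop :=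
  almost_hermitian U g J /\ of_type W1 U g J.

Definition smooth_function (U : set M) (f : M -> R) : Prop :=
  forall c, atlas M c ->
    smooth (chart_map c @` (chart_dom c `&` U)) (f \o chart_inv c).

(* the components of f g *)
Definition conformal (f : M -> R) (g : components) : components :=
  fun c x => f (chart_inv c x) *: g c x.

End AlmostHermitian.

(* Main.v *)
Require Import Defs.
From HB Require Import structures.
From mathcomp Require Import all_boot all_order all_algebra.
From mathcomp Require Import all_classical all_reals all_analysis.
From mathcomp Require Import ring lra.

Set Implicit Arguments.
Unset Strict Implicit.
Unset Printing Implicit Defensive.

Import Order.TTheory GRing.Theory Num.Theory.
Import numFieldNormedType.Exports.

Local Open Scope classical_set_scope.
Local Open Scope ring_scope.

(** The covariant derivative of the Kaehler form omega is the sum of a part beta in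
    W1, a 3-form of type (3,0)+(0,3), and of a part in W4.  By Schur's lemma the
    latter is built from a covector (W4_form), so that
    d omega = 3 beta + theta /\ omega, where the Lee form theta is a trace of
    d omega.  When g is replaced by f g, the derivative of log f is added to theta
    and beta is multiplied by f.  It is thus enough to show that theta is closed:
    if P is a primitive of theta on a ball (poincare), then f = exp(- P) removes the
    W4 part of the derivative of the Kaehler form (nabla_scale).

    Closedness (lee_closed) is where dimension six enters.  A form of type
    (3,0)+(0,3) is then the real part of a multiple of the complex determinant
    (W1_components).  Let hat beta be the corresponding imaginary part and N the
    square of the norm of beta.  Where beta does not vanish, there is a 1-form xi
    with
      d beta = xi /\ beta  and  d (hat beta) = xi /\ hat beta - N/12 omega /\ omega.
    These structure equations are pointwise consequences of the type of the
    derivative of omega (structure_equations): the derivative of beta along the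
    canonical Hermitian connection is again of type (3,0)+(0,3), and the torsion of
    that connection is given by beta and theta.  Differentiating the two equations
    once more gives d xi /\ beta = 0 and dN = N (xi - 2 theta) (norm_derivative),
    hence d xi = 2 d theta and d theta /\ beta = 0.  On the other hand d d omega = 0
    gives d theta /\ omega = 3 (theta - xi) /\ beta.  A 2-form with both properties
    is zero (lee_derivative_eq0).  Where beta vanishes identically, d d omega = 0
    reads d theta /\ omega = 0, and wedging with omega is injective on 2-forms
    (wedge_omega_inj).  The two open sets together are dense.

    Everything local is done in one chart.  The Lee form does not depend on the
    chart (lee_form_pullback), so the function exp(- P), pushed to another chart,
    satisfies there the equation Df = - f theta.  This gives its smoothness
    (smooth_of_linear_ode) and the conclusion in every chart. *)

(** * Differentiability and symmetry of second derivatives *)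

Section DirectionalCalculus.
Context {R : realType} {m : nat}.
Local Notation V := 'rV[R]_m.
Implicit Types (f : V -> R) (x y v w : V).

Lemma is_derive_line f y v (t : R) : derivable f (y + t *: v) v ->
  is_derive t 1 (fun s : R => f (y + s *: v)) ('D_v f (y + t *: v)).
Proof.
move=> df.
have E : (fun h : R => h^-1 *: (((fun s : R => f (y + s *: v)) \o shift t) (h *: 1)
             - f (y + t *: v)))
    = (fun h : R => h^-1 *: ((f \o shift (y + t *: v)) (h *: v) - f (y + t *: v))).
  apply/funext => h /=; congr (_ *: (f _ - _)).
  by rewrite [h *: 1]mulr1 scalerDl addrCA addrA.
by split; rewrite /derivable /derive E.
Qed.

Lemma is_derive_of_line f y v : derivable (fun h : R => f (h *: v + y)) 0 1 ->
  is_derive y v f ('D_1 (fun h : R => f (h *: v + y)) 0).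
Proof.
move=> df; split; first exact/derivable1P.
rewrite /derive; congr (lim _).
suff -> : (fun h : R => h^-1 *: ((f \o shift y) (h *: v) - f y))
    = (fun h : R => h^-1 *: (((fun s : R => f (s *: v + y)) \o shift 0) (h *: 1)
         - f (0 *: v + y))) by [].
apply/funext => h /=; rewrite scale0r add0r; congr (_ *: (f (_ *: v + _) - _)).
by rewrite [h *: 1]mulr1 addr0.
Qed.

Lemma MVT_line f y v :
  (forall t : R, 0 <= t <= 1 -> derivable f (y + t *: v) v) ->
  exists2 t : R, 0 <= t <= 1 & f (y + v) - f y = 'D_v f (y + t *: v).
Proof.
move=> df.
have [||t] := @MVT_segment R (fun s : R => f (y + s *: v))
   (fun s => 'D_v f (y + s *: v)) 0 1 ler01.
- by move=> t /[!in_itv]/= /andP[t0 t1]; apply/is_derive_line/df; rewrite !ltW.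
- apply: derivable_within_continuous => t /[!in_itv]/= t01.
  by have [] := is_derive_line (df t t01).
rewrite in_itv/= => t01 E; exists t => //.
by move: E; rewrite scale1r scale0r addr0 subr0 mulr1.
Qed.

Lemma is_derive_scale_dir f x v (a : R) : derivable f x v ->
  is_derive x (a *: v) f (a * 'D_v f x).
Proof.
move=> df.
have [D0 E0] : is_derive (0 : R) 1 (fun h : R => f (x + h *: (a *: v))) (a * 'D_v f x).
  have df' : derivable f (x + (a * 0) *: v) v by rewrite mulr0 scale0r addr0.
  have da : is_derive (0 : R) 1 (fun h : R => a * h) a.
    by apply: is_derive_eq; rewrite [_ *: 1]mulr1.
  have := @is_derive1_comp _ _ (fun h : R => a * h) 0 _ _ (is_derive_line df') da.
  rewrite mulr0 scale0r addr0 mulrC => H.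
  by under eq_fun do rewrite scalerA mulrC.
have E : (fun h : R => h^-1 *: (((fun h : R => f (x + h *: (a *: v))) \o shift 0) (h *: 1)
             - f (x + 0 *: (a *: v))))
    = (fun h : R => h^-1 *: ((f \o shift x) (h *: (a *: v)) - f x)).
  apply/funext => h /=; congr (_ *: (f _ - f _)); last by rewrite scale0r addr0.
  by rewrite [h *: 1]mulr1 addr0 addrC.
by move: D0 E0; rewrite /derivable /derive E => ? ?; split.
Qed.

End DirectionalCalculus.

Lemma differentiable_of_remainder (R : realType) (V W : normedModType R)
    (f : V -> W) (L : {linear V -> W}) (x : V) : continuous L ->
  (forall e : R, 0 < e ->
     exists2 d : R, 0 < d &
       forall h, `|h| < d -> `|f (h + x) - f x - L h| <= e * `|h|) ->
  differentiable f x.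
Proof.
move=> cL fL; suff E : f \o shift x = cst (f x) + L +o_ 0 id.
  by apply/diff_locallyP; have D := diff_unique cL E; rewrite D.
apply/eqaddoP => _/posnumP[e]; have [//|d d0 dP] := fL e%:num.
near=> h; rewrite /= opprD addrA; apply: dP.
by near: h; exact: nbhs0_lt.
Unshelve. all: by end_near. Qed.

Section C1.
Context {R : realType} {m : nat}.
Local Notation V := 'rV[R]_m.
Implicit Types (f : V -> R) (x y v w : V).

Lemma MVT_scale f y v (a : R) :
  (forall s : R, `|s| <= `|a| -> derivable f (y + s *: v) v) ->
  exists2 s : R, `|s| <= `|a| & f (y + a *: v) - f y = a * 'D_v f (y + s *: v).
Proof.
move=> df.
have dl t : 0 <= t <= 1 -> `|t * a| <= `|a|.
  by move=> /andP[t0 t1]; rewrite normrM ger0_norm// ler_piMl.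
have [t t01|t t01 ->] := @MVT_line _ _ f y (a *: v).
  have df' : derivable f (y + t *: (a *: v)) v by rewrite scalerA; exact/df/dl.
  by have [] := is_derive_scale_dir a df'.
exists (t * a); first exact: dl.
have df' : derivable f (y + t *: (a *: v)) v by rewrite scalerA; exact/df/dl.
by rewrite (derive_val (is_derive := is_derive_scale_dir a df')) scalerA.
Qed.

(* the first k coordinates of h *)
Let trunc (h : V) (k : nat) : V := \row_i (h 0 i *+ (i < k)%N).

Let truncS (h : V) (k : 'I_m) : trunc h k.+1 = trunc h k + h 0 k *: delta_mx 0 k.
Proof.
apply/rowP => i; rewrite !mxE eqxx/=; have [->|ik] := eqVneq i k.
  by rewrite ltnSn ltnn mulr1n mulr0n add0r mulr1.
by rewrite mulr0 addr0 ltnS leq_eqVlt (negPf (_ : i != k :> nat)).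
Qed.

Let trunc_norm (h : V) (k : nat) (j : 'I_m) (s : R) : (k <= j)%N -> `|s| <= `|h 0 j| ->
  `|trunc h k + s *: delta_mx 0 j| <= `|h|.
Proof.
move=> kj sj; rewrite [leLHS]/Num.norm/= mx_normrE.
apply: bigmax_le => [|[i0 i] _]; first exact: normr_ge0.
have hi l : `|h 0 l| <= `|h|.
  by rewrite [leRHS]/Num.norm/= mx_normrE (le_bigmax _ (fun i => `|h i.1 i.2|) (0, l)).
rewrite !mxE; have [->|ij] := eqVneq i j.
  by rewrite ltnNge kj/= mulr0n add0r ord1 eqxx mulr1 (le_trans sj).
by rewrite andbF mulr0 addr0; case: ltnP => _; rewrite ?mulr1n ?mulr0n ?normr0.
Qed.

(** Continuous partial derivatives suffice: the increment is telescoped along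
    the coordinate directions and each step is a mean value. *)
Lemma differentiable_of_partials (O : set V) f x : open O ->
  (forall v, (forall y, O y -> derivable f y v) /\ Ck 0 O ('D_v f)) -> O x ->
  differentiable f x.
Proof.
move=> oO C1 Ox.
pose c : 'cV[R]_m := \col_i 'D_(delta_mx 0 i) f x.
pose L (h : V) : R := (h *m c) 0 0.
have LE h : L h = \sum_i h 0 i * 'D_(delta_mx 0 i) f x.
  by rewrite /L mxE; apply: eq_bigr => i _; rewrite mxE.
have linL : linear L by move=> a u v; rewrite /L mulmxDl -scalemxAl [LHS]mxE [X in X + _]mxE.
pose scL := GRing.isLinear.Build _ _ _ _ _ linL.
pose lL : {linear V -> R} := HB.pack L scL.
have cL : continuous lL.
  rewrite (_ : (lL : V -> R) = fun h => \sum_i h 0 i * 'D_(delta_mx 0 i) f x).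
    apply: continuous_big => [|i _]; first exact: add_continuous.
    move=> y; apply: differentiable_continuous; apply: differentiableM => //.
    exact: differentiable_coord.
  by apply/funext => h; exact: LE.
apply: (differentiable_of_remainder cL) => e e0.
pose e' := e / m.+1%:R.
have e'0 : 0 < e' by rewrite divr_gt0.
have : \forall y \near x, O y /\ forall i : 'I_m,
    `|'D_(delta_mx 0 i) f x - 'D_(delta_mx 0 i) f y| < e'.
  apply: filterI; first exact: open_nbhs_nbhs.
  apply: (@filter_forall V 'I_m (fun i y =>
    `|'D_(delta_mx 0 i) f x - 'D_(delta_mx 0 i) f y| < e') _ (nbhs_filter x)) => i.
  have [_ [cD _]] := C1 (delta_mx 0 i).
  by have /cvgrPdist_lt/(_ _ e'0) := cD x Ox.
move=> /nbhs_ballP[d /= d0 dP]; exists d => // h hd.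
have inb (u : V) : `|u| <= `|h| -> ball x d (x + u).
  move=> uh; rewrite -ball_normE/= opprD addrA subrr sub0r normrN.
  exact: le_lt_trans hd.
have tele : f (h + x) - f x =
    \sum_(k < m) (f (x + trunc h k.+1) - f (x + trunc h k)).
  rewrite -(big_mkord xpredT (fun k => f (x + trunc h k.+1) - f (x + trunc h k))).
  rewrite telescope_sumr//; congr (f _ - f _).
    by rewrite addrC; congr (_ + _); apply/rowP => i; rewrite !mxE ltn_ord.
  by rewrite -[LHS]addr0; congr (_ + _); apply/rowP => i; rewrite !mxE mulr0n.
rewrite tele LE -sumrB.
apply: le_trans (ler_norm_sum _ _ _) _.
apply: (@le_trans _ _ (\sum_(i < m) e' * `|h|)).
  apply: ler_sum => k _.
  rewrite truncS addrA.
  have dk s : `|s| <= `|h 0 k| -> ball x d (x + trunc h k + s *: delta_mx 0 k).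
    by move=> sk; rewrite -addrA; apply/inb/trunc_norm.
  have [s sk|s sk ->] := @MVT_scale f (x + trunc h k) (delta_mx 0 k) (h 0 k).
    by have [+ _] := C1 (delta_mx 0 k); apply; have [] := dP _ (dk s sk).
  rewrite -mulrBr normrM mulrC ler_pM//.
    by have [_ /(_ k)/ltW] := dP _ (dk s sk); rewrite distrC.
  by rewrite [leRHS]/Num.norm/= mx_normrE (le_bigmax _ (fun i => `|h i.1 i.2|) (0, k)).
rewrite sumr_const card_ord -mulr_natr /e' mulrAC ler_wpM2r//.
by rewrite -mulrA ler_piMr// ?ltW// mulrC ltr_pdivrMr// mul1r ltr_nat.
Qed.

Lemma C1_differentiable (O : set V) f x : open O -> Ck 1 O f -> O x ->
  differentiable f x.
Proof. by move=> oO [_ C1]; exact: differentiable_of_partials. Qed.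

End C1.

Section Schwarz.
Context {R : realType} {m : nat}.
Local Notation V := 'rV[R]_m.
Implicit Types (f : V -> R) (x y v w : V).

(** The mean value theorem, in the direction v and then in the direction w. *)
Lemma double_difference f x v w (r : R) :
  (forall s t : R, 0 <= s <= 1 -> 0 <= t <= 1 ->
    [/\ derivable f (x + (s * r) *: v + (t * r) *: w) v &
     derivable ('D_v f) (x + (s * r) *: v + (t * r) *: w) w]) ->
  exists s t : R, [/\ 0 <= s <= 1, 0 <= t <= 1 &
    f (x + r *: v + r *: w) - f (x + r *: v) - (f (x + r *: w) - f x)
     = r * r * 'D_w ('D_v f) (x + (s * r) *: v + (t * r) *: w)].
Proof.
move=> H.
have t0 : 0 <= (0 : R) <= 1 by rewrite lexx ler01.
have t1 : 0 <= (1 : R) <= 1 by rewrite lexx ler01.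
pose F y := f (y + r *: w) - f y.
have dF (s : R) : 0 <= s <= 1 ->
    is_derive s 1 (fun s : R => F (x + s *: (r *: v)))
     (r * ('D_v f (x + (s * r) *: v + r *: w) - 'D_v f (x + (s * r) *: v))).
  move=> s01.
  have [d1 _] := H s 1 s01 t1; have [d0 _] := H s 0 s01 t0.
  rewrite mul1r in d1; rewrite mul0r scale0r addr0 in d0.
  have -> : (fun s0 : R => F (x + s0 *: (r *: v))) =
      (fun s0 : R => f (x + r *: w + s0 *: (r *: v)))
      - (fun s0 : R => f (x + s0 *: (r *: v))).
    by apply/funext => z; rewrite /F fctE/= addrAC.
  rewrite mulrBr; apply: is_deriveB.
    have [dd1 E1] := is_derive_scale_dir r d1.
    have dd1' : derivable f (x + r *: w + s *: (r *: v)) (r *: v).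
      by rewrite scalerA addrAC.
    have := is_derive_line dd1'.
    by rewrite [x + r *: w + _]addrAC [in X in is_derive _ _ _ X]scalerA E1.
  have [dd1 E1] := is_derive_scale_dir r d0.
  have dd1' : derivable f (x + s *: (r *: v)) (r *: v) by rewrite scalerA.
  by have := is_derive_line dd1'; rewrite [in X in is_derive _ _ _ X]scalerA E1.
have [||s /[!in_itv]/= s01] := @MVT_segment R (fun s : R => F (x + s *: (r *: v)))
   (fun s => r * ('D_v f (x + (s * r) *: v + r *: w) - 'D_v f (x + (s * r) *: v)))
   0 1 ler01.
- by move=> t /[!in_itv]/= /andP[? ?]; apply: dF; rewrite !ltW.
- by apply: derivable_within_continuous => t /[!in_itv]/= t01; have [] := dF t t01.
rewrite scale1r scale0r addr0 subr0 mulr1 {1 2}/F => E.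
have [t t01|t t01] := @MVT_line _ _ ('D_v f) (x + (s * r) *: v) (r *: w).
  by have [_ d] := H s t s01 t01; have [+ _] := is_derive_scale_dir r d; rewrite scalerA.
have [_ d] := H s t s01 t01; have [_ E1] := is_derive_scale_dir r d.
rewrite scalerA E1 => E2; exists s, t; split => //.
by rewrite E E2 mulrA.
Qed.

Lemma cvg_small_combination x v w (e : R) : 0 < e ->
  \forall r \near 0^'+, forall s t : R, 0 <= s <= 1 -> 0 <= t <= 1 ->
    ball x e (x + (s * r) *: v + (t * r) *: w).
Proof.
move=> e0; pose d := e / (1 + (`|v| + `|w|)).
have n0 : 0 < 1 + (`|v| + `|w|) by rewrite ltr_wpDr// addr_ge0.
near=> r => s t s01 t01.
have r0 : 0 < r by near: r; exact: nbhs_right_gt.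
have rd : r < d by near: r; apply: nbhs_right_lt; rewrite divr_gt0.
rewrite -ball_normE/= -addrA opprD addrA subrr sub0r normrN.
have b (a : R) (u : V) : 0 <= a <= 1 -> `|(a * r) *: u| <= r * `|u|.
  move=> /andP[a0 a1]; rewrite normrZ ler_wpM2r// normrM.
  by rewrite (ger0_norm a0) (gtr0_norm r0) ler_piMl// ltW.
apply: le_lt_trans (ler_normD _ _) _.
apply: le_lt_trans (lerD (b _ v s01) (b _ w t01)) _.
rewrite -mulrDr; move: rd; rewrite /d ltr_pdivlMr// => rd.
by apply: le_lt_trans rd; rewrite ler_wpM2l// ?ltW// ltrDr.
Unshelve. all: by end_near. Qed.

(** Both mixed derivatives are limits of the same double difference quotient. *)
Lemma schwarz (O : set V) f x v w : open O -> Ck 2 O f -> O x ->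
  'D_v ('D_w f) x = 'D_w ('D_v f) x.
Proof.
move=> oO C2 Ox; apply/eqP; rewrite -subr_eq0 -normr_le0.
apply/ler_addgt0Pr => e e0; rewrite add0r.
have e2 : 0 < e / 2 by rewrite divr_gt0.
have swap (a b c d : R) : a - b - (c - d) = a - c - (b - d) by ring.
have close (a b c : R) : `|b - c| < e / 2 -> `|a - c| < e / 2 -> `|a - b| <= e.
  move=> bc ac; have -> : a - b = (a - c) - (b - c) by ring.
  by rewrite (le_trans (ler_normB _ _))// [leRHS](splitr e) lerD// ltW.
have C v' w' : \forall y \near x, O y /\ `|'D_v' ('D_w' f) x - 'D_v' ('D_w' f) y| < e / 2.
  apply: filterI; first exact: open_nbhs_nbhs.
  have [_ /(_ w')[_ [_ /(_ v')[_ [cD _]]]]] := C2.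
  by have /cvgrPdist_lt/(_ _ e2) := cD x Ox.
have : \forall y \near x, (O y /\ `|'D_v ('D_w f) x - 'D_v ('D_w f) y| < e / 2)
   /\ (O y /\ `|'D_w ('D_v f) x - 'D_w ('D_v f) y| < e / 2).
  by apply: filterI; exact: C.
move=> /nbhs_ballP[d /= d0 dP].
have dv (u y : V) : O y -> derivable f y u by have [_ /(_ u)[+ _]] := C2; apply.
have ddv (u u' y : V) : O y -> derivable ('D_u f) y u'.
  by have [_ /(_ u)[_ [_ /(_ u')[+ _]]]] := C2; apply.
near (0:R)^'+ => r.
have r0 : 0 < r by near: r; exact: nbhs_right_gt.
have rP : forall s t : R, 0 <= s <= 1 -> 0 <= t <= 1 ->
    ball x d (x + (s * r) *: v + (t * r) *: w).
  by near: r; exact: cvg_small_combination.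
have [s t s1 t1|s [t [s1 t1 E1]]] := @double_difference f x v w r.
  by have [[? _] _] := dP _ (rP s t s1 t1); split; [exact: dv|exact: ddv].
have [s' t' s1' t1'|s' [t' [s1' t1' E2]]] := @double_difference f x w v r.
  by have [[+ _] _] := dP _ (rP t' s' t1' s1'); rewrite addrAC;
    split; [exact: dv|exact: ddv].
have := dP _ (rP s t s1 t1); have := dP _ (rP t' s' t1' s1').
rewrite (addrAC x ((t' * r) *: v)) => -[[_ +] _] [_ [_ +]].
have E : 'D_w ('D_v f) (x + (s * r) *: v + (t * r) *: w)
    = 'D_v ('D_w f) (x + (s' * r) *: w + (t' * r) *: v).
  have rr : r * r != 0 by rewrite mulf_neq0// gt_eqF.
  apply: (mulfI rr); apply: etrans (esym E1) _; apply: etrans E2.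
  by rewrite (addrAC x (r *: w)); exact: swap.
move=> h1 h2.
have h3 := eq_ind _ (fun z => `|'D_w ('D_v f) x - z| < e / 2) h2 _ E.
exact: (@close _ _ _ h3 h1).
Unshelve. all: by end_near. Qed.

End Schwarz.

Lemma near_open (U : topologicalType) (O : set U) (P : U -> Prop) x :
  open O -> O x -> (forall y, O y -> P y) -> \near x, P x.
Proof. by move=> oO Ox OP; apply: filterS OP _; exact: open_nbhs_nbhs. Qed.

Lemma cont_ext (U W : topologicalType) (O : set U) (f g : U -> W) x : open O ->
  (forall y, O y -> f y = g y) -> O x ->
  {for x, continuous f} -> {for x, continuous g}.
Proof.
move=> oO fg Ox; rewrite /prop_for /continuous_at (fg _ Ox); apply: cvg_trans.
by apply: near_eq_cvg; exact: (near_open (P := fun y => f y = g y) oO Ox fg).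
Qed.

Lemma open_eq_derivable (R : realType) (U W : normedModType R) (O : set U)
    (f g : U -> W) x v : open O -> (forall y, O y -> f y = g y) -> O x ->
  derivable f x v -> derivable g x v.
Proof.
move=> oO fg Ox; apply: near_eq_derivable.
exact: (near_open (P := fun y => f y = g y) oO Ox fg).
Qed.

Lemma open_eq_derive (R : realType) (U W : normedModType R) (O : set U)
    (f g : U -> W) x v : open O -> (forall y, O y -> f y = g y) -> O x ->
  'D_v f x = 'D_v g x.
Proof.
move=> oO fg Ox; apply: near_eq_derive.
exact: (near_open (P := fun y => f y = g y) oO Ox fg).
Qed.

(** * The algebra of C^k functions *)

Section DerivationRules.
Context {R : realType} {V : normedModType R}.
Implicit Types (f g : V -> R) (x v : V).

Lemma is_derive_add f g x v : derivable f x v -> derivable g x v ->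
  is_derive x v (fun y => f y + g y) ('D_v f x + 'D_v g x).
Proof. by move=> df dg; exact: is_deriveD (DeriveDef df erefl) (DeriveDef dg erefl). Qed.

Lemma is_derive_mul f g x v : derivable f x v -> derivable g x v ->
  is_derive x v (fun y => f y * g y) ('D_v f x * g x + f x * 'D_v g x).
Proof.
move=> df dg; apply: is_derive_eq; first exact: is_deriveM.
by rewrite addrC; congr (_ + _); rewrite mulrC.
Qed.

Lemma is_derive_big (I : Type) (r : seq I) (P : pred I) (f : I -> V -> R) x v :
  (forall i, P i -> derivable (f i) x v) ->
  is_derive x v (fun y => \sum_(i <- r | P i) f i y) (\sum_(i <- r | P i) 'D_v (f i) x).
Proof.
move=> df; elim: r => [|i r IH].
  rewrite big_nil (_ : (fun _ => _) = cst 0); first exact: is_derive_cst.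
  by apply/funext => y; rewrite big_nil.
rewrite big_cons (_ : (fun y => _) = fun y =>
   (if P i then f i y else 0) + \sum_(j <- r | P j) f j y); last first.
  by apply/funext => y; rewrite big_cons; case: ifP; rewrite ?add0r.
have [dr Er] := IH.
case: ifP => Pi; first by rewrite -Er; apply: is_derive_add => //; exact: df.
by rewrite (_ : (fun y => _) = fun y => \sum_(j <- r | P j) f j y)//;
   apply/funext => y; rewrite add0r.
Qed.

Lemma is_derive_inv f x v : f x != 0 -> derivable f x v ->
  is_derive x v (fun y => (f y)^-1) (- (f x)^-1 * (f x)^-1 * 'D_v f x).
Proof.
move=> f0 df; split; first exact: derivableV.
by rewrite deriveV// -exprVn expr2 -mulNr; congr (_ * _).
Qed.

End DerivationRules.

Lemma continuous_mxP (R : realType) (U : topologicalType) (p q : nat)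
    (A : U -> 'M[R]_(p, q)) x :
  (forall i j, {for x, continuous (fun y => A y i j)}) <-> {for x, continuous A}.
Proof.
split=> [cA|cA i j].
  apply/cvgrPdist_lt => e e0.
  have : \forall y \near x, forall ij : 'I_p * 'I_q,
      `|A x ij.1 ij.2 - A y ij.1 ij.2| < e.
    apply: (@filter_forall U ('I_p * 'I_q)%type (fun ij y =>
      `|A x ij.1 ij.2 - A y ij.1 ij.2| < e) _ (nbhs_filter x)) => -[i j].
    by have /cvgrPdist_lt/(_ _ e0) := cA i j.
  apply: filterS => y H.
  rewrite [ltLHS]/Num.norm/= mx_normrE; apply: bigmax_lt => // -[i j] _.
  by rewrite !mxE; exact: (H (i, j)).
apply/cvgrPdist_lt => e e0; have /cvgrPdist_lt/(_ _ e0) := cA.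
apply: filterS => y; apply: le_lt_trans.
rewrite [leRHS]/Num.norm/= mx_normrE.
by apply: le_trans (le_bigmax _ _ (i, j)); rewrite !mxE.
Qed.

Section CkTheory.
Context {R : realType} {m : nat}.
Local Notation V := 'rV[R]_m.
Implicit Types (k : nat) (O : set V) (x v : V).

Lemma Ck_cont (W : normedModType R) k O (f : V -> W) x :
  Ck k O f -> O x -> {for x, continuous f}.
Proof. by case: k => [|k] [cf _] /cf. Qed.

Lemma Ck_der (W : normedModType R) k O (f : V -> W) x v :
  Ck k.+1 O f -> O x -> derivable f x v.
Proof. by move=> [_ /(_ v)[+ _]]; apply. Qed.

Lemma Ck_D (W : normedModType R) k O (f : V -> W) v :
  Ck k.+1 O f -> Ck k O ('D_v f).
Proof. by move=> [_ /(_ v)[]]. Qed.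

Lemma CkS (W : normedModType R) k O (f : V -> W) :
  (forall x, O x -> {for x, continuous f}) ->
  (forall v x, O x -> derivable f x v) ->
  (forall v, Ck k O ('D_v f)) -> Ck k.+1 O f.
Proof. by move=> cf df Df; split => // v; split => // x; exact: df. Qed.

Lemma Ck_pred (W : normedModType R) k O (f : V -> W) : Ck k.+1 O f -> Ck k O f.
Proof.
elim: k f => [|k IH] f Cf; first by case: Cf.
apply: CkS => [x Ox|v x Ox|v]; first exact: Ck_cont Cf _.
  exact: Ck_der Cf _.
exact/IH/Ck_D.
Qed.

Lemma Ck_sub (W : normedModType R) k (A B : set V) (f : V -> W) :
  A `<=` B -> Ck k B f -> Ck k A f.
Proof.
move=> AB; elim: k f => [|k IH] f Cf.
  by split => // x /AB; exact: Ck_cont Cf.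
apply: CkS => [x /AB|v x /AB|v]; first exact: Ck_cont Cf.
  exact: Ck_der Cf.
exact/IH/Ck_D.
Qed.

Lemma Ck_ext (W : normedModType R) k O (f g : V -> W) : open O ->
  (forall x, O x -> f x = g x) -> Ck k O f -> Ck k O g.
Proof.
move=> oO; elim: k f g => [|k IH] f g fg Cf.
  by split => // x Ox; apply: cont_ext oO fg Ox (Ck_cont Cf Ox).
apply: CkS => [x Ox|v x Ox|v].
- exact: cont_ext oO fg Ox (Ck_cont Cf Ox).
- exact: open_eq_derivable oO fg Ox (Ck_der Cf Ox).
- by apply: IH (Ck_D v Cf) => x Ox; exact: (open_eq_derive v oO fg Ox).
Qed.

Lemma Ck_cst (W : normedModType R) k O (c : W) : Ck k O (fun=> c).
Proof.
elim: k c => [|k IH] c.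
  by split => // x _; exact: cst_continuous.
apply: CkS => [x _|v x _|v]; first exact: cst_continuous.
  exact: derivable_cst.
rewrite (_ : 'D_v _ = fun=> 0); first exact: IH.
by apply/funext => x; exact: derive_cst.
Qed.

Lemma Ck_add k O (f g : V -> R) : open O ->
  Ck k O f -> Ck k O g -> Ck k O (fun x => f x + g x).
Proof.
move=> oO; elim: k f g => [|k IH] f g Cf Cg.
  by split => // x Ox; apply: continuousD; [exact: (Ck_cont Cf Ox)|exact: (Ck_cont Cg Ox)].
have D v x : O x -> is_derive x v (fun x => f x + g x) ('D_v f x + 'D_v g x).
  by move=> Ox; apply: is_derive_add; [exact: Ck_der Cf _|exact: Ck_der Cg _].
apply: CkS => [x Ox|v x Ox|v].
- by apply: continuousD; [exact: (Ck_cont Cf Ox)|exact: (Ck_cont Cg Ox)].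
- by have [] := D v x Ox.
- by apply: Ck_ext (IH _ _ (Ck_D v Cf) (Ck_D v Cg)) => // x /(D v)[].
Qed.

Lemma Ck_mul k O (f g : V -> R) : open O ->
  Ck k O f -> Ck k O g -> Ck k O (fun x => f x * g x).
Proof.
move=> oO; elim: k f g => [|k IH] f g Cf Cg.
  by split => // x Ox; apply: continuousM; [exact: (Ck_cont Cf Ox)|exact: (Ck_cont Cg Ox)].
have D v x : O x ->
    is_derive x v (fun x => f x * g x) ('D_v f x * g x + f x * 'D_v g x).
  by move=> Ox; apply: is_derive_mul; [exact: Ck_der Cf _|exact: Ck_der Cg _].
apply: CkS => [x Ox|v x Ox|v].
- by apply: continuousM; [exact: (Ck_cont Cf Ox)|exact: (Ck_cont Cg Ox)].
- by have [] := D v x Ox.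
- apply: Ck_ext (Ck_add oO (IH _ _ (Ck_D v Cf) (Ck_pred Cg))
    (IH _ _ (Ck_pred Cf) (Ck_D v Cg))) => // x /(D v)[//].
Qed.

Lemma Ck_opp k O (f : V -> R) : open O -> Ck k O f -> Ck k O (fun x => - f x).
Proof.
move=> oO Cf; apply: Ck_ext (Ck_mul oO (Ck_cst (W := R) k O (-1)) Cf) => // x _.
by rewrite mulN1r.
Qed.

Lemma Ck_inv k O (f : V -> R) : open O -> (forall x, O x -> f x != 0) ->
  Ck k O f -> Ck k O (fun x => (f x)^-1).
Proof.
move=> oO f0; elim: k => [|k IH] Cf.
  by split => // x Ox; apply: continuousV; [exact: f0|exact: (Ck_cont Cf Ox)].
have D v x : O x ->
    is_derive x v (fun x => (f x)^-1) (- (f x)^-1 * (f x)^-1 * 'D_v f x).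
  by move=> Ox; apply: is_derive_inv; [exact: f0|exact: Ck_der Cf _].
apply: CkS => [x Ox|v x Ox|v].
- by apply: continuousV; [exact: f0|exact: (Ck_cont Cf Ox)].
- by have [] := D v x Ox.
- have CV := IH (Ck_pred Cf).
  by apply: Ck_ext (Ck_mul oO (Ck_mul oO (Ck_opp oO CV) CV) (Ck_D v Cf)) => // x /(D v)[].
Qed.

Lemma Ck_sum k O (I : Type) (r : seq I) (P : pred I) (f : I -> V -> R) : open O ->
  (forall i, P i -> Ck k O (f i)) -> Ck k O (fun x => \sum_(i <- r | P i) f i x).
Proof.
move=> oO Cf; elim: r => [|i r IH].
  by apply: Ck_ext (Ck_cst (W := R) k O 0) => // x _; rewrite big_nil.
have C1 : Ck k O (fun x => if P i then f i x else 0).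
  by case Pi : (P i); [exact: Cf|exact: Ck_cst].
apply: Ck_ext (Ck_add oO C1 IH) => // x _; rewrite big_cons.
by case: ifP; rewrite ?add0r.
Qed.

Lemma Ck_prod k O (I : Type) (r : seq I) (P : pred I) (f : I -> V -> R) : open O ->
  (forall i, P i -> Ck k O (f i)) -> Ck k O (fun x => \prod_(i <- r | P i) f i x).
Proof.
move=> oO Cf; elim: r => [|i r IH].
  by apply: Ck_ext (Ck_cst (W := R) k O 1) => // x _; rewrite big_nil.
have C1 : Ck k O (fun x => if P i then f i x else 1).
  by case Pi : (P i); [exact: Cf|exact: Ck_cst].
apply: Ck_ext (Ck_mul oO C1 IH) => // x _; rewrite big_cons.
by case: ifP; rewrite ?mul1r.
Qed.

Lemma Ck_mxP k O (p q : nat) (A : V -> 'M[R]_(p, q)) : open O ->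
  Ck k O A <-> forall i j, Ck k O (fun x => A x i j).
Proof.
move=> oO; elim: k A => [|k IH] A; split => CA.
- by move=> i j; split => // x Ox; apply/continuous_mxP: i j; exact: Ck_cont CA _.
- by split => // x Ox; apply/continuous_mxP => i j; exact: Ck_cont (CA i j) _.
- move=> i j; apply: CkS => [x Ox|v x Ox|v].
  + by apply/continuous_mxP: i j; exact: Ck_cont CA _.
  + by apply/derivable_mxP: i j; exact: Ck_der CA _.
  + have /IH/(_ i j) := Ck_D v CA; apply: Ck_ext => // x Ox.
    by rewrite derive_mx ?mxE//; exact: Ck_der CA _.
- have dA v x : O x -> derivable A x v.
    by move=> Ox; apply/derivable_mxP => i j; exact: Ck_der (CA i j) _.
  apply: CkS => [x Ox|v x|v]; last 2 first.
  + exact: dA.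
  + apply/IH => i j; apply: Ck_ext (Ck_D v (CA i j)) => // x Ox.
    by rewrite derive_mx ?mxE//; exact: dA.
  by apply/continuous_mxP => i j; exact: Ck_cont (CA i j) _.
Qed.

Lemma Ck_det k O (p : nat) (A : V -> 'M[R]_p) : open O ->
  (forall i j, Ck k O (fun x => A x i j)) -> Ck k O (fun x => \det (A x)).
Proof.
move=> oO CA; apply: Ck_sum => // s _; apply: Ck_mul => //; first exact: Ck_cst.
by apply: Ck_prod => // i _.
Qed.

(** By Cramer's rule. *)
Lemma Ck_invmx k O (p : nat) (A : V -> 'M[R]_p) : open O ->
  (forall x, O x -> A x \in unitmx) ->
  (forall i j, Ck k O (fun x => A x i j)) ->
  forall i j, Ck k O (fun x => invmx (A x) i j).
Proof.
move=> oO uA CA i j.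
have Cd : Ck k O (fun x => (\det (A x))^-1).
  apply: Ck_inv => //; last exact: Ck_det.
  by move=> x /uA; rewrite unitmxE unitfE.
have Cc : Ck k O (fun x => cofactor (A x) j i).
  apply: Ck_mul => //; first exact: Ck_cst.
  apply: Ck_det => // a b; apply: Ck_ext (CA (lift j a) (lift i b)) => // x _.
  by rewrite !mxE.
by apply: Ck_ext (Ck_mul oO Cd Cc) => // x /uA; rewrite /invmx => ->; rewrite !mxE.
Qed.

(** Regularity bootstraps along a linear differential equation. *)
Lemma smooth_of_linear_ode O (f : V -> R) (a : V -> V -> R) : open O ->
  (forall x, O x -> {for x, continuous f}) ->
  (forall v, smooth O (fun x => a x v)) ->
  (forall x v, O x -> is_derive x v f (a x v * f x)) -> smooth O f.
Proof.
move=> oO cf sa df; elim=> [|k IH]; first by split.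
apply: CkS => // [v x Ox|v]; first by have [] := df x v Ox.
apply: Ck_ext (Ck_mul oO (sa v k) IH) => // x Ox.
by have [] := df x v Ox.
Qed.

End CkTheory.

(** * Closed 1-forms on a ball *)

Section Poincare.
Context {R : realType} {m : nat}.
Local Notation V := 'rV[R]_m.
Local Notation mu := (@lebesgue_measure R).
Implicit Types (x y v w z : V).

Lemma bounded_on_closed_ball (f : V -> R) (x0 : V) (rho r : R) :
  0 <= rho -> rho < r -> (forall z, `|z - x0| < r -> {for z, continuous f}) ->
  exists M, forall z, `|z - x0| <= rho -> `|f z| <= M.
Proof.
move=> rho0 rr cf; pose A : set V := closed_ball_ Num.norm x0 rho.
have cA : compact A.
  apply: bounded_closed_compact; last exact: closed_closed_ball_.
  exists (`|x0| + rho); split; first exact: num_real.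
  move=> M HM z /=; rewrite /closed_ball_/= => zA; apply: le_trans (ltW HM).
  have -> : z = x0 - (x0 - z) by rewrite opprB addrC subrK.
  by rewrite (le_trans (ler_normB _ _))// lerD2l.
have A0 : A !=set0 by exists x0; rewrite /A /closed_ball_/= subrr normr0.
have [|c cin cmax] := compact_EVT_max A0 cA (f := fun z => `|f z|).
  apply: continuous_in_subspaceT => z; rewrite inE /A /closed_ball_/= distrC => zA.
  apply: (@continuous_comp _ _ _ f (fun u : R => `|u|)); last exact: norm_continuous.
  exact/cf/(le_lt_trans zA).
exists `|f c| => z zA; apply: cmax; rewrite inE /A /closed_ball_/= distrC.
exact: zA.
Qed.

Variables (x0 : V) (r : R) (theta : V -> V -> R).
Let B : set V := [set z | `|z - x0| < r].
Hypothesis theta_linear : forall z, B z -> scalar (theta z).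
Hypothesis theta_C1 : forall v, Ck 1 B (theta^~ v).
Hypothesis theta_closed : forall u v z : V, B z ->
  'D_u (theta^~ v) z = 'D_v (theta^~ u) z.

Let F y := \int[mu]_(t in `[0, 1]) theta (x0 + t *: (y - x0)) (y - x0).

Let oB : open B.
Proof.
rewrite (_ : B = ball x0 r); first exact: ball_open.
by apply/seteqP; split => z; rewrite -ball_normE/= /B/= distrC.
Qed.

Let thetaD z v w (h : R) : B z -> theta z (w + h *: v) = theta z w + h * theta z v.
Proof. by move=> Bz; rewrite addrC (theta_linear Bz) addrC. Qed.

Section Derivative.
Variables (w v : V).
Hypothesis wr : `|w| < r.

(* for |h| < d the segment from x0 to x0 + w + h v stays at distance at most *)
(* rho < r from x0; see zB *)
Let rho : R := (`|w| + r) / 2.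
Let d : R := (rho - `|w|) / (1 + `|v|).

Let rho_r : rho < r.
Proof. by rewrite /rho ltr_pdivrMr// mulr_natr mulr2n ltrD2r. Qed.
Let w_rho : `|w| < rho.
Proof. by rewrite /rho ltr_pdivlMr// mulr_natr mulr2n ltrD2l. Qed.
Let rho0 : 0 <= rho. Proof. by rewrite ltW// (le_lt_trans _ w_rho). Qed.
Let d0 : 0 < d. Proof. by rewrite divr_gt0// ?subr_gt0// ltr_wpDr. Qed.

Let z (h t : R) : V := x0 + t *: (w + h *: v).

Let zB (h t : R) : `|h| < d -> 0 <= t <= 1 -> `|z h t - x0| <= rho.
Proof.
move=> hd /andP[t0 t1]; rewrite /z addrAC subrr add0r normrZ ger0_norm//.
apply: (@le_trans _ _ `|w + h *: v|); first by rewrite ler_piMl.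
apply: le_trans (ler_normD _ _) _; rewrite -lerBrDl normrZ.
have n1 : 0 < 1 + `|v| by rewrite ltr_wpDr.
move: hd; rewrite /d ltr_pdivlMr// => hd'.
by apply: le_trans (ltW hd'); rewrite ler_wpM2l// lerDr.
Qed.

Let zB' (h t : R) : `|h| < d -> 0 <= t <= 1 -> B (z h t).
Proof. by move=> hd t01; apply: le_lt_trans rho_r; exact: zB. Qed.

(* the integrand of F at x0 + w + h v, and its derivative in h *)
Let f (h t : R) := theta (z h t) w + h * theta (z h t) v.

Let df (h t : R) := t * ('D_v (theta^~ w) (z h t) + h * 'D_v (theta^~ v) (z h t))
   + theta (z h t) v.

Let is_derive_z (u : V) (h t : R) : `|h| < d -> 0 <= t <= 1 ->
  is_derive h 1 (fun s => theta (z s t) u) (t * 'D_v (theta^~ u) (z h t)).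
Proof.
move=> hd t01; have Bz := zB' hd t01.
have E (s : R) : z s t = (x0 + t *: w) + s *: (t *: v).
  by rewrite /z scalerDr addrA !scalerA (mulrC s).
have dz := Ck_der (v := v) (theta_C1 u) Bz.
have [D1 E1] := is_derive_scale_dir t dz.
have := is_derive_line (f := theta^~ u) (y := x0 + t *: w) (v := t *: v) (t := h).
by rewrite -E E1 (_ : (fun s => theta (x0 + _ + _) u) = fun s => theta (z s t) u);
  [apply|apply/funext => s; rewrite E].
Qed.

Let is_derive_f (h t : R) : `|h| < d -> 0 <= t <= 1 -> is_derive h 1 (f^~ t) (df h t).
Proof.
move=> hd t01.
have [D1 E1] := is_derive_z w hd t01; have [D2 E2] := is_derive_z v hd t01.
have did : derivable (id : R -> R) h 1 by exact: derivable_id.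
have [D3 E3] := is_derive_mul did D2.
have [D4 E4] := is_derive_add D1 D3.
apply: DeriveDef => //; rewrite E4 E3 E1 E2 derive_id /df/=; ring.
Qed.

Let is_derive_ray (u : V) (t : R) : 0 <= t <= 1 ->
  is_derive t 1 (fun s => theta (z 0 s) u) ('D_w (theta^~ u) (z 0 t)).
Proof.
move=> t01; have n0 : `|0 : R| < d by rewrite normr0.
have Bz := zB' n0 t01; have dz := Ck_der (v := w) (theta_C1 u) Bz.
have E s : z 0 s = x0 + s *: w by rewrite /z scale0r addr0.
have -> : (fun s => theta (z 0 s) u) = fun s => theta (x0 + s *: w) u.
  by apply/funext => s; rewrite E.
by rewrite E in dz *; exact: (is_derive_line (f := theta^~ u)).
Qed.

Let continuous_along (u : V) (h t : R) : `|h| < d -> 0 <= t <= 1 ->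
  {for t, continuous (fun s : R => theta (z h s) u)}.
Proof.
move=> hd t01; apply: (@continuous_comp _ _ _ (z h) (theta^~ u)).
  apply: cvgD; first exact: cvg_cst.
  by apply: cvgZr_tmp; exact: cvg_id.
exact: (Ck_cont (theta_C1 u) (zB' hd t01)).
Qed.

Let integrable_f (h : R) : `|h| < d -> mu.-integrable `[0, 1] (EFin \o f h).
Proof.
move=> hd; apply: continuous_compact_integrable; first exact: segment_compact.
apply: continuous_in_subspaceT => t; rewrite inE/= in_itv/= => t01.
apply: (@continuousD _ _ _ (fun t => theta (z h t) w)); first exact: continuous_along.
by apply: continuousM; [exact: cst_continuous|exact: continuous_along].
Qed.

Let bounded_df : exists M : R, forall h t : R, `|h| < d -> 0 <= t <= 1 -> `|df h t| <= M.
Proof.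
have cD u z' : `|z' - x0| < r -> {for z', continuous ('D_v (theta^~ u))}.
  by move=> Bz; apply: (Ck_cont (Ck_D v (theta_C1 u))).
have [M1 H1] := bounded_on_closed_ball rho0 rho_r (cD w).
have [M2 H2] := bounded_on_closed_ball rho0 rho_r (cD v).
have [M3 H3] := bounded_on_closed_ball rho0 rho_r
  (fun z' Bz => Ck_cont (theta_C1 v) (Bz : B z')).
exists (M1 + d * M2 + M3) => h t hd t01; have zr := zB hd t01.
apply: le_trans (ler_normD _ _) _; apply: lerD; last exact: H3.
rewrite normrM; move: (t01) => /andP[t0 t1]; rewrite ger0_norm//.
apply: (@le_trans _ _ `|'D_v (theta^~ w) (z h t) + h * 'D_v (theta^~ v) (z h t)|).
  by rewrite ler_piMl.
apply: le_trans (ler_normD _ _) _; apply: lerD; first exact: H1.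
by rewrite normrM ler_pM// ?H2// ltW.
Qed.

(* as theta is closed, the integrand is the derivative of t theta(x0 + t w)(v) *)
Let integral_df : \int[mu]_(t in `[0, 1]) df 0 t = theta (x0 + w) v.
Proof.
have n0 : `|0 : R| < d by rewrite normr0.
have dF (t : R) : 0 <= t <= 1 -> is_derive t 1 (fun s : R => s * theta (z 0 s) v) (df 0 t).
  move=> t01; have [D1 E1] := is_derive_ray v t01.
  have did : derivable (id : R -> R) t 1 by exact: derivable_id.
  have [D3 E3] := is_derive_mul did D1.
  apply: DeriveDef => //; rewrite E3 E1 derive_id /df/=.
  by rewrite (theta_closed _ _ (zB' n0 t01)); ring.
have cF (t : R) : 0 <= t <= 1 -> {for t, continuous (fun s : R => s * theta (z 0 s) v)}.
  move=> /dF[D _]; exact/differentiable_continuous/derivable1_diffP.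
rewrite /Rintegral (@continuous_FTC2 _ (df 0) (fun s : R => s * theta (z 0 s) v) 0 1) ?ltr01//.
- by rewrite /= mul1r mul0r subr0 /z scale0r addr0 scale1r.
- apply: continuous_in_subspaceT => t; rewrite inE/= in_itv/= => t01.
  have cz : {for t, continuous (z 0)}.
    apply: cvgD; first exact: cvg_cst.
    by apply: cvgZr_tmp; exact: cvg_id.
  have cDz u : {for t, continuous (fun s : R => 'D_v (theta^~ u) (z 0 s))}.
    apply: (@continuous_comp _ _ _ (z 0) ('D_v (theta^~ u))) => //.
    exact: (Ck_cont (Ck_D v (theta_C1 u)) (zB' n0 t01)).
  apply: (@continuousD _ _ _ (fun s : R => s * _)); last exact: continuous_along.
  apply: (@continuousM _ _ (fun s : R => s)); first exact: cvg_id.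
  apply: continuousD; first exact: cDz.
  by apply: continuousM; [exact: cst_continuous|exact: cDz].
- split.
  + move=> t; rewrite in_itv/= => /andP[t0 t1].
    have t01 : 0 <= t <= 1 by rewrite !ltW.
    by have [] := dF t t01.
  + by apply/cvg_at_right_filter/cF; rewrite lexx ler01.
  + by apply/cvg_at_left_filter/cF; rewrite lexx ler01.
- move=> t; rewrite in_itv/= => /andP[t0 t1].
  have t01 : 0 <= t <= 1 by rewrite !ltW.
  by have [_ <-] := dF t t01; rewrite derive1E.
Qed.

(** Differentiation under the integral sign; the derivative of the integrand is
    bounded, by compactness of the closed ball of radius rho. *)
Lemma ray_integral_derive : is_derive (x0 + w) v F (theta (x0 + w) v).
Proof.
have [M HM] := bounded_df.
have M0 : 0 <= M.
  by apply: le_trans (HM 0 0 _ _) => //; rewrite ?normr0// lexx ler01.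
have I0 : (0 : R) \in `](- d), d[ by rewrite in_itv/= oppr_lt0 d0.
have Id (h : R) : `](- d), d[%classic h -> `|h| < d by rewrite /= in_itv/= ltr_norml.
have i01 (t : R) : `[0, 1]%classic t -> 0 <= t <= 1 by rewrite /= in_itv.
have d1 (h t : R) : `](- d), d[%classic h -> `[0, 1]%classic t ->
    partial1of2 f h t = df h t.
  move=> /Id hd /i01 t01; rewrite partial1of2E.
  by have [_ ->] := is_derive_f hd t01.
have iM : mu.-integrable `[0, 1] (EFin \o (fun=> M)).
  apply: continuous_compact_integrable; first exact: segment_compact.
  by apply: continuous_subspaceT => t; exact: cvg_cst.
have mI : measurable (`[0, 1]%classic : set (measurableTypeR R)).
  exact: measurable_itv.
have intf (h : R) : `](- d), d[%classic h -> mu.-integrable `[0, 1] (EFin \o f h).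
  by move=> /Id; exact: integrable_f.
have derf (h t : R) : `](- d), d[%classic h -> `[0, 1]%classic t -> derivable (f^~ t) h 1.
  by move=> /Id hd /i01 t01; have [] := is_derive_f hd t01.
have ubG (h t : R) : `](- d), d[%classic h -> `[0, 1]%classic t -> `|partial1of2 f h t| <= M.
  by move=> Ih It; rewrite d1//; apply: HM; [exact: Id|exact: i01].
pose P (h : R) := \int[mu]_(t in `[0, 1]) f h t.
have dP : derivable P 0 1.
  exact: (@derivable_under_integral _ _ _ mu f _ mI 0 (- d) d I0 intf derf (fun=> M) (fun=> M0) iM ubG).
have eP : 'D_1 P 0 = theta (x0 + w) v.
  rewrite -derive1E.
  rewrite (@differentiation_under_integral _ _ _ mu f _ mI 0 (- d) d I0 intf derf (fun=> M) (fun=> M0) iM ubG).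
  rewrite -integral_df; apply: eq_Rintegral => t; rewrite inE => It.
  by rewrite d1.
have EF (h : R) : `](- d), d[%classic h -> P h = F (h *: v + (x0 + w)).
  move=> Ih; apply: eq_Rintegral => t; rewrite inE => It.
  have -> : h *: v + (x0 + w) - x0 = w + h *: v.
    by rewrite addrCA addrAC subrr add0r addrC.
  by rewrite thetaD//; exact: (zB' (Id _ Ih) (i01 _ It)).
have oI : open (`](- d), d[%classic : set R) by exact: interval_open.
have dF : derivable (fun h : R => F (h *: v + (x0 + w))) 0 1.
  exact: open_eq_derivable oI EF I0 dP.
have EF' := open_eq_derive (U := R) (1 : R) oI EF I0.
have [D E] := is_derive_of_line dF.
split; first exact: D.
exact: etrans E (etrans (esym EF') eP).
Qed.

End Derivative.

(** On a ball a closed 1-form is exact: a primitive is its integral along the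
    rays from the centre, and closedness turns the derivative of the integrand
    into the total derivative of t theta. *)
Lemma poincare : exists2 P : V -> R,
  (forall z, B z -> {for z, continuous P}) &
  forall z v, B z -> is_derive z v P (theta z v).
Proof.
have dF z v : B z -> is_derive z v F (theta z v).
  move=> Bz; have E : x0 + (z - x0) = z by rewrite addrC subrK.
  by rewrite -E; exact: ray_integral_derive.
exists F => // z Bz; apply: differentiable_continuous.
apply: (differentiable_of_partials oB) => // v; split=> [y By|].
  by have [] := dF y v By.
apply: (Ck_ext oB _ (Ck_pred (theta_C1 v))) => y By.
by have [_ ->] := dF y v By.
Qed.

End Poincare.

(** * Unitary frames *)

Section Multilinear.
Context {R : realType}.
Local Notation V := 'rV[R]_6.
Implicit Types (X Y Z W : V) (g J : 'M[R]_6) (f : V -> R).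

Lemma scalarD f X Y : scalar f -> f (X + Y) = f X + f Y.
Proof. by move=> lf; rewrite -[X]scale1r lf mul1r scale1r. Qed.

Lemma scalar0 f : scalar f -> f 0 = 0.
Proof. by move=> lf; have := lf (-1) 0 0; rewrite scaler0 addr0 mulN1r addNr. Qed.

Lemma scalarZ f (a : R) X : scalar f -> f (a *: X) = a * f X.
Proof. by move=> lf; rewrite -[a *: X]addr0 lf scalar0// addr0. Qed.

Lemma scalarN f X : scalar f -> f (- X) = - f X.
Proof. by move=> lf; rewrite -scaleN1r scalarZ// mulN1r. Qed.

Lemma scalar_sum f (I : Type) (r : seq I) (P : pred I) (v : I -> V) : scalar f ->
  f (\sum_(i <- r | P i) v i) = \sum_(i <- r | P i) f (v i).
Proof.
move=> lf; elim/big_rec2: _ => [|i x y _ <-]; first exact: scalar0.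
by rewrite scalarD.
Qed.

Lemma bilinDl g X Y Z : bilin g (X + Y) Z = bilin g X Z + bilin g Y Z.
Proof. by rewrite /bilin !mulmxDl mxE. Qed.

Lemma bilinDr g X Y Z : bilin g X (Y + Z) = bilin g X Y + bilin g X Z.
Proof. by rewrite /bilin linearD/= mulmxDr mxE. Qed.

Lemma bilinZl g (a : R) X Y : bilin g (a *: X) Y = a * bilin g X Y.
Proof. by rewrite /bilin -!scalemxAl mxE. Qed.

Lemma bilinZr g (a : R) X Y : bilin g X (a *: Y) = a * bilin g X Y.
Proof. by rewrite /bilin linearZ/= -scalemxAr mxE. Qed.

Lemma scalar_bilinl g Y : scalar (fun X => bilin g X Y).
Proof. by move=> a X Z; rewrite bilinDl bilinZl. Qed.

Lemma scalar_bilinr g X : scalar (fun Y => bilin g X Y).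
Proof. by move=> a Y Z; rewrite bilinDr bilinZr. Qed.

Lemma bilinNl g X Y : bilin g (- X) Y = - bilin g X Y.
Proof. exact: (scalarN _ (scalar_bilinl g Y)). Qed.

Lemma bilinNr g X Y : bilin g X (- Y) = - bilin g X Y.
Proof. exact: (scalarN _ (scalar_bilinr g X)). Qed.

Lemma bilin_mul g X Y (A B : 'M[R]_6) :
  bilin g (X *m A) (Y *m B) = bilin (A *m g *m B^T) X Y.
Proof. by rewrite /bilin trmx_mul !mulmxA. Qed.

Lemma bilin_ext g h : (forall X Y, bilin g X Y = bilin h X Y) -> g = h.
Proof.
move=> E; apply/matrixP => i j; have := E (delta_mx 0 i) (delta_mx 0 j).
by rewrite /bilin !trmx_delta -!rowE -!colE !mxE.
Qed.

Definition trilinear (alpha : V -> V -> V -> R) :=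
  [/\ forall Y Z, scalar (fun X => alpha X Y Z),
      forall X Z, scalar (fun Y => alpha X Y Z) &
      forall X Y, scalar (fun Z => alpha X Y Z)].

Lemma sum6E (T : nmodType) (f : nat -> T) :
  \sum_(i < 6) f i = f 0%N + (f 1%N + (f 2%N + (f 3%N + (f 4%N + f 5%N)))).
Proof. by rewrite !big_ord_recl big_ord0 addr0. Qed.

End Multilinear.

Section Hermitian.
Context {R : realType} (g J : 'M[R]_6).
Local Notation V := 'rV[R]_6.
Implicit Types (X Y Z W a b c t : V).
Hypothesis gJ : hermitian_pair g J.

Let gC X Y : bilin g X Y = bilin g Y X. Proof. by case: gJ. Qed.
Let gJJ X Y : bilin g (X *m J) (Y *m J) = bilin g X Y. Proof. by case: gJ. Qed.

Lemma mulJJ X : X *m J *m J = - X.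
Proof. by case: gJ => _ _ JJ _; rewrite -mulmxA JJ mulmxN mulmx1. Qed.

Lemma metric_tr : g^T = g.
Proof.
apply: bilin_ext => X Y; rewrite gC /bilin -[in LHS](trmxK (X *m g^T *m Y^T)).
by rewrite [in LHS]mxE !trmx_mul !trmxK mulmxA.
Qed.

Lemma metric_unit : g \in unitmx.
Proof.
rewrite -row_free_unit -kermx_eq0; apply/eqP/row_matrixP => i; rewrite row0.
apply/eqP; apply: contraT => n0; have [_ /(_ _ n0)+ _ _] := gJ.
by rewrite /bilin -row_mul mulmx_ker row0 mul0mx mxE ltxx.
Qed.

Lemma metric_skew X Y : bilin g (X *m J) Y = - bilin g X (Y *m J).
Proof. by rewrite -gJJ mulJJ bilinNl. Qed.

Lemma metric_XJX X : bilin g X (X *m J) = 0.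
Proof.
have := metric_skew X X; rewrite gC => /eqP.
by rewrite -subr_eq0 opprK -mulr2n mulrn_eq0/= => /eqP.
Qed.

(** The order is a, b, c, Ja, Jb, Jc.  Frames are indexed by nat, so that component
    formulas are evaluated by cases on numerals. *)
Definition frame_of a b c (i : nat) : V :=
  match i with
  | 0%N => a | 1%N => b | 2%N => c
  | 3%N => a *m J | 4%N => b *m J | 5%N => c *m J | _ => 0
  end.

Definition unitary_frame (e : nat -> V) : Prop :=
  [/\ e 3%N = e 0%N *m J, e 4%N = e 1%N *m J, e 5%N = e 2%N *m J &
      forall i j, (i < 6)%N -> (j < 6)%N -> bilin g (e i) (e j) = (i == j)%:R].

Lemma frame_ofP a b c :
  bilin g a a = 1 -> bilin g b b = 1 -> bilin g c c = 1 ->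
  bilin g a b = 0 -> bilin g a c = 0 -> bilin g b c = 0 ->
  bilin g a (b *m J) = 0 -> bilin g a (c *m J) = 0 -> bilin g b (c *m J) = 0 ->
  unitary_frame (frame_of a b c).
Proof.
move=> aa bb cc ab ac bc aJb aJc bJc; split => //.
have baJ : bilin g b (a *m J) = 0 by rewrite gC metric_skew aJb oppr0.
have caJ : bilin g c (a *m J) = 0 by rewrite gC metric_skew aJc oppr0.
have cbJ : bilin g c (b *m J) = 0 by rewrite gC metric_skew bJc oppr0.
have [ba [ca cb]] : bilin g b a = 0 /\ bilin g c a = 0 /\ bilin g c b = 0.
  by rewrite !(gC _ a) (gC c b).
case=> [|[|[|[|[|[|//]]]]]] [|[|[|[|[|[|//]]]]]] _ _ /=;
  by rewrite ?gJJ ?(gC (_ *m J)) ?metric_XJX ?aa ?bb ?cc ?ab ?ac ?bc ?ba ?ca ?cb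
    ?aJb ?aJc ?bJc ?baJ ?caJ ?cbJ.
Qed.

Lemma normalize X : X != 0 -> exists k : R, k != 0 /\ bilin g (k *: X) (k *: X) = 1.
Proof.
move=> n0; have [_ /(_ _ n0) gX _ _] := gJ.
exists (Num.sqrt (bilin g X X))^-1; split.
  by rewrite invr_eq0 gt_eqF// sqrtr_gt0.
rewrite bilinZl bilinZr mulrA -invfM -expr2 sqr_sqrtr ?ltW// mulVf// gt_eqF//.
Qed.

Lemma exists_unit_orthogonal (k : nat) (v : 'I_k -> V) : (k < 6)%N ->
  exists2 X, bilin g X X = 1 & forall i, bilin g (v i) X = 0.
Proof.
move=> k6; pose A : 'M[R]_(6, k) := \matrix_(r, i) (g *m (v i)^T) r 0.
have : kermx A != 0.
  rewrite -mxrank_eq0 mxrank_ker -lt0n subn_gt0.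
  exact: leq_ltn_trans (rank_leq_col A) k6.
move=> /rowV0Pn[X XA n0].
have [s [s0 sX]] := normalize n0.
exists (s *: X) => // i; rewrite gC bilinZl.
have /sub_kermxP/rowP/(_ i) := XA.
rewrite [in X in _ -> X](_ : bilin g X (v i) = (X *m A) 0 i); last first.
  rewrite /bilin -mulmxA !mxE; apply: eq_bigr => r _; congr (_ * _).
  by rewrite /A [RHS]mxE.
by move=> ->; rewrite mxE mulr0.
Qed.

(** Gram-Schmidt, starting from a prescribed direction. *)
Lemma exists_unitary_frame t : t != 0 ->
  exists2 e, unitary_frame e & exists k : R, t = k *: e 0%N.
Proof.
move=> t0; have [k [k0 aa]] := normalize t0; set a := k *: t in aa.
have [b bb bP] := @exists_unit_orthogonal 2 (fun i => [eta (fun=> a) with 1%N |-> a *m J] (i : nat)) isT.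
have ab := bP ord0; have aJb := bP (Ordinal (isT : 1 < 2)%N).
rewrite /= in ab aJb.
have [c cc cP] := @exists_unit_orthogonal 4
  (fun i => [eta (fun=> a) with 1%N |-> a *m J, 2%N |-> b, 3%N |-> b *m J] (i : nat)) isT.
have ac := cP ord0; have aJc := cP (Ordinal (isT : 1 < 4)%N).
have bc := cP (Ordinal (isT : 2 < 4)%N); have bJc := cP (Ordinal (isT : 3 < 4)%N).
rewrite /= in ac aJc bc bJc.
exists (frame_of a b c).
  by apply: frame_ofP => //; apply/eqP; rewrite -oppr_eq0 -metric_skew; apply/eqP.
by exists k^-1; rewrite /= /a scalerA mulVf// scale1r.
Qed.

Lemma exists_frame : exists e, unitary_frame e.
Proof.
have d0 : delta_mx 0 0 != 0 :> V.
  by apply/eqP => /matrixP/(_ 0 0); rewrite !mxE !eqxx => /eqP; rewrite oner_eq0.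
by have [e eP _] := exists_unitary_frame d0; exists e.
Qed.

Section Frame.
Variable e : nat -> V.
Hypothesis eP : unitary_frame e.

Let gee i j : (i < 6)%N -> (j < 6)%N -> bilin g (e i) (e j) = (i == j)%:R.
Proof. by case: eP => _ _ _; apply. Qed.

Let P : 'M[R]_6 := \matrix_(i < 6) e i.

Let PgP : P *m g *m P^T = 1%:M.
Proof.
apply/matrixP => i j; rewrite [RHS]mxE -val_eqE -gee; [|exact: ltn_ord..].
rewrite /bilin [LHS]mxE [RHS]mxE; apply: eq_bigr => l _.
rewrite [P^T _ _]mxE [P _ _]mxE [(e j)^T _ _]mxE; congr (_ * _).
by rewrite [LHS]mxE [RHS]mxE; apply: eq_bigr => r _; rewrite !mxE.
Qed.

Lemma frame_matrix_inv : invmx g = P^T *m P.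
Proof.
have gPP : g *m (P^T *m P) = 1%:M.
  by rewrite mulmxA; have := PgP; rewrite -mulmxA => /mulmx1C.
by rewrite -[RHS](mulKmx metric_unit) gPP mulmx1.
Qed.

Lemma frame_expand X : X = \sum_(i < 6) bilin g X (e i) *: e i.
Proof.
rewrite -[LHS](mulmxK metric_unit) frame_matrix_inv mulmxA.
rewrite [LHS]mulmx_sum_row; apply: eq_bigr => i _.
rewrite rowK; congr (_ *: _); rewrite /bilin [LHS]mxE [RHS]mxE.
by apply: eq_bigr => l _; rewrite !mxE.
Qed.

Lemma scalar_frame (f : V -> R) X : scalar f ->
  f X = \sum_(i < 6) bilin g X (e i) * f (e i).
Proof.
move=> lf; rewrite {1}(frame_expand X) (scalar_sum _ _ _ lf).
by apply: eq_bigr => i _; rewrite scalarZ.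
Qed.

Lemma scalar_ext (f h : V -> R) : scalar f -> scalar h ->
  (forall i, (i < 6)%N -> f (e i) = h (e i)) -> f =1 h.
Proof.
move=> lf lh E X; rewrite (scalar_frame _ lf) (scalar_frame _ lh).
by apply: eq_bigr => i _; rewrite E.
Qed.

Lemma trilinear_ext (f h : V -> V -> V -> R) : trilinear f -> trilinear h ->
  (forall i j k, (i < 6)%N -> (j < 6)%N -> (k < 6)%N ->
     f (e i) (e j) (e k) = h (e i) (e j) (e k)) ->
  forall X Y Z, f X Y Z = h X Y Z.
Proof.
move=> [f1 f2 f3] [h1 h2 h3] E X Y Z.
apply: (scalar_ext (f1 Y Z) (h1 Y Z)) => i i6.
apply: (scalar_ext (f2 _ Z) (h2 _ Z)) => j j6.
by apply: (scalar_ext (f3 _ _) (h3 _ _)) => k k6; exact: E.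
Qed.

Lemma frameJ : [/\ e 0%N *m J = e 3%N, e 1%N *m J = e 4%N, e 2%N *m J = e 5%N,
  e 3%N *m J = - e 0%N & e 4%N *m J = - e 1%N /\ e 5%N *m J = - e 2%N].
Proof. by case: eP => -> -> -> _; rewrite !mulJJ. Qed.

Lemma frame_change e' : unitary_frame e' ->
  exists2 A, unitary_endo g J A & forall i, (i < 6)%N -> e i *m A = e' i.
Proof.
move=> e'P; pose A : 'M[R]_6 := g *m P^T *m \matrix_(i < 6) e' i.
have AE X : X *m A = \sum_(i < 6) bilin g X (e i) *: e' i.
  rewrite /A mulmxA mulmx_sum_row; apply: eq_bigr => i _.
  rewrite rowK; congr (_ *: _); rewrite mulmxA /bilin [LHS]mxE [RHS]mxE.
  by apply: eq_bigr => l _; rewrite !mxE.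
have eA i : (i < 6)%N -> e i *m A = e' i.
  move=> i6; rewrite AE (bigD1 (Ordinal i6))//= gee// eqxx scale1r big1 ?addr0//.
  move=> j ji; rewrite gee// (_ : (i == j) = false) ?scale0r//.
  by apply: contraNF ji => /eqP E; apply/eqP/val_inj.
clearbody A; exists A => //; split.
  move=> X Y; apply: (scalar_ext (f := fun X => bilin g (X *m A) (Y *m A))
    (h := fun X => bilin g X Y)).
  - by move=> s U W; rewrite mulmxDl -scalemxAl bilinDl bilinZl.
  - exact: scalar_bilinl.
  move=> i i6; apply: (scalar_ext (f := fun Y => bilin g (e i *m A) (Y *m A))
    (h := fun Y => bilin g (e i) Y)).
  - by move=> s U W; rewrite mulmxDl -scalemxAl bilinDr bilinZr.
  - exact: scalar_bilinr.
  by move=> j j6; rewrite !eA// gee//; case: e'P => _ _ _ ->.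
suff E X : X *m (A *m J) = X *m (J *m A).
  by apply/row_matrixP => i; rewrite !rowE E.
have [E0 E1 E2 E3 [E4 E5]] := frameJ.
have [F3 F4 F5 _] := e'P.
have F X' : X' *m J *m J = - X' by exact: mulJJ.
rewrite !mulmxA (frame_expand X) !mulmx_suml; apply: eq_bigr => i _.
rewrite -!scalemxAl; congr (_ *: _); rewrite eA//.
by case: i => -[|[|[|[|[|[|//]]]]]] i6 /=;
  rewrite ?E0 ?E1 ?E2 ?E3 ?E4 ?E5 ?mulNmx ?eA// ?F3 ?F4 ?F5 ?F.
Qed.

End Frame.

Definition mtrace (phi : V -> V -> R) : R :=
  \sum_(i < 6) \sum_(j < 6) invmx g i j * phi (delta_mx 0 i) (delta_mx 0 j).

Lemma mtraceE (e : nat -> V) (phi : V -> V -> R) : unitary_frame e ->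
  (forall Y, scalar (phi^~ Y)) -> (forall X, scalar (phi X)) ->
  mtrace phi = \sum_(a < 6) phi (e a) (e a).
Proof.
move=> eP l1 l2.
have ea (a : 'I_6) : phi (e a) (e a) =
    \sum_(i < 6) \sum_(j < 6) e a 0 i * e a 0 j * phi (delta_mx 0 i) (delta_mx 0 j).
  rewrite [X in phi X _](row_sum_delta (e a)) (scalar_sum _ _ _ (l1 _)); apply: eq_bigr => i _.
  rewrite (scalarZ _ _ (l1 _)) [X in phi _ X](row_sum_delta (e a)) (scalar_sum _ _ _ (l2 _)).
  rewrite mulr_sumr; apply: eq_bigr => j _.
  by rewrite (scalarZ _ _ (l2 _)) mulrA.
rewrite (eq_bigr _ (fun (i : 'I_6) _ => ea i)) exchange_big/=; apply: eq_bigr => i _.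
rewrite exchange_big/=; apply: eq_bigr => j _.
rewrite -mulr_suml; congr (_ * _); rewrite (frame_matrix_inv eP) mxE.
by apply: eq_bigr => a _; rewrite !mxE.
Qed.

End Hermitian.

(** * The components W1 and W4 of the derivative of the Kaehler form *)

Section GrayHervella.
Context {R : realType} (g J : 'M[R]_6).
Local Notation V := 'rV[R]_6.
Implicit Types (X Y Z W : V) (mu theta : V -> R) (alpha beta : V -> V -> V -> R).
Hypothesis gJ : hermitian_pair g J.

(** The copy of the covectors in the space of all possible values of the
    covariant derivative of the Kaehler form. *)
Definition covector_part mu X Y Z : R :=
  bilin g X Y * mu Z - bilin g X Z * mu Y
  - bilin g X (Y *m J) * mu (Z *m J) + bilin g X (Z *m J) * mu (Y *m J).

Lemma covector_part_trilinear mu : scalar mu -> trilinear (covector_part mu).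
Proof.
move=> lm; split=> [Y Z|X Z|X Y] a U W; rewrite /covector_part;
  by rewrite ?mulmxDl -?scalemxAl ?bilinDl ?bilinDr ?bilinZl ?bilinZr
    ?(scalarD _ _ lm) ?(scalarZ _ _ lm); ring.
Qed.

Lemma GH_shift alpha X Y Z : GH_space J alpha ->
  alpha X (Y *m J) Z = alpha X Y (Z *m J).
Proof.
move=> [[_ _ l3] _ tJ]; have := tJ X Y (Z *m J); rewrite (mulJJ gJ).
by rewrite (scalarN _ (l3 _ _)) => /oppr_inj.
Qed.

Lemma GH_diag alpha X Y : GH_space J alpha -> alpha X Y (Y *m J) = 0.
Proof.
move=> H; have [_ an _] := H; have := an X Y (Y *m J).
by rewrite (GH_shift _ _ _ H) => E; lra.
Qed.

Lemma unitary_signed_perm e (p : nat -> nat) (s : nat -> R) : unitary_frame g J e ->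
  (forall i, (i < 6)%N -> (p i < 6)%N) ->
  (forall i j, (i < 6)%N -> (j < 6)%N -> (p i == p j) = (i == j)) ->
  (forall i, (i < 6)%N -> s i * s i = 1) ->
  s 3%N *: e (p 3%N) = s 0%N *: e (p 0%N) *m J ->
  s 4%N *: e (p 4%N) = s 1%N *: e (p 1%N) *m J ->
  s 5%N *: e (p 5%N) = s 2%N *: e (p 2%N) *m J ->
  unitary_frame g J (fun i => s i *: e (p i)).
Proof.
move=> [_ _ _ gee] p6 pI s1 E3 E4 E5; split => // i j i6 j6.
rewrite bilinZl bilinZr gee ?p6// pI//.
by case: eqP => [->|_]; rewrite ?mulr0// mulr1 s1.
Qed.

(** Schur's lemma: a vector t and its dual covector have the same stabilizer in
    the unitary group, and four elements of it, signed permutations of a unitary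
    frame starting along t, already determine an invariant tensor up to two
    real parameters. *)
Lemma W4_form gamma : W4 g J gamma ->
  exists2 mu, scalar mu & forall X Y Z, gamma X Y Z = covector_part mu X Y Z.
Proof.
move=> [F [theta [[FG Fl _ Finv] gF]]].
have [th0|th0] := eqVneq theta 0.
  exists (fun=> 0) => [a X Y|X Y Z]; first by rewrite mulr0 addr0.
  have l : scalar (fun th : 'cV[R]_6 => F th X Y Z) by exact: Fl.
  rewrite gF th0 /covector_part; have := l (-1) 0 0.
  by rewrite scaler0 addr0 mulN1r addNr => ->; ring.
pose t : V := theta^T *m invmx g.
have gu := metric_unit gJ.
have t0 : t != 0.
  apply: contraNneq th0 => E; have : t *m g = 0 by rewrite E mul0mx.
  by rewrite mulmxKV// => E'; rewrite -[theta]trmxK E' trmx0.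
have [e eP [k tE]] := exists_unitary_frame gJ t0.
have gee i j : (i < 6)%N -> (j < 6)%N -> bilin g (e i) (e j) = (i == j)%:R.
  by case: eP => _ _ _; apply.
have thE : theta = g *m t^T.
  by rewrite trmx_mul trmxK trmx_inv (metric_tr gJ) mulKVmx.
set alpha := F theta in gF *.
have aG : GH_space J alpha by exact: FG.
have [[l1 l2 l3] an tJ] := aG.
have stab e' : unitary_frame g J e' -> e' 0%N = e 0%N -> forall i j l : nat,
    (i < 6)%N -> (j < 6)%N -> (l < 6)%N ->
    alpha (e' i) (e' j) (e' l) = alpha (e i) (e j) (e l).
  move=> e'P e0 i j l i6 j6 l6.
  have [A AU eA] := frame_change gJ eP e'P.
  rewrite -!eA// /alpha -Finv//; congr (F _ _ _ _).
  have tA : t *m A = t by rewrite tE -scalemxAl eA// e0.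
  have Atheta X : X *m (A *m theta) = X *m theta.
    rewrite thE !mulmxA; apply/matrixP => a b; rewrite !ord1.
    by have := AU.1 X t; rewrite tA.
  by apply/row_matrixP => a; rewrite !rowE Atheta.
pose T i j l := alpha (e i) (e j) (e l).
have inv (p : nat -> nat) (s : nat -> R) :
  p 0%N = 0%N -> s 0%N = 1 ->
  (forall i, (i < 6)%N -> (p i < 6)%N) ->
  (forall i j, (i < 6)%N -> (j < 6)%N -> (p i == p j) = (i == j)) ->
  (forall i, (i < 6)%N -> s i * s i = 1) ->
  s 3%N *: e (p 3%N) = s 0%N *: e (p 0%N) *m J ->
  s 4%N *: e (p 4%N) = s 1%N *: e (p 1%N) *m J ->
  s 5%N *: e (p 5%N) = s 2%N *: e (p 2%N) *m J ->
  forall i j l : nat, (i < 6)%N -> (j < 6)%N -> (l < 6)%N ->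
    T i j l = s i * (s j * (s l * T (p i) (p j) (p l))).
  move=> p0 s0 p6 pI s1 E3 E4 E5 i j l i6 j6 l6.
  rewrite /T -(stab _ (unitary_signed_perm eP p6 pI s1 E3 E4 E5))//; last first.
    by rewrite p0 s0 scale1r.
  by rewrite (scalarZ _ _ (l1 _ _)) (scalarZ _ _ (l2 _ _)) (scalarZ _ _ (l3 _ _)).
have [J0 J1 J2 J3 [J4 J5]] := frameJ gJ eP.
pose sign1 i : R := if i is (0 | 3)%N then 1 else -1.
pose sign2 i : R := if i is (1 | 4)%N then -1 else 1.
pose perm3 i := match i with 1 => 4 | 2 => 5 | 4 => 1 | 5 => 2 | _ => i end%N.
pose sign3 i : R := if i is (4 | 5)%N then -1 else 1.
pose perm4 i := match i with 1 => 2 | 2 => 1 | 4 => 5 | 5 => 4 | _ => i end%N.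
have JE := (J0, J1, J2, J3, J4, J5, scale1r, scaleN1r, mulNmx).
have i1 i j l : (i < 6)%N -> (j < 6)%N -> (l < 6)%N ->
    T i j l = sign1 i * (sign1 j * (sign1 l * T i j l)).
  (* -1 on the complex complement of t *)
  apply: (inv id sign1) => //; rewrite /= ?JE//.
  by case=> [|[|[|[|[|[|//]]]]]] _ /=; rewrite ?mulrNN mulr1.
have i2 i j l : (i < 6)%N -> (j < 6)%N -> (l < 6)%N ->
    T i j l = sign2 i * (sign2 j * (sign2 l * T i j l)).
  (* -1 on the second complex direction only *)
  apply: (inv id sign2) => //; rewrite /= ?JE//.
  by case=> [|[|[|[|[|[|//]]]]]] _ /=; rewrite ?mulrNN mulr1.
have i3 i j l : (i < 6)%N -> (j < 6)%N -> (l < 6)%N ->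
    T i j l = sign3 i * (sign3 j * (sign3 l * T (perm3 i) (perm3 j) (perm3 l))).
  (* J on the complex complement of t *)
  apply: (inv perm3 sign3) => //; rewrite /= ?JE//.
  - by case=> [|[|[|[|[|[|//]]]]]].
  - by case=> [|[|[|[|[|[|//]]]]]] [|[|[|[|[|[|//]]]]]].
  - by case=> [|[|[|[|[|[|//]]]]]] _ /=; rewrite ?mulrNN mulr1.
have i4 i j l : (i < 6)%N -> (j < 6)%N -> (l < 6)%N ->
    T i j l = 1 * (1 * (1 * T (perm4 i) (perm4 j) (perm4 l))).
  (* exchange of the last two complex directions *)
  apply: (inv perm4 (fun=> 1)) => //; rewrite /= ?JE//.
  - by case=> [|[|[|[|[|[|//]]]]]].
  - by case=> [|[|[|[|[|[|//]]]]]] [|[|[|[|[|[|//]]]]]].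
  - by move=> n _; rewrite mulr1.
have anT i j l : T i l j = - T i j l by exact: an.
have tT X j l : alpha X (e j *m J) (e l) = alpha X (e j) (e l *m J).
  exact: GH_shift.
have TJ i : [/\ T i 3%N 1%N = T i 0%N 4%N, T i 3%N 4%N = - T i 0%N 1%N,
    T i 3%N 2%N = T i 0%N 5%N, T i 3%N 5%N = - T i 0%N 2%N &
    [/\ T i 0%N 3%N = 0, T i 1%N 4%N = 0 & T i 2%N 5%N = 0]].
  rewrite /T -J0 !tT J1 J2 J4 J5 !(scalarN _ (l3 _ _)); split => //.
  by rewrite -J1 -J2; split; exact: GH_diag.
have [T2 T2'] : T 2%N 0%N 2%N = T 1%N 0%N 1%N /\ T 2%N 0%N 5%N = T 1%N 0%N 4%N.
  by split; rewrite i4//= !mul1r.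
have [T4 T4'] : T 4%N 0%N 4%N = T 1%N 0%N 1%N /\ T 4%N 0%N 1%N = - T 1%N 0%N 4%N.
  by split; rewrite i3//= ?mul1r ?mulN1r ?opprK.
have [T5 T5'] : T 5%N 0%N 5%N = T 1%N 0%N 1%N /\ T 5%N 0%N 2%N = - T 1%N 0%N 4%N.
  by split; rewrite i4//= !mul1r.
pose mu X := - T 1%N 0%N 1%N * bilin g X (e 0%N) - T 1%N 0%N 4%N * bilin g X (e 3%N).
have lmu : scalar mu.
  by move=> a X Y; rewrite /mu !bilinDl !bilinZl; ring.
exists mu => // X Y Z; rewrite gF.
apply: (trilinear_ext gJ eP) => //; first exact: covector_part_trilinear.
have muN X' : mu (- X') = - mu X' by exact: scalarN.
have [m0 m1 m2 m3] : [/\ mu (e 0%N) = - T 1%N 0%N 1%N, mu (e 1%N) = 0,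
   mu (e 2%N) = 0 & mu (e 3%N) = - T 1%N 0%N 4%N].
  by split; rewrite /mu !gee//=; ring.
have [m4 m5] : mu (e 4%N) = 0 /\ mu (e 5%N) = 0.
  by split; rewrite /mu !gee//=; ring.
clearbody mu.
have key : forall i j l, (j < l < 6)%N -> (i < 6)%N ->
   T i j l = covector_part mu (e i) (e j) (e l).
  move=> i j l /andP[jl l6] i6; have j6 := ltn_trans jl l6.
  rewrite /covector_part.
  have := i1 i j l i6 j6 l6; have := i2 i j l i6 j6 l6.
  have := i3 i j l i6 j6 l6; have := i4 i j l i6 j6 l6.
  have [+ + + + []] := TJ i; have := anT i j l.
  move: i6 j6 l6 jl.
  case: i => [|[|[|[|[|[|//]]]]]]; case: j => [|[|[|[|[|[|//]]]]]];
    case: l => [|[|[|[|[|[|//]]]]]] // _ _ _ _ /=;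
    rewrite ?J0 ?J1 ?J2 ?J3 ?J4 ?J5 ?muN ?bilinNr ?gee//= ?m0 ?m1 ?m2 ?m3 ?m4 ?m5
     ?mulr0 ?mul0r ?mulr1 ?mul1r ?mulN1r ?oppr0 ?addr0 ?add0r ?opprK;
    clear -T2 T2' T4 T4' T5 T5'; lra.
have [[lc1 lc2 lc3] lcA] : trilinear (covector_part mu) /\
    forall X Y Z, covector_part mu X Z Y = - covector_part mu X Y Z.
  by split=> [|U S W]; [exact: covector_part_trilinear|rewrite /covector_part; ring].
move=> i j l i6 j6 l6; rewrite -/(T i j l); have [jl|lj|<-] := ltngtP j l.
- by apply: key; rewrite ?jl.
- by rewrite -[T i j l]opprK -anT lcA key ?lj.
- have := anT i j j; have := lcA (e i) (e j) (e j); lra.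
Qed.

End GrayHervella.

Section TotallySkew.
Context {R : realType} (g J : 'M[R]_6).
Local Notation V := 'rV[R]_6.
Implicit Types (X Y Z W : V) (mu theta : V -> R) (alpha beta : V -> V -> V -> R).
Hypothesis gJ : hermitian_pair g J.

Definition direction (i : nat) : nat :=
  match i with 3%N => 0%N | 4%N => 1%N | 5%N => 2%N | _ => i end.

Definition is_J (i : nat) : bool :=
  match i with 3%N | 4%N | 5%N => true | _ => false end.

Definition levi_civita_sign (i j k : nat) : R :=
  match i, j, k with
  | 0%N, 1%N, 2%N | 1%N, 2%N, 0%N | 2%N, 0%N, 1%N => 1
  | 0%N, 2%N, 1%N | 2%N, 1%N, 0%N | 1%N, 0%N, 2%N => -1
  | _, _, _ => 0
  end.

(** The components on a unitary frame of the real part of (u + i v) times the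
    complex determinant; the factor i^n, with n the number of J, is
    split into real and imaginary parts. *)
Definition det_component (u v : R) (i j k : nat) : R :=
  levi_civita_sign (direction i) (direction j) (direction k) *
  match is_J i, is_J j, is_J k with
  | false, false, false => u
  | true, false, false | false, true, false | false, false, true => - v
  | true, true, false | true, false, true | false, true, true => - u
  | true, true, true => v
  end.

Section W1.
Variable beta : V -> V -> V -> R.
Hypothesis betaP : W1 g J beta.

Lemma W1_trilinear : trilinear beta. Proof. by case: betaP => -[]. Qed.
Lemma W1_swapl X Y Z : beta Y X Z = - beta X Y Z. Proof. by case: betaP. Qed.
Lemma W1_swapr X Y Z : beta X Z Y = - beta X Y Z. Proof. by case: betaP => -[]. Qed.

Lemma W1_shift23 X Y Z : beta X (Y *m J) Z = beta X Y (Z *m J).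
Proof. by case: betaP => + _; apply: (GH_shift gJ). Qed.

Lemma W1_shift12 X Y Z : beta (X *m J) Y Z = beta X (Y *m J) Z.
Proof. by rewrite (W1_swapl Y) W1_shift23 (W1_swapl X) opprK W1_shift23. Qed.

(** Complex dimension three: the forms of type (3,0)+(0,3) are determined by one
    complex number. *)
Lemma W1_components e : unitary_frame g J e ->
  forall i j k, (i < 6)%N -> (j < 6)%N -> (k < 6)%N ->
  beta (e i) (e j) (e k) =
  det_component (beta (e 0%N) (e 1%N) (e 2%N)) (- beta (e 3%N) (e 1%N) (e 2%N)) i j k.
Proof.
move=> [E3 E4 E5 _].
have [l1 l2 l3] := W1_trilinear.
pose B0 i j k := beta (e i) (e j) (e k).
pose B1 i j k := beta (e i *m J) (e j) (e k).
have alt (B : nat -> nat -> nat -> R) :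
    (forall i j k, B j i k = - B i j k) -> (forall i j k, B i k j = - B i j k) ->
    forall i j k, (i < 3)%N -> (j < 3)%N -> (k < 3)%N ->
      B i j k = levi_civita_sign i j k * B 0%N 1%N 2%N.
  move=> sl sr i j k i3 j3 k3.
  have := sl i j k; have := sr i j k; have := sl i k j; have := sr j i k.
  have := sl j k i; have := sr k i j; have := sl k i j; have := sr i k j.
  move: i3 j3 k3.
  by case: i => [|[|[|//]]]; case: j => [|[|[|//]]]; case: k => [|[|[|//]]] _ _ _ /=; lra.
have alt0 := alt B0 (fun i j k => W1_swapl _ _ _) (fun i j k => W1_swapr _ _ _).
have sw1 i j k : B1 j i k = - B1 i j k by rewrite /B1 W1_shift12 W1_swapl.
have alt1 := alt B1 sw1 (fun i j k => W1_swapr _ _ _).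
have JJ X : X *m J *m J = - X by exact: (mulJJ gJ).
have sh2 X Y Z : beta X (Y *m J) Z = beta (X *m J) Y Z by rewrite W1_shift12.
have sh3 X Y Z : beta X Y (Z *m J) = beta (X *m J) Y Z.
  by rewrite -W1_shift23 sh2.
have N1 X Y Z : beta (- X) Y Z = - beta X Y Z by exact: (scalarN X (l1 Y Z)).
move=> i j k i6 j6 k6; rewrite E3 -/(B0 0 1 2)%N -/(B1 0 1 2)%N.
pose red n := direction n.
have e_dir n : (n < 6)%N -> e n = if is_J n then e (direction n) *m J else e (direction n).
  by case: n => [|[|[|[|[|[|//]]]]]].
have dir3 n : (n < 6)%N -> (direction n < 3)%N by case: n => [|[|[|[|[|[|//]]]]]].
rewrite (e_dir i)// (e_dir j)// (e_dir k)// /det_component.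
have b0 := alt0 _ _ _ (dir3 _ i6) (dir3 _ j6) (dir3 _ k6).
have b1 := alt1 _ _ _ (dir3 _ i6) (dir3 _ j6) (dir3 _ k6).
by case: (is_J i); case: (is_J j); case: (is_J k);
  rewrite ?sh3 ?sh2 ?JJ ?N1 -/(B0 _ _ _) -/(B1 _ _ _) ?b0 ?b1; ring.
Qed.

End W1.
End TotallySkew.

(** * The structure equations at a point *)

(** Alternating sums over shuffles, on an arbitrary type so that the same formulas
    serve for vectors and for indices of a frame. *)
Section AlternatingSums.
Context {R : realType} (T : Type).
Implicit Types (A B C D E : T).

Definition cyclic_sum (alpha : T -> T -> T -> R) A B C : R :=
  alpha A B C + alpha B C A + alpha C A B.

Definition wedge12 (theta : T -> R) (sigma : T -> T -> R) A B C : R :=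
  theta A * sigma B C + theta B * sigma C A + theta C * sigma A B.

Definition alt4 (Q : T -> T -> T -> T -> R) A B C D : R :=
  Q A B C D - Q B A C D + Q C A B D - Q D A B C.

Definition wedge13 (t : T -> R) (b : T -> T -> T -> R) A B C D : R :=
  alt4 (fun A B C D => t A * b B C D) A B C D.

Definition wedge22 (s t : T -> T -> R) A B C D : R :=
  s A B * t C D - s A C * t B D + s A D * t B C
  + s B C * t A D - s B D * t A C + s C D * t A B.

Definition alt5 (Q : T -> T -> T -> T -> T -> R) A B C D E : R :=
  Q A B C D E - Q B A C D E + Q C A B D E - Q D A B C E + Q E A B C D.

Definition wedge14 (t : T -> R) (Q : T -> T -> T -> T -> R) A B C D E : R :=
  alt5 (fun A B C D E => t A * Q B C D E) A B C D E.

Definition wedge23 (s : T -> T -> R) (b : T -> T -> T -> R) A B C D E : R :=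
  s A B * b C D E - s A C * b B D E + s A D * b B C E - s A E * b B C D
  + s B C * b A D E - s B D * b A C E + s B E * b A C D
  + s C D * b A B E - s C E * b A B D + s D E * b A B C.

End AlternatingSums.

(** Components on a unitary frame e.  The 3-form beta is the real part of
    (u + i v) det, its derivative in the direction e_x along the canonical Hermitian
    connection is the real part of (p_x + i q_x) det, and m gives the covector of
    the W4 part.  Then alpha stands for the derivative of the Kaehler form, A for
    the difference of the two connections, b and bhat for the Levi-Civita
    derivatives of beta and of its imaginary partner. *)
Section Components.
Context {R : realType}.
Variables (u v : R) (m p q : nat -> R).
Hypothesis uv0 : u * u + v * v != 0.

Definition sum6 (f : nat -> R) : R :=
  f 0%N + f 1%N + f 2%N + f 3%N + f 4%N + f 5%N.

Definition J_index (a : nat) : nat :=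
  match a with
  | 0%N => 3%N | 1%N => 4%N | 2%N => 5%N
  | 3%N => 0%N | 4%N => 1%N | 5%N => 2%N | _ => a end.

Definition J_sign (a : nat) : R :=
  match a with 3%N | 4%N | 5%N => -1 | _ => 1 end.

Definition delta (i j : nat) : R := (i == j)%:R.

Definition omega_component i j : R := - (J_sign j * delta i (J_index j)).

Definition alpha_component x i a : R :=
  det_component u v x i a + delta x i * m a - delta x a * m i
  + omega_component x i * (J_sign a * m (J_index a))
  - omega_component x a * (J_sign i * m (J_index i)).

Definition A_component x i a : R :=
  2^-1 * (J_sign a * alpha_component x i (J_index a)).

Definition b_component x i j k : R :=
  det_component (p x) (q x) i j k +
  sum6 (fun a => A_component x i a * det_component u v a j k
   + A_component x j a * det_component u v i a k
   + A_component x k a * det_component u v i j a).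

Definition bhat_component x i j k : R :=
  - (J_sign i * b_component x (J_index i) j k)
  - sum6 (fun a => alpha_component x i a * det_component u v a j k).

Definition dethat_component i j k : R :=
  - (J_sign i * det_component u v (J_index i) j k).

Definition theta_component i : R := 2 * (J_sign i * m (J_index i)).

Definition xi_component i : R :=
  (u * p i - u * (J_sign i * q (J_index i))
   + v * (J_sign i * p (J_index i)) + v * q i) / (u * u + v * v)
  + theta_component i.

(** For each choice of increasing indices these are identities between rational
    functions of the components. *)
Lemma structure_components i j k l : (i < j < k)%N -> (k < l < 6)%N ->
  alt4 b_component i j k l =
    wedge13 xi_component (det_component u v) i j k l /\
  alt4 bhat_component i j k l =
    wedge13 xi_component dethat_component i j k l
    - 2 * (u * u + v * v) * wedge22 omega_component omega_component i j k l.
Proof.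
move=> /andP[ij jk] /andP[kl l6].
rewrite /wedge13 /wedge22 /alt4 /bhat_component /b_component /A_component.
move: ij jk kl l6; case: i => [|[|[|i]]]; case: j => [|[|[|[|j]]]] //;
 case: k => [|[|[|[|[|k]]]]] //; case: l => [|[|[|[|[|[|l]]]]]] // _ _ _ _.
all: rewrite /sum6 /alpha_component /xi_component /theta_component
  /dethat_component /omega_component /delta /det_component /=.
all: by split; field.
Qed.

End Components.

Section FourForms.
Context {R : realType}.
Local Notation V := 'rV[R]_6.
Implicit Types (X Y Z W : V) (B S T : V -> V -> V -> V -> R).

Definition four_form T : Prop :=
  [/\ forall Y Z W, scalar (fun X => T X Y Z W),
      forall X Y Z W, T Y X Z W = - T X Y Z W,
      forall X Y Z W, T X Z Y W = - T X Y Z W &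
      forall X Y Z W, T X Y W Z = - T X Y Z W].

(** Every arrangement of four indices is reached from the increasing one by
    adjacent transpositions. *)
Lemma sort4_ind (P : nat -> nat -> nat -> nat -> Prop) :
  (forall i j k l, P i j k l -> P j i k l) ->
  (forall i j k l, P i j k l -> P i k j l) ->
  (forall i j k l, P i j k l -> P i j l k) ->
  (forall i j k l, (i <= j <= k)%N -> (k <= l)%N -> P i j k l) ->
  forall i j k l, P i j k l.
Proof.
move=> s12 s23 s34 sP.
have P3 i j k l : (i <= j <= k)%N -> P i j k l.
  move=> /andP[ij jk]; have [kl|/ltnW lk] := leqP k l; first by apply: sP; rewrite ?ij.
  apply: s34; have [jl|/ltnW lj] := leqP j l; first by apply: sP; rewrite ?ij.
  apply: s23; have [il|/ltnW li] := leqP i l; first by apply: sP; rewrite ?il.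
  by apply: s12; apply: sP; rewrite ?li.
have P2 i j k l : (i <= j)%N -> P i j k l.
  move=> ij; have [jk|/ltnW kj] := leqP j k; first by apply: P3; rewrite ij.
  apply: s23; have [ik|/ltnW ki] := leqP i k; first by apply: P3; rewrite ik.
  by apply: s12; apply: P3; rewrite ki.
move=> i j k l; have [ij|/ltnW ji] := leqP i j; first exact: P2.
by apply: s12; exact: P2.
Qed.

Lemma four_form_ext (g J : 'M[R]_6) e S T : hermitian_pair g J -> unitary_frame g J e ->
  four_form S -> four_form T ->
  (forall i j k l, (i < j < k)%N -> (k < l < 6)%N ->
     S (e i) (e j) (e k) (e l) = T (e i) (e j) (e k) (e l)) ->
  forall X Y Z W, S X Y Z W = T X Y Z W.
Proof.
move=> gJ eP [S1 S12 S23 S34] [T1 T12 T23 T34] E.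
have all : forall i j k l, (i < 6)%N -> (j < 6)%N -> (k < 6)%N -> (l < 6)%N ->
    S (e i) (e j) (e k) (e l) = T (e i) (e j) (e k) (e l).
  apply: (@sort4_ind (fun i j k l => (i < 6)%N -> (j < 6)%N -> (k < 6)%N ->
    (l < 6)%N -> S (e i) (e j) (e k) (e l) = T (e i) (e j) (e k) (e l))) =>
    [i j k l H|i j k l H|i j k l H|i j k l /andP[ij jk] kl].
  - by move=> *; rewrite S12 T12 H.
  - by move=> *; rewrite S23 T23 H.
  - by move=> *; rewrite S34 T34 H.
  have diag (a b : R) : a = - a -> b = - b -> a = b by move=> ? ?; lra.
  move=> i6 j6 k6 l6; move: ij; rewrite leq_eqVlt => /orP[/eqP <-|ij].
    by apply: diag; [exact: S12|exact: T12].
  move: jk; rewrite leq_eqVlt => /orP[/eqP <-|jk].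
    by apply: diag; [exact: S23|exact: T23].
  move: kl; rewrite leq_eqVlt => /orP[/eqP <-|kl].
    by apply: diag; [exact: S34|exact: T34].
  by apply: E; rewrite ?ij ?kl.
have sN (f h : V -> R) : (forall X, f X = - h X) -> scalar h -> scalar f.
  by move=> fh lh a X Y; rewrite !fh lh; ring.
have lin2 Q : (forall Y Z W, scalar (fun X => Q X Y Z W)) ->
    (forall X Y Z W, Q Y X Z W = - Q X Y Z W) -> forall X Z W, scalar (fun Y => Q X Y Z W).
  by move=> Q1 Q12 X Z W; apply: (sN _ (fun Y => Q Y X Z W)) => // Y; rewrite Q12.
have lin3 Q : (forall Y Z W, scalar (fun X => Q X Y Z W)) ->
    (forall X Y Z W, Q Y X Z W = - Q X Y Z W) -> (forall X Y Z W, Q X Z Y W = - Q X Y Z W) ->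
    forall X Y W, scalar (fun Z => Q X Y Z W).
  by move=> Q1 Q12 Q23 X Y W; apply: (sN _ (fun Z => Q X Z Y W)) => [Z|]; [rewrite Q23|exact: lin2].
have lin4 Q : (forall Y Z W, scalar (fun X => Q X Y Z W)) ->
    (forall X Y Z W, Q Y X Z W = - Q X Y Z W) -> (forall X Y Z W, Q X Z Y W = - Q X Y Z W) ->
    (forall X Y Z W, Q X Y W Z = - Q X Y Z W) ->
    forall X Y Z, scalar (fun W => Q X Y Z W).
  by move=> Q1 Q12 Q23 Q34 X Y Z; apply: (sN _ (fun W => Q X Y W Z)) => [W|]; [rewrite Q34|exact: lin3].
move=> X Y Z W.
apply: (scalar_ext gJ eP (S1 Y Z W) (T1 Y Z W)) => i i6.
apply: (scalar_ext gJ eP (lin2 _ S1 S12 _ Z W) (lin2 _ T1 T12 _ Z W)) => j j6.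
apply: (scalar_ext gJ eP (lin3 _ S1 S12 S23 _ _ W) (lin3 _ T1 T12 T23 _ _ W)) => k k6.
apply: (scalar_ext gJ eP (lin4 _ S1 S12 S23 S34 _ _ _) (lin4 _ T1 T12 T23 T34 _ _ _)) => l l6.
exact: all.
Qed.

Lemma alt4_four_form B :
  (forall Y Z W, scalar (fun X => B X Y Z W)) -> (forall X, trilinear (B X)) ->
  (forall X Y Z W, B X Z Y W = - B X Y Z W) ->
  (forall X Y Z W, B X Y W Z = - B X Y Z W) -> four_form (alt4 B).
Proof.
move=> B1 B3 Bs Bt; rewrite /alt4; split.
- move=> Y Z W a X X'; have [l _ _] := B3 Y; have [l' _ _] := B3 Z.
  have [l'' _ _] := B3 W.
  have := B1 Y Z W a X X'; have := l Z W a X X'; have := l' Y W a X X'.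
  by have := l'' Y Z a X X' => /= -> -> -> ->; ring.
- by move=> X Y Z W; rewrite (Bs Z Y X) (Bs W Y X); ring.
- by move=> X Y Z W; rewrite (Bs X Z Y) (Bt W X Z Y); ring.
- by move=> X Y Z W; rewrite (Bt X Y W Z) (Bt Y X W Z); ring.
Qed.

Lemma wedge13_four_form theta beta : scalar theta -> trilinear beta ->
  (forall X Y Z, beta Y X Z = - beta X Y Z) -> (forall X Y Z, beta X Z Y = - beta X Y Z) ->
  four_form (wedge13 theta beta).
Proof.
move=> lt [b1 b2 b3] bl br; apply: alt4_four_form.
- by move=> Y Z W a X X'; rewrite lt; ring.
- move=> X; split=> [Y Z|Y Z|Y Z] a U W.
  + by have /= -> := b1 Y Z a U W; ring.
  + by have /= -> := b2 Y Z a U W; ring.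
  + by have /= -> := b3 Y Z a U W; ring.
- by move=> X Y Z W; rewrite bl; ring.
- by move=> X Y Z W; rewrite br; ring.
Qed.

Lemma wedge22_four_form (a b : V -> V -> R) :
  (forall Y, scalar (a^~ Y)) -> (forall Y, scalar (b^~ Y)) ->
  (forall X Y, a Y X = - a X Y) -> (forall X Y, b Y X = - b X Y) ->
  four_form (wedge22 a b).
Proof.
move=> la lb sa sb; rewrite /wedge22; split.
- move=> Y Z W s X X'.
  have := la Y s X X'; have := la Z s X X'; have := la W s X X'.
  have := lb Y s X X'; have := lb Z s X X'; have := lb W s X X'.
  by move=> /= -> -> -> -> -> ->; ring.
- by move=> X Y Z W; rewrite (sa X Y) (sb X Y); ring.
- by move=> X Y Z W; rewrite (sa Y Z) (sb Y Z); ring.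
- by move=> X Y Z W; rewrite (sa Z W) (sb Z W); ring.
Qed.

Lemma four_form_lin S T (c : R) : four_form S -> four_form T ->
  four_form (fun X Y Z W => S X Y Z W - c * T X Y Z W).
Proof.
move=> [S1 S12 S23 S34] [T1 T12 T23 T34]; split.
- by move=> Y Z W a X X'; have /= -> := S1 Y Z W a X X'; have /= -> := T1 Y Z W a X X'; ring.
- by move=> X Y Z W; rewrite S12 T12; ring.
- by move=> X Y Z W; rewrite S23 T23; ring.
- by move=> X Y Z W; rewrite S34 T34; ring.
Qed.

End FourForms.

Section StructureEquations.
Context {R : realType} (g J : 'M[R]_6).
Local Notation V := 'rV[R]_6.
Implicit Types (X Y Z W : V).
Hypothesis gJ : hermitian_pair g J.

Definition omega X Y : R := bilin g (X *m J) Y.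

(** The partner of beta: together they are the real and imaginary parts of a
    form of type (3,0). *)
Definition hat (beta : V -> V -> V -> R) X Y Z : R := - beta (X *m J) Y Z.

Lemma omega_skew X Y : omega Y X = - omega X Y.
Proof.
rewrite /omega (metric_skew gJ) bilin_sym; first by [].
exact: metric_tr gJ.
Qed.

Lemma omega_scalar Y : scalar (omega^~ Y).
Proof. by move=> a X X'; rewrite /omega mulmxDl -scalemxAl bilinDl bilinZl. Qed.

Lemma frameJE e i : unitary_frame g J e -> (i < 6)%N ->
  e i *m J = J_sign i *: e (J_index i).
Proof.
move=> /(frameJ gJ) [J0 J1 J2 J3 [J4 J5]].
by case: i => [|[|[|[|[|[|//]]]]]] _ /=; rewrite ?J0 ?J1 ?J2 ?J3 ?J4 ?J5 ?scale1r ?scaleN1r.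
Qed.

Lemma J_index6 i : (i < 6)%N -> (J_index i < 6)%N.
Proof. by case: i => [|[|[|[|[|[|//]]]]]]. Qed.

Lemma sum_sum6 (f : nat -> R) : \sum_(i < 6) f i = sum6 f.
Proof. by rewrite sum6E /sum6 !addrA. Qed.

Lemma omega_frame e i k : unitary_frame g J e -> (i < 6)%N -> (k < 6)%N ->
  omega (e i) (e k) = omega_component i k.
Proof.
move=> eP i6 k6; rewrite /omega (metric_skew gJ) (frameJE eP k6) bilinZr.
by case: eP => _ _ _ ->//; exact: J_index6.
Qed.

Lemma hat_frame e beta i k l : W1 g J beta -> unitary_frame g J e ->
  (i < 6)%N -> (k < 6)%N -> (l < 6)%N ->
  hat beta (e i) (e k) (e l) =
  dethat_component (beta (e 0%N) (e 1%N) (e 2%N)) (- beta (e 3%N) (e 1%N) (e 2%N)) i k l.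
Proof.
move=> betaP eP i6 k6 l6; have [l1 _ _] := W1_trilinear betaP.
by rewrite /hat (frameJE eP i6) (scalarZ _ _ (l1 _ _)) (W1_components gJ betaP eP) ?J_index6.
Qed.

Section Point.
Variables (e : nat -> V) (beta : V -> V -> V -> R) (mu : V -> R).
Variables (j : V -> V -> V) (b : V -> V -> V -> V -> R).
Hypothesis eP : unitary_frame g J e.
Hypothesis betaP : W1 g J beta.
Hypothesis mu_scalar : scalar mu.
Hypothesis jP : forall X Y Z,
  bilin g (j X Y) Z = beta X Y Z + covector_part g J mu X Y Z.
Hypothesis b1 : forall Y Z W, scalar (fun X => b X Y Z W).
Hypothesis b3 : forall X, trilinear (b X).
Hypothesis bl : forall X Y Z W, b X Z Y W = - b X Y Z W.
Hypothesis br : forall X Y Z W, b X Y W Z = - b X Y Z W.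
Hypothesis bJ : forall X Y Z W,
  b X (Y *m J) (Z *m J) W + beta (j X Y) (Z *m J) W + beta (Y *m J) (j X Z) W
  = - b X Y Z W.

Let alpha X Y Z : R := beta X Y Z + covector_part g J mu X Y Z.
Let u := beta (e 0%N) (e 1%N) (e 2%N).
Let v := - beta (e 3%N) (e 1%N) (e 2%N).

Let gee i k : (i < 6)%N -> (k < 6)%N -> bilin g (e i) (e k) = delta i k.
Proof. by case: eP => _ _ _; apply. Qed.

Let gC X Y : bilin g X Y = bilin g Y X. Proof. by case: gJ. Qed.

Let alpha3 : trilinear alpha.
Proof.
have [l1 l2 l3] := W1_trilinear betaP.
have [c1 c2 c3] := covector_part_trilinear g J mu_scalar.
split=> [Y Z|X Z|X Y] a U U'; rewrite /alpha.
- by have /= -> := l1 Y Z a U U'; have /= -> := c1 Y Z a U U'; ring.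
- by have /= -> := l2 X Z a U U'; have /= -> := c2 X Z a U U'; ring.
- by have /= -> := l3 X Y a U U'; have /= -> := c3 X Y a U U'; ring.
Qed.

Let alpha_shift X Y Z : alpha X (Y *m J) Z = alpha X Y (Z *m J).
Proof.
rewrite /alpha (W1_shift23 gJ betaP); congr (_ + _).
by rewrite /covector_part !(mulJJ gJ) !bilinNr !(scalarN _ mu_scalar); ring.
Qed.

Let jD a X Y Y' : j X (a *: Y + Y') = a *: j X Y + j X Y'.
Proof.
apply: (bilin_inj (metric_unit gJ)) => Z; have [_ l2 _] := alpha3.
by rewrite bilinDl bilinZl !jP -!/(alpha _ _ _); exact: l2.
Qed.

Let jDl a X X' Y : j (a *: X + X') Y = a *: j X Y + j X' Y.
Proof.
apply: (bilin_inj (metric_unit gJ)) => Z; have [l1 _ _] := alpha3.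
by rewrite bilinDl bilinZl !jP -!/(alpha _ _ _); exact: l1.
Qed.

Let jJ X Y : j X (Y *m J) = - (j X Y *m J).
Proof.
apply: (bilin_inj (metric_unit gJ)) => Z.
rewrite bilinNl (metric_skew gJ) opprK !jP -!/(alpha _ _ _); exact: alpha_shift.
Qed.

(* nabla + A is the canonical Hermitian connection: J is parallel for it *)
Let A X Y : V := - 2^-1 *: (j X Y *m J).

Let AD a X Y Y' : A X (a *: Y + Y') = a *: A X Y + A X Y'.
Proof. by rewrite /A jD mulmxDl -scalemxAl scalerDr !scalerA (mulrC a). Qed.

Let ADl a X X' Y : A (a *: X + X') Y = a *: A X Y + A X' Y.
Proof. by rewrite /A jDl mulmxDl -scalemxAl scalerDr !scalerA (mulrC a). Qed.

Let AJ X Y : A X (Y *m J) = - 2^-1 *: j X Y.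
Proof. by rewrite /A jJ mulNmx (mulJJ gJ) opprK. Qed.

Let bA X Y Z W : R := beta (A X Y) Z W + beta Y (A X Z) W + beta Y Z (A X W).

(* the derivative of beta along the Hermitian connection *)
Let b' X Y Z W : R := b X Y Z W - bA X Y Z W.

(* J being parallel, the derivative of beta keeps the type of beta *)
Let b'_W1 X : W1 g J (b' X).
Proof.
have [l1 l2 l3] := W1_trilinear betaP.
have sl := W1_swapl betaP; have sr := W1_swapr betaP.
have [t1 t2 t3] := b3 X.
have b'l Y Z W : b' X Z Y W = - b' X Y Z W.
  by rewrite /b' /bA bl (sl Y (A X Z) W) (sl (A X Y) Z W) (sl Y Z); ring.
have b'r Y Z W : b' X Y W Z = - b' X Y Z W.
  by rewrite /b' /bA br (sr (A X Y) Z W) (sr Y (A X Z) W) (sr Y Z (A X W)); ring.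
have b'1 Z W : scalar (fun Y => b' X Y Z W).
  move=> a Y Y'; rewrite /b' /bA AD.
  have /= -> := t1 Z W a Y Y'; have /= -> := l1 Z W a (A X Y) (A X Y').
  by have /= -> := l1 (A X Z) W a Y Y'; have /= -> := l1 Z (A X W) a Y Y'; ring.
have b'2 Y W : scalar (fun Z => b' X Y Z W).
  by move=> a Z Z'; have /= E := b'1 Y W a Z Z'; rewrite !(b'l _ Y) E; ring.
split; last by move=> Y Z W; exact: b'l.
split=> [|//|Y Z W].
- split=> [//|//|Y Z a W W']; have /= E := b'2 Y Z a W W'.
  by rewrite !(b'r Y _ Z) E; ring.
have rot Y' Z' W' : b' X Y' Z' W' = b' X Z' W' Y'.
  by rewrite b'l b'r opprK.
rewrite !(rot Y) /b' /bA.
have := bJ X Z W Y; rewrite !AJ => E.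
have N1 U S Q : beta (- 2^-1 *: U) S Q = - 2^-1 * beta U S Q by exact: scalarZ (l1 S Q).
have N2 U S Q : beta U (- 2^-1 *: S) Q = - 2^-1 * beta U S Q.
  by rewrite (scalarZ _ _ (l2 U Q)).
rewrite /A !N1 !N2.
have -> : beta (j X Z *m J) W Y = beta (j X Z) (W *m J) Y by exact: (W1_shift12 gJ betaP).
have -> : beta Z (j X W *m J) Y = beta (Z *m J) (j X W) Y.
  by rewrite (W1_shift12 gJ betaP).
have -> : beta (Z *m J) (W *m J) (- 2^-1 *: (j X Y *m J))
   = - beta Z W (- 2^-1 *: (j X Y *m J)).
  by rewrite (W1_shift12 gJ betaP) (mulJJ gJ) (scalarN _ (l2 _ _)).
lra.
Qed.

Let p X := b' X (e 0%N) (e 1%N) (e 2%N).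
Let q X := - b' X (e 3%N) (e 1%N) (e 2%N).
Let m i := mu (e i).

Let betaE i k l : (i < 6)%N -> (k < 6)%N -> (l < 6)%N ->
  beta (e i) (e k) (e l) = det_component u v i k l.
Proof. exact: (W1_components gJ betaP eP). Qed.

Let omegaE i k : (i < 6)%N -> (k < 6)%N -> omega (e i) (e k) = omega_component i k.
Proof. exact: omega_frame. Qed.

Let muJ i : (i < 6)%N -> mu (e i *m J) = J_sign i * m (J_index i).
Proof. by move=> i6; rewrite (frameJE eP i6) (scalarZ _ _ mu_scalar). Qed.

Let alphaE x i a : (x < 6)%N -> (i < 6)%N -> (a < 6)%N ->
  alpha (e x) (e i) (e a) = alpha_component u v m x i a.
Proof.
move=> x6 i6 a6; rewrite /alpha /covector_part betaE// !gee//.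
rewrite /alpha_component -!omegaE// !muJ// /omega !(metric_skew gJ) /m; ring.
Qed.

Let AE x i a : (x < 6)%N -> (i < 6)%N -> (a < 6)%N ->
  bilin g (A (e x) (e i)) (e a) = A_component u v m x i a.
Proof.
move=> x6 i6 a6; rewrite /A bilinZl (metric_skew gJ) mulrN mulNr opprK jP -/(alpha _ _ _).
rewrite (frameJE eP a6) (scalarZ _ _ (_ : scalar (alpha (e x) (e i)))); last first.
  by have [_ _ l3] := alpha3.
by rewrite alphaE//; exact: J_index6.
Qed.

Let bE x i k l : (x < 6)%N -> (i < 6)%N -> (k < 6)%N -> (l < 6)%N ->
  b (e x) (e i) (e k) (e l)
  = b_component u v m (p \o e) (q \o e) x i k l.
Proof.
move=> x6 i6 k6 l6; have [l1 l2 l3] := W1_trilinear betaP.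
have -> : b (e x) (e i) (e k) (e l) = b' (e x) (e i) (e k) (e l) + bA (e x) (e i) (e k) (e l).
  by rewrite subrK.
rewrite (W1_components gJ (b'_W1 (e x)) eP)// /b_component; congr (_ + _).
rewrite -sum_sum6 !big_split/= /bA.
rewrite (scalar_frame gJ eP _ (l1 _ _)) (scalar_frame gJ eP _ (l2 _ _)).
rewrite (scalar_frame gJ eP _ (l3 _ _)).
by congr (_ + _ + _); apply: eq_bigr => a _; rewrite AE// betaE.
Qed.

Definition bhat X Y Z W : R := - b X (Y *m J) Z W - beta (j X Y) Z W.

Let bhatE x i k l : (x < 6)%N -> (i < 6)%N -> (k < 6)%N -> (l < 6)%N ->
  bhat (e x) (e i) (e k) (e l)
  = bhat_component u v m (p \o e) (q \o e) x i k l.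
Proof.
move=> x6 i6 k6 l6; have [l1 l2 l3] := W1_trilinear betaP.
have [t1 _ _] := b3 (e x).
rewrite /bhat (frameJE eP i6) (scalarZ _ _ (t1 _ _)) bE ?J_index6//.
rewrite /bhat_component -sum_sum6; congr (_ - _).
rewrite (scalar_frame gJ eP _ (l1 _ _)).
by apply: eq_bigr => a _; rewrite jP -/(alpha _ _ _) alphaE// betaE.
Qed.

Let hatE i k l : (i < 6)%N -> (k < 6)%N -> (l < 6)%N ->
  hat beta (e i) (e k) (e l) = dethat_component u v i k l.
Proof. exact: hat_frame. Qed.

Lemma hat_W1 : W1 g J (hat beta).
Proof.
have [l1 l2 l3] := W1_trilinear betaP.
have sl Y Z W : hat beta Z Y W = - hat beta Y Z W.
  by rewrite /hat (W1_shift12 gJ betaP Z) (W1_swapl betaP).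
have sr Y Z W : hat beta Y W Z = - hat beta Y Z W.
  by rewrite /hat (W1_swapr betaP).
split=> //; split=> [|//|Y Z W].
- split=> [Y Z|X Z|X Y] a U U'; rewrite /hat.
  + by rewrite mulmxDl -scalemxAl; have /= -> := l1 Y Z a (U *m J) (U' *m J); ring.
  + by have /= -> := l2 (X *m J) Z a U U'; ring.
  + by have /= -> := l3 (X *m J) Y a U U'; ring.
- by have [[_ _ tJ] _] := betaP; rewrite /hat tJ opprK.
Qed.

Let xi X : R := (u * p X - u * q (X *m J) + v * p (X *m J) + v * q X)
  / (u * u + v * v) + 2 * mu (X *m J).

Let pD : scalar p.
Proof.
have [l1 l2 l3] := W1_trilinear betaP.
move=> a X X'; rewrite /p /b' /bA !ADl.
have /= -> := b1 (e 0%N) (e 1%N) (e 2%N) a X X'.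
have /= -> := l1 (e 1%N) (e 2%N) a (A X (e 0%N)) (A X' (e 0%N)).
have /= -> := l2 (e 0%N) (e 2%N) a (A X (e 1%N)) (A X' (e 1%N)).
by have /= -> := l3 (e 0%N) (e 1%N) a (A X (e 2%N)) (A X' (e 2%N)); ring.
Qed.

Let qD : scalar q.
Proof.
have [l1 l2 l3] := W1_trilinear betaP.
move=> a X X'; rewrite /q /b' /bA !ADl.
have /= -> := b1 (e 3%N) (e 1%N) (e 2%N) a X X'.
have /= -> := l1 (e 1%N) (e 2%N) a (A X (e 3%N)) (A X' (e 3%N)).
have /= -> := l2 (e 3%N) (e 2%N) a (A X (e 1%N)) (A X' (e 1%N)).
by have /= -> := l3 (e 3%N) (e 1%N) a (A X (e 2%N)) (A X' (e 2%N)); ring.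
Qed.

Let xi_scalar : scalar xi.
Proof.
move=> a X X'; rewrite /xi !mulmxDl -!scalemxAl.
have -> : p (a *: X + X') = a * p X + p X' by exact: pD.
have -> : q (a *: X + X') = a * q X + q X' by exact: qD.
have -> : p (a *: (X *m J) + X' *m J) = a * p (X *m J) + p (X' *m J) by exact: pD.
have -> : q (a *: (X *m J) + X' *m J) = a * q (X *m J) + q (X' *m J) by exact: qD.
have -> : mu (a *: (X *m J) + X' *m J) = a * mu (X *m J) + mu (X' *m J).
  exact: mu_scalar.
ring.
Qed.

Let xiE i : (i < 6)%N -> xi (e i) = xi_component u v m (p \o e) (q \o e) i.
Proof.
move=> i6; rewrite /xi muJ// (frameJE eP i6).
by rewrite (scalarZ _ _ pD) (scalarZ _ _ qD) /xi_component /theta_component /comp; ring.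
Qed.

(** Both sides are 4-forms, so it is enough to compare their components on a
    unitary frame. *)
Lemma structure_equations : u * u + v * v != 0 ->
  exists2 xi : V -> R, scalar xi & forall X Y Z W,
    alt4 b X Y Z W = wedge13 xi beta X Y Z W /\
    alt4 bhat X Y Z W = wedge13 xi (hat beta) X Y Z W
      - 2 * (u * u + v * v) * wedge22 omega omega X Y Z W.
Proof.
move=> uv0; exists xi; first exact: xi_scalar.
have H i k l n : (i < k < l)%N -> (l < n < 6)%N ->
    [/\ (i < 6)%N, (k < 6)%N, (l < 6)%N & (n < 6)%N].
  move=> /andP[ik kl] /andP[ln n6]; have l6 := ltn_trans ln n6.
  by have k6 := ltn_trans kl l6; have i6 := ltn_trans ik k6.
have [l1 l2 l3] := W1_trilinear betaP.
have Q i k l n : (i < k < l)%N -> (l < n < 6)%N ->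
  alt4 b (e i) (e k) (e l) (e n) = wedge13 xi beta (e i) (e k) (e l) (e n) /\
  alt4 bhat (e i) (e k) (e l) (e n) = wedge13 xi (hat beta) (e i) (e k) (e l) (e n)
      - 2 * (u * u + v * v) * wedge22 omega omega (e i) (e k) (e l) (e n).
  move=> ikl ln; have [i6 k6 l6 n6] := H i k l n ikl ln.
  have [E1 E2] := structure_components m (p \o e) (q \o e) uv0 ikl ln.
  split.
    rewrite /alt4 !bE// -[LHS]/(alt4 (b_component u v m (p \o e) (q \o e)) i k l n) E1.
    by rewrite /wedge13 /alt4 !xiE// !betaE.
  rewrite /alt4 !bhatE// -[LHS]/(alt4 (bhat_component u v m (p \o e) (q \o e)) i k l n) E2.
  by rewrite /wedge13 /wedge22 /alt4 !xiE// !hatE// !omegaE.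
have fb : four_form (alt4 b) by exact: alt4_four_form.
have fw B : W1 g J B -> four_form (wedge13 xi B).
  move=> BP; apply: wedge13_four_form; first exact: xi_scalar.
  - exact: W1_trilinear BP.
  - exact: W1_swapl BP.
  - exact: W1_swapr BP.
have bhatl X Y Z W : bhat X Z Y W = - bhat X Y Z W.
  have sl := W1_swapl betaP; have sr := W1_swapr betaP.
  have E : b X (Z *m J) Y W + beta (j X Z) Y W = - (b X Y (Z *m J) W + beta Y (j X Z) W).
    by rewrite (bl X Y (Z *m J)) (sl Y (j X Z)); ring.
  have := bJ X Y (Z *m J) W; rewrite (mulJJ gJ) jJ.
  have [_ t2 _] := b3 X.
  rewrite (scalarN _ (t2 _ _)) (scalarN _ (l2 _ _)) (scalarN _ (l2 _ _)).
  rewrite (W1_shift12 gJ betaP Y) (mulJJ gJ) (scalarN _ (l2 _ _)) opprK => E'.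
  by rewrite /bhat; lra.
have fbh : four_form (alt4 bhat).
  apply: alt4_four_form => //.
  - move=> Y Z W a X X'; rewrite /bhat jDl.
    have /= -> := b1 (Y *m J) Z W a X X'.
    by have /= -> := l1 Z W a (j X Y) (j X' Y); ring.
  - move=> X; have [t1 t2 t3] := b3 X.
    split=> [Y Z|Y Z|Y Z] a U U'; rewrite /bhat.
    + rewrite mulmxDl -scalemxAl jD.
      have /= -> := t1 Y Z a (U *m J) (U' *m J).
      by have /= -> := l1 Y Z a (j X U) (j X U'); ring.
    + have /= -> := t2 (Y *m J) Z a U U'.
      by have /= -> := l2 (j X Y) Z a U U'; ring.
    + have /= -> := t3 (Y *m J) Z a U U'.
      by have /= -> := l3 (j X Y) Z a U U'; ring.
  - by move=> X Y Z W; rewrite /bhat br (W1_swapr betaP); ring.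
move=> X Y Z W; split.
  apply: (four_form_ext gJ eP fb (fw _ betaP)) => i k l n ikl ln.
  by have [] := Q _ _ _ _ ikl ln.
apply: (four_form_ext gJ eP fbh
  (four_form_lin (2 * (u * u + v * v)) (fw _ hat_W1)
    (wedge22_four_form omega_scalar omega_scalar omega_skew omega_skew))) => i k l n ikl ln.
by have [] := Q _ _ _ _ ikl ln.
Qed.

End Point.
End StructureEquations.

(** * Traces and the Lee form *)

Section Contractions.
Context {R : realType} (g J : 'M[R]_6).
Local Notation V := 'rV[R]_6.
Implicit Types (X Y Z W : V) (P Q : V -> V -> V -> R).
Hypothesis gJ : hermitian_pair g J.

Definition mtrace3 P Q : R :=
  mtrace g (fun A A' => mtrace g (fun B B' => mtrace g (fun C C' =>
    P A B C * Q A' B' C'))).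

Lemma mtrace3E e P Q : unitary_frame g J e -> trilinear P -> trilinear Q ->
  mtrace3 P Q = sum6 (fun a => sum6 (fun b => sum6 (fun c =>
    P (e a) (e b) (e c) * Q (e a) (e b) (e c)))).
Proof.
move=> eP [p1 p2 p3] [q1 q2 q3].
have E3 A A' B B' : mtrace g (fun C C' => P A B C * Q A' B' C') =
    sum6 (fun c => P A B (e c) * Q A' B' (e c)).
  rewrite (mtraceE gJ eP) -?sum_sum6//.
    by move=> C' a C C0; have /= -> := p3 A B a C C0; ring.
  by move=> C a C' C0; have /= -> := q3 A' B' a C' C0; ring.
have E2 A A' : mtrace g (fun B B' => mtrace g (fun C C' => P A B C * Q A' B' C')) =
    sum6 (fun b => sum6 (fun c => P A (e b) (e c) * Q A' (e b) (e c))).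
  rewrite (mtraceE gJ eP) -?sum_sum6.
  - by apply: eq_bigr => b _; rewrite E3.
  - move=> B' a B B0; rewrite !E3 /sum6.
    have H c : P A (a *: B + B0) (e c) = a * P A B (e c) + P A B0 (e c) by exact: p2.
    by rewrite !H; ring.
  - move=> B a B' B0; rewrite !E3 /sum6.
    have H c : Q A' (a *: B' + B0) (e c) = a * Q A' B' (e c) + Q A' B0 (e c) by exact: q2.
    by rewrite !H; ring.
rewrite /mtrace3 (mtraceE gJ eP) -?sum_sum6.
- by apply: eq_bigr => a _; rewrite E2.
- move=> A' a A A0; rewrite !E2.
  have H b c : P (a *: A + A0) (e b) (e c) = a * P A (e b) (e c) + P A0 (e b) (e c).
    exact: p1.
  rewrite -!sum_sum6 mulr_sumr -big_split/=; apply: eq_bigr => b _.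
  by rewrite -!sum_sum6 mulr_sumr -big_split/=; apply: eq_bigr => c _; rewrite H; ring.
- move=> A a A' A0; rewrite !E2.
  have H b c : Q (a *: A' + A0) (e b) (e c) = a * Q A' (e b) (e c) + Q A0 (e b) (e c).
    exact: q1.
  rewrite -!sum_sum6 mulr_sumr -big_split/=; apply: eq_bigr => b _.
  by rewrite -!sum_sum6 mulr_sumr -big_split/=; apply: eq_bigr => c _; rewrite H; ring.
Qed.

Lemma eq_sum6 (f h : nat -> R) : (forall i, (i < 6)%N -> f i = h i) -> sum6 f = sum6 h.
Proof. by move=> E; rewrite /sum6 !E. Qed.

Lemma det_component_norm (u v : R) :
  sum6 (fun a => sum6 (fun b => sum6 (fun c =>
    det_component u v a b c * det_component u v a b c))) = 24 * (u * u + v * v).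
Proof. by rewrite /sum6 /det_component /=; ring. Qed.

Lemma det_component_contraction (u v : R) (x : nat -> R) i : (i < 6)%N ->
  sum6 (fun a => sum6 (fun b => sum6 (fun c =>
    wedge13 x (det_component u v) i a b c * det_component u v a b c)))
  = 12 * (u * u + v * v) * x i.
Proof.
by case: i => [|[|[|[|[|[|//]]]]]] _;
  rewrite /sum6 /wedge13 /alt4 /det_component /=; ring.
Qed.

Variable beta : V -> V -> V -> R.
Hypothesis betaP : W1 g J beta.

Lemma W1_norm e : unitary_frame g J e -> mtrace3 beta beta =
  24 * (beta (e 0%N) (e 1%N) (e 2%N) * beta (e 0%N) (e 1%N) (e 2%N)
    + - beta (e 3%N) (e 1%N) (e 2%N) * - beta (e 3%N) (e 1%N) (e 2%N)).
Proof.
move=> eP; have b3 := W1_trilinear betaP.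
rewrite (mtrace3E eP b3 b3) -det_component_norm.
do 3 (apply: eq_sum6 => ? ?).
by rewrite (W1_components gJ betaP eP).
Qed.

Lemma W1_norm_eq0 : mtrace3 beta beta = 0 -> forall X Y Z, beta X Y Z = 0.
Proof.
have [e eP] := exists_frame gJ.
rewrite (W1_norm eP); set u := beta _ _ _; set v := - beta _ _ _ => N0.
have [u0 v0] : u = 0 /\ v = 0.
  have : u ^+ 2 + v ^+ 2 == 0 by rewrite !expr2; apply/eqP; lra.
  by rewrite paddr_eq0 ?sqr_ge0// !sqrf_eq0 => /andP[/eqP -> /eqP ->].
have [z1 z2 z3] : trilinear (fun _ _ _ : V => 0 : R).
  by split=> [Y Z|Y Z|Y Z] a U W; rewrite mulr0 addr0.
apply: (trilinear_ext gJ eP (W1_trilinear betaP)) => // i j k i6 j6 k6.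
rewrite (W1_components gJ betaP eP)// -/u -/v u0 v0 /det_component.
by do 3 case: is_J; rewrite ?oppr0 mulr0.
Qed.

(** A 1-form is recovered from its product with beta by contraction with beta; this
    gives an explicit, hence smooth, expression of xi. *)
Lemma wedge13_contraction theta X : scalar theta ->
  mtrace3 (wedge13 theta beta X) beta = 2^-1 * mtrace3 beta beta * theta X.
Proof.
move=> lt.
have [e eP] := exists_frame gJ.
have b3 := W1_trilinear betaP; have [l1 l2 l3] := b3.
have w3 X' : trilinear (wedge13 theta beta X').
  split=> [Y Z|Y Z|Y Z] a U W; rewrite /wedge13 /alt4.
  - have /= -> := l1 Y Z a U W; have /= -> := lt a U W.
    have -> : beta X' (a *: U + W) Z = a * beta X' U Z + beta X' W Z by exact: l2.
    have -> : beta X' (a *: U + W) Y = a * beta X' U Y + beta X' W Y by exact: l2.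
    ring.
  - have /= -> := l2 Y Z a U W; have /= -> := lt a U W.
    have -> : beta X' (a *: U + W) Z = a * beta X' U Z + beta X' W Z by exact: l2.
    have -> : beta X' Y (a *: U + W) = a * beta X' Y U + beta X' Y W by exact: l3.
    ring.
  - have /= -> := l3 Y Z a U W; have /= -> := lt a U W.
    have -> : beta X' Z (a *: U + W) = a * beta X' Z U + beta X' Z W by exact: l3.
    have -> : beta X' Y (a *: U + W) = a * beta X' Y U + beta X' Y W by exact: l3.
    ring.
have E X' : mtrace3 (wedge13 theta beta X') beta =
    sum6 (fun a => sum6 (fun b => sum6 (fun c =>
      wedge13 theta beta X' (e a) (e b) (e c) * beta (e a) (e b) (e c)))).
  exact: mtrace3E.
have [sl sr] : scalar (fun X => mtrace3 (wedge13 theta beta X) beta) /\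
    scalar (fun X => 2^-1 * mtrace3 beta beta * theta X).
  split; last by move=> a U W; rewrite lt; ring.
  move=> a U W; rewrite !E.
  rewrite -!sum_sum6 mulr_sumr -big_split/=; apply: eq_bigr => i _.
  rewrite -!sum_sum6 mulr_sumr -big_split/=; apply: eq_bigr => k _.
  rewrite -!sum_sum6 mulr_sumr -big_split/=; apply: eq_bigr => n _.
  rewrite /wedge13 /alt4 (lt a U W).
  have -> : beta (a *: U + W) (e k) (e n) = a * beta U (e k) (e n) + beta W (e k) (e n).
    exact: l1.
  have -> : beta (a *: U + W) (e i) (e n) = a * beta U (e i) (e n) + beta W (e i) (e n).
    exact: l1.
  have -> : beta (a *: U + W) (e i) (e k) = a * beta U (e i) (e k) + beta W (e i) (e k).
    exact: l1.
  ring.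
apply: (scalar_ext gJ eP sl sr) => i i6.
rewrite E (W1_norm eP).
set u := beta _ _ _; set v := - beta (e 3%N) _ _.
have := det_component_contraction u v (theta \o e) i6.
rewrite /= => C; have -> : 2^-1 * (24 * (u * u + v * v)) * theta (e i)
   = 12 * (u * u + v * v) * theta (e i) by field.
rewrite -C; have BE i1 i2 i3 : (i1 < 6)%N -> (i2 < 6)%N -> (i3 < 6)%N ->
    beta (e i1) (e i2) (e i3) = det_component u v i1 i2 i3.
  exact: (W1_components gJ betaP eP).
by do 3 (apply: eq_sum6 => ? ?); rewrite /wedge13 /alt4 !BE.
Qed.

End Contractions.

Section LeeForm.
Context {R : realType} (g J : 'M[R]_6).
Local Notation V := 'rV[R]_6.
Implicit Types (X Y Z W : V) (beta : V -> V -> V -> R) (mu theta : V -> R).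
Hypothesis gJ : hermitian_pair g J.

(** The cyclic sum of the covariant derivative of a 2-form is its exterior
    derivative. *)
Lemma cyclic_sum_W1_W4 beta mu X Y Z : W1 g J beta ->
  cyclic_sum (fun X Y Z => beta X Y Z + covector_part g J mu X Y Z) X Y Z
  = 3 * beta X Y Z + wedge12 (fun X => 2 * mu (X *m J)) (omega g J) X Y Z.
Proof.
move=> bP; rewrite /cyclic_sum /wedge12 /covector_part.
have gC U S : bilin g U S = bilin g S U by case: gJ.
have gJo U S : bilin g U (S *m J) = omega g J S U by rewrite gC.
have rot U S Q : beta S Q U = beta U S Q.
  by rewrite (W1_swapr bP) (W1_swapl bP) opprK.
rewrite !gJo (rot X Y Z) (rot Z X Y).
rewrite (gC Y X) (gC Z X) (gC Z Y).
rewrite (omega_skew gJ X Y) (omega_skew gJ Y Z) (omega_skew gJ Z X); ring.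
Qed.

(** The factor is chosen so that a form theta /\ omega is sent to theta. *)
Definition lee (dw : V -> V -> V -> R) X : R :=
  4^-1 * mtrace g (fun Y Y' => dw Y (Y' *m J) X).

Lemma eq_lee dw dw' X : (forall X Y Z, dw X Y Z = dw' X Y Z) -> lee dw X = lee dw' X.
Proof.
move=> E; rewrite /lee /mtrace; congr (_ * _).
by apply: eq_bigr => i _; apply: eq_bigr => k _; rewrite E.
Qed.

Lemma leeE beta theta X : W1 g J beta -> scalar theta ->
  lee (fun X Y Z => 3 * beta X Y Z + wedge12 theta (omega g J) X Y Z) X = theta X.
Proof.
move=> bP lt.
have [e eP] := exists_frame gJ.
have [l1 l2 l3] := W1_trilinear bP.
have o1 Y : scalar ((omega g J)^~ Y) by exact: omega_scalar.
have o2 Y : scalar (omega g J Y).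
  by move=> a U W; rewrite !(omega_skew gJ _ Y); have /= -> := o1 Y a U W; ring.
have gC U S : bilin g U S = bilin g S U by case: gJ.
rewrite /lee (mtraceE gJ eP); first last.
- move=> Y a U W; rewrite /wedge12 !mulmxDl -!scalemxAl.
  have /= -> := l2 Y X a (U *m J) (W *m J); have /= -> := o1 X a (U *m J) (W *m J).
  by have /= -> := lt a (U *m J) (W *m J); have /= -> := o2 Y a (U *m J) (W *m J); ring.
- move=> Y a U W; rewrite /wedge12.
  have /= -> := l1 (Y *m J) X a U W; have /= -> := o1 (Y *m J) a U W.
  by have /= -> := lt a U W; have /= -> := o2 X a U W; ring.
have term (i : 'I_6) : 3 * beta (e i) (e i *m J) X +
    wedge12 theta (omega g J) (e i) (e i *m J) X
    = - (bilin g X (e i) * theta (e i)) - bilin g (- (X *m J)) (e i) * theta (e i *m J) + theta X.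
  rewrite /wedge12 /omega (mulJJ gJ).
  have -> : beta (e i) (e i *m J) X = 0.
    have := W1_swapl bP (e i) (e i *m J) X; rewrite (W1_shift12 gJ bP) => E; lra.
  have -> : bilin g (e i *m J) (e i *m J) = 1.
    by case: gJ => _ _ _ ->; case: eP => _ _ _ ->; rewrite ?eqxx.
  by rewrite !bilinNl (gC (e i)); ring.
rewrite (eq_bigr _ (fun (i : 'I_6) _ => term i)) big_split/= sumr_const card_ord.
rewrite big_split/= !sumrN -(scalar_frame gJ eP X lt).
have lt' : scalar (fun Y => theta (Y *m J)).
  by move=> a U W; rewrite mulmxDl -scalemxAl; exact: lt.
rewrite -(scalar_frame gJ eP (- (X *m J)) lt') mulNmx (mulJJ gJ) opprK.
by rewrite -mulr_natr; field.
Qed.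

End LeeForm.

Section TypeAlgebra.
Context {R : realType} (g J : 'M[R]_6).
Local Notation V := 'rV[R]_6.
Implicit Types (X Y Z W : V) (beta : V -> V -> V -> R) (theta : V -> R).
Hypothesis gJ : hermitian_pair g J.
Variables (beta : V -> V -> V -> R).
Hypothesis betaP : W1 g J beta.

(** The second hypothesis is the derivative of the second structure equation.  The
    unknown 1-form df - N (xi - 2 theta) occurs in components in which tau enters
    only through combinations that vanish by the first hypothesis. *)
Lemma norm_derivative (tau : V -> V -> R) (xi theta df : V -> R) (cst : R) :
  scalar xi -> scalar theta -> scalar df ->
  (forall A B C D E, wedge23 tau beta A B C D E = 0) ->
  (forall A B C D E, wedge23 tau (hat J beta) A B C D E
     + 12^-1 * wedge14 (fun X => mtrace3 g beta beta * (xi X - 2 * theta X) - df X)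
         (wedge22 (omega g J) (omega g J)) A B C D E
     + cst * wedge23 (omega g J) beta A B C D E = 0) ->
  forall X, df X = mtrace3 g beta beta * (xi X - 2 * theta X).
Proof.
move=> lxi lth ldf S1 S2; have [e eP] := exists_frame gJ.
pose r X := mtrace3 g beta beta * (xi X - 2 * theta X) - df X.
have lr : scalar r by move=> a U W; rewrite /r lxi lth ldf; ring.
have z : scalar (fun _ : V => 0 : R) by move=> a U W; rewrite mulr0 addr0.
suff H X : r X = 0 by move=> X; have := H X; rewrite /r; lra.
apply: (scalar_ext gJ eP lr z) => i i6.
set u := beta (e 0%N) (e 1%N) (e 2%N); set v := - beta (e 3%N) (e 1%N) (e 2%N).
have BE i1 i2 i3 : (i1 < 6)%N -> (i2 < 6)%N -> (i3 < 6)%N ->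
    beta (e i1) (e i2) (e i3) = det_component u v i1 i2 i3.
  exact: (W1_components gJ betaP eP).
have HE i1 i2 i3 : (i1 < 6)%N -> (i2 < 6)%N -> (i3 < 6)%N ->
    hat J beta (e i1) (e i2) (e i3) = dethat_component u v i1 i2 i3.
  exact: (hat_frame gJ betaP eP).
have OE i1 i2 : (i1 < 6)%N -> (i2 < 6)%N -> omega g J (e i1) (e i2) = omega_component i1 i2.
  exact: (omega_frame gJ eP).
have P1 a b c d f : (a < 6)%N -> (b < 6)%N -> (c < 6)%N -> (d < 6)%N -> (f < 6)%N ->
   wedge23 (fun i k => tau (e i) (e k)) (det_component u v) a b c d f = 0.
  by move=> *; rewrite /wedge23 -!BE//; exact: S1.
have P2 a b c d f : (a < 6)%N -> (b < 6)%N -> (c < 6)%N -> (d < 6)%N -> (f < 6)%N ->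
   wedge23 (fun i k => tau (e i) (e k)) (dethat_component u v) a b c d f
   + 12^-1 * wedge14 (r \o e) (wedge22 omega_component omega_component) a b c d f
   + cst * wedge23 omega_component (det_component u v) a b c d f = 0.
  by move=> *; rewrite /wedge23 -!HE// -!BE// /wedge14 /wedge22 /alt5 -!OE//; exact: S2.
rewrite /wedge23 /wedge14 /wedge22 /alt5 /dethat_component /det_component
  /omega_component /delta /= in P1 P2.
(* the components without the index i in P1, without J_index i in P2 *)
case: i i6 => [|[|[|[|[|[|//]]]]]] _.
- have := P1 1 2 3 4 5 isT isT isT isT isT.
  have := P2 0 1 2 4 5 isT isT isT isT isT.
  by move=> /= ? ?; lra.
- have := P1 0 2 3 4 5 isT isT isT isT isT.
  have := P2 0 1 2 3 5 isT isT isT isT isT.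
  by move=> /= ? ?; lra.
- have := P1 0 1 3 4 5 isT isT isT isT isT.
  have := P2 0 1 2 3 4 isT isT isT isT isT.
  by move=> /= ? ?; lra.
- have := P1 0 1 2 4 5 isT isT isT isT isT.
  have := P2 1 2 3 4 5 isT isT isT isT isT.
  by move=> /= ? ?; lra.
- have := P1 0 1 2 3 5 isT isT isT isT isT.
  have := P2 0 2 3 4 5 isT isT isT isT isT.
  by move=> /= ? ?; lra.
- have := P1 0 1 2 3 4 isT isT isT isT isT.
  have := P2 0 1 3 4 5 isT isT isT isT isT.
  by move=> /= ? ?; lra.
Qed.

Lemma skew_frame_eq0 e (sigma : V -> V -> R) : unitary_frame g J e ->
  (forall Y, scalar (sigma^~ Y)) -> (forall X Y, sigma Y X = - sigma X Y) ->
  (forall i k, (i < k < 6)%N -> sigma (e i) (e k) = 0) ->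
  forall X Y, sigma X Y = 0.
Proof.
move=> eP ls sk z0.
have z : scalar (fun _ : V => 0 : R) by move=> a U W; rewrite mulr0 addr0.
have ls' X : scalar (sigma X).
  by move=> a U W; rewrite !(sk _ X); have /= -> := ls X a U W; ring.
move=> X Y; apply: (scalar_ext gJ eP (ls Y) z) => i i6.
apply: (scalar_ext gJ eP (ls' _) z) => k k6.
have [ik|ki|<-] := ltngtP i k; first by rewrite z0 ?ik.
  by rewrite sk z0 ?ki ?oppr0.
have := sk (e i) (e i); lra.
Qed.

(** The equation in omega kills the part of type (1,1) of sigma, as nu /\ beta has
    no component of type (2,2); the equation in beta kills the part of type
    (2,0)+(0,2), whose components appear there multiplied by u + i v. *)
Lemma lee_derivative_eq0 (sigma : V -> V -> R) (nu : V -> R) :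
  (forall Y, scalar (sigma^~ Y)) -> (forall X Y, sigma Y X = - sigma X Y) ->
  mtrace3 g beta beta != 0 ->
  (forall A B C D E, wedge23 sigma beta A B C D E = 0) ->
  (forall X Y Z W, wedge22 sigma (omega g J) X Y Z W = 3 * wedge13 nu beta X Y Z W) ->
  forall X Y, sigma X Y = 0.
Proof.
move=> ls sk N0 S1 S2; have [e eP] := exists_frame gJ.
rewrite (W1_norm gJ betaP eP) in N0.
set u := beta (e 0%N) (e 1%N) (e 2%N) in N0; set v := - beta (e 3%N) (e 1%N) (e 2%N) in N0.
have uv0 : u * u + v * v != 0 by apply: contraNneq N0 => ->; rewrite mulr0.
have BE i1 i2 i3 : (i1 < 6)%N -> (i2 < 6)%N -> (i3 < 6)%N ->
    beta (e i1) (e i2) (e i3) = det_component u v i1 i2 i3.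
  exact: (W1_components gJ betaP eP).
have OE i1 i2 : (i1 < 6)%N -> (i2 < 6)%N -> omega g J (e i1) (e i2) = omega_component i1 i2.
  exact: (omega_frame gJ eP).
pose s i k := sigma (e i) (e k); pose n i := nu (e i).
have P1 a b c d f : (a < 6)%N -> (b < 6)%N -> (c < 6)%N -> (d < 6)%N -> (f < 6)%N ->
   wedge23 s (det_component u v) a b c d f = 0.
  by move=> *; rewrite /wedge23 -!BE//; exact: S1.
have P2 a b c d : (a < 6)%N -> (b < 6)%N -> (c < 6)%N -> (d < 6)%N ->
   wedge22 s omega_component a b c d = 3 * wedge13 n (det_component u v) a b c d.
  by move=> *; rewrite /wedge22 /wedge13 /alt4 -!BE// -!OE//; exact: S2.
have sS i k : s k i = - s i k by exact: sk.
apply: (skew_frame_eq0 eP ls sk) => i k; rewrite -/(s i k); move: i k.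
clearbody s n.
have complex_eq0 x y : v * x + u * y = 0 -> u * x - v * y = 0 -> x = 0 /\ y = 0.
  move=> E1 E2; split; apply: (mulfI uv0); rewrite mulr0.
    have -> : (u * u + v * v) * x = v * (v * x + u * y) + u * (u * x - v * y) by ring.
    by rewrite E1 E2; ring.
  have -> : (u * u + v * v) * y = u * (v * x + u * y) - v * (u * x - v * y) by ring.
  by rewrite E1 E2; ring.
rewrite /wedge23 /wedge22 /wedge13 /alt4 /det_component /omega_component /delta /= in P1 P2.
have [s03 [s14 s25]] : s 0%N 3%N = 0 /\ s 1%N 4%N = 0 /\ s 2%N 5%N = 0.
  have := P2 0 1 3 4 isT isT isT isT; have := P2 0 2 3 5 isT isT isT isT.
  by have := P2 1 2 4 5 isT isT isT isT => /= ? ? ?; split; [|split]; lra.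
have [x0 y0] : s 1%N 2%N - s 4%N 5%N = 0 /\ s 1%N 5%N - s 2%N 4%N = 0.
  have := P1 1 2 3 4 5 isT isT isT isT isT; have := P1 0 1 2 4 5 isT isT isT isT isT => /= E1 E2.
  by apply: complex_eq0; lra.
have [z0 w0] : s 1%N 2%N + s 4%N 5%N = 0 /\ s 1%N 5%N + s 2%N 4%N = 0.
  have := P2 0 1 2 3 isT isT isT isT; have := P2 0 3 4 5 isT isT isT isT.
  have := P2 0 1 3 5 isT isT isT isT; have := P2 0 2 3 4 isT isT isT isT.
  by move=> /= ? ? ? ?; split; lra.
have [x1 y1] : s 0%N 2%N - s 3%N 5%N = 0 /\ s 0%N 5%N - s 2%N 3%N = 0.
  have := P1 0 2 3 4 5 isT isT isT isT isT; have := P1 0 1 2 3 5 isT isT isT isT isT => /= E1 E2.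
  by apply: complex_eq0; lra.
have [z1 w1] : s 0%N 2%N + s 3%N 5%N = 0 /\ s 0%N 5%N + s 2%N 3%N = 0.
  have := P2 0 1 2 4 isT isT isT isT; have := P2 1 3 4 5 isT isT isT isT.
  have := P2 0 1 4 5 isT isT isT isT; have := P2 1 2 3 4 isT isT isT isT.
  by move=> /= ? ? ? ?; split; lra.
have [x2 y2] : s 0%N 1%N - s 3%N 4%N = 0 /\ s 0%N 4%N - s 1%N 3%N = 0.
  have := P1 0 1 3 4 5 isT isT isT isT isT; have := P1 0 1 2 3 4 isT isT isT isT isT => /= E1 E2.
  by apply: complex_eq0; lra.
have [z2 w2] : s 0%N 1%N + s 3%N 4%N = 0 /\ s 0%N 4%N + s 1%N 3%N = 0.
  have := P2 0 1 2 5 isT isT isT isT; have := P2 2 3 4 5 isT isT isT isT.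
  have := P2 0 2 4 5 isT isT isT isT; have := P2 1 2 3 5 isT isT isT isT.
  by move=> /= ? ? ? ?; split; lra.
clear P1 P2 BE OE.
case=> [|[|[|[|[|[|i]]]]]] [|[|[|[|[|[|k]]]]]] //= ik; try lra.
by move: ik; rewrite andbF.
Qed.

(** The three components sigma(e_i, J e_i) are determined by three components of the
    product; each of the others occurs alone in some component. *)
Lemma wedge_omega_inj (sigma : V -> V -> R) :
  (forall Y, scalar (sigma^~ Y)) -> (forall X Y, sigma Y X = - sigma X Y) ->
  (forall X Y Z W, wedge22 sigma (omega g J) X Y Z W = 0) ->
  forall X Y, sigma X Y = 0.
Proof.
move=> ls sk S2; have [e eP] := exists_frame gJ.
have OE i1 i2 : (i1 < 6)%N -> (i2 < 6)%N -> omega g J (e i1) (e i2) = omega_component i1 i2.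
  exact: (omega_frame gJ eP).
pose s i k := sigma (e i) (e k).
have P2 a b c d : (a < 6)%N -> (b < 6)%N -> (c < 6)%N -> (d < 6)%N ->
   wedge22 s omega_component a b c d = 0.
  by move=> *; rewrite /wedge22 -!OE//; exact: S2.
apply: (skew_frame_eq0 eP ls sk) => i k; rewrite -/(s i k); move: i k.
clearbody s.
rewrite /wedge22 /omega_component /delta /= in P2.
have [s03 [s14 s25]] : s 0%N 3%N = 0 /\ s 1%N 4%N = 0 /\ s 2%N 5%N = 0.
  have := P2 0 1 3 4 isT isT isT isT; have := P2 0 2 3 5 isT isT isT isT.
  by have := P2 1 2 4 5 isT isT isT isT => /= ? ? ?; split; [|split]; lra.
have s01 : s 0%N 1%N = 0 by have := P2 0 1 2 5 isT isT isT isT => /= ?; lra.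
have s02 : s 0%N 2%N = 0 by have := P2 0 1 2 4 isT isT isT isT => /= ?; lra.
have s04 : s 0%N 4%N = 0 by have := P2 0 2 4 5 isT isT isT isT => /= ?; lra.
have s05 : s 0%N 5%N = 0 by have := P2 0 1 4 5 isT isT isT isT => /= ?; lra.
have s12 : s 1%N 2%N = 0 by have := P2 0 1 2 3 isT isT isT isT => /= ?; lra.
have s13 : s 1%N 3%N = 0 by have := P2 1 2 3 5 isT isT isT isT => /= ?; lra.
have s15 : s 1%N 5%N = 0 by have := P2 0 1 3 5 isT isT isT isT => /= ?; lra.
have s23 : s 2%N 3%N = 0 by have := P2 1 2 3 4 isT isT isT isT => /= ?; lra.
have s24 : s 2%N 4%N = 0 by have := P2 0 2 3 4 isT isT isT isT => /= ?; lra.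
have s34 : s 3%N 4%N = 0 by have := P2 2 3 4 5 isT isT isT isT => /= ?; lra.
have s35 : s 3%N 5%N = 0 by have := P2 1 3 4 5 isT isT isT isT => /= ?; lra.
have s45 : s 4%N 5%N = 0 by have := P2 0 3 4 5 isT isT isT isT => /= ?; lra.
by case=> [|[|[|[|[|[|i]]]]]] [|[|[|[|[|[|k]]]]]] //= ik; move: ik; rewrite andbF.
Qed.

End TypeAlgebra.

(** * Smooth tensor fields on an open set *)

Section SmoothTensors.
Context {R : realType}.
Local Notation V := 'rV[R]_6.
Variable O : set V.
Hypothesis oO : open O.
Implicit Types (x y U X Y Z W v w : V) (f : V -> R).

Lemma smooth_D f v : smooth O f -> smooth O ('D_v f).
Proof. by move=> sf k; exact: (Ck_D v (sf k.+1)). Qed.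

Lemma smooth_derivable f x v : smooth O f -> O x -> derivable f x v.
Proof. by move=> sf Ox; exact: (Ck_der (sf 1%N) Ox). Qed.

Lemma smooth_derive_scalar f x : smooth O f -> O x -> scalar (fun v => 'D_v f x).
Proof.
move=> sf Ox a v w; have df := C1_differentiable oO (sf 1%N) Ox.
by rewrite !deriveE// linearP.
Qed.

Lemma smooth_schwarz f x v w : smooth O f -> O x ->
  'D_v ('D_w f) x = 'D_w ('D_v f) x.
Proof. by move=> sf Ox; exact: schwarz oO (sf 2%N) Ox. Qed.

Lemma smooth_ext f g : (forall x, O x -> f x = g x) -> smooth O f -> smooth O g.
Proof. by move=> fg sf k; exact: Ck_ext oO fg (sf k). Qed.

Lemma smooth_cst (c : R) : smooth O (fun=> c).
Proof. by move=> k; exact: Ck_cst. Qed.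

Lemma smooth_add f g : smooth O f -> smooth O g -> smooth O (fun x => f x + g x).
Proof. by move=> sf sg k; exact: Ck_add. Qed.

Lemma smooth_mul f g : smooth O f -> smooth O g -> smooth O (fun x => f x * g x).
Proof. by move=> sf sg k; exact: Ck_mul. Qed.

Lemma smooth_opp f : smooth O f -> smooth O (fun x => - f x).
Proof. by move=> sf k; exact: Ck_opp. Qed.

Lemma smooth_sub f g : smooth O f -> smooth O g -> smooth O (fun x => f x - g x).
Proof. by move=> sf sg; apply: smooth_add => //; exact: smooth_opp. Qed.

Lemma smooth_inv f : (forall x, O x -> f x != 0) -> smooth O f ->
  smooth O (fun x => (f x)^-1).
Proof. by move=> f0 sf k; exact: Ck_inv. Qed.

Lemma smooth_sum (I : Type) (r : seq I) (P : pred I) (f : I -> V -> R) :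
  (forall i, P i -> smooth O (f i)) -> smooth O (fun x => \sum_(i <- r | P i) f i x).
Proof. by move=> sf k; apply: Ck_sum => // i Pi; exact: sf. Qed.

Lemma smooth_mx (p q : nat) (A : V -> 'M[R]_(p, q)) :
  smooth O A <-> forall i j, smooth O (fun x => A x i j).
Proof.
split=> [sA i j k|sA k]; first by have /(Ck_mxP _ _ oO) := sA k; exact.
by apply/(Ck_mxP _ _ oO) => i j; exact: sA.
Qed.

Lemma smooth_continuous (W : normedModType R) (f : V -> W) x :
  smooth O f -> O x -> {for x, continuous f}.
Proof. by move=> sf Ox; exact: (Ck_cont (sf 0%N) Ox). Qed.

Lemma scalar_coord (B : V -> R) U : scalar B ->
  B U = \sum_(i < 6) U 0 i * B (delta_mx 0 i).
Proof.
move=> lB; rewrite {1}(row_sum_delta U) (scalar_sum _ _ _ lB).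
by apply: eq_bigr => i _; rewrite (scalarZ _ _ lB).
Qed.

(** In coordinates, a field of linear forms applied to a vector field is a sum of
    products. *)
Lemma smooth_insert (B : V -> V -> R) (Vf : V -> V) :
  (forall U, smooth O (B^~ U)) -> (forall y, O y -> scalar (B y)) ->
  smooth O Vf -> smooth O (fun y => B y (Vf y)).
Proof.
move=> sB lB sV.
apply: (@smooth_ext (fun y => \sum_(i < 6) Vf y 0 i * B y (delta_mx 0 i))).
  by move=> y Oy; rewrite -(scalar_coord _ (lB y Oy)).
apply: smooth_sum => i _; apply: smooth_mul; last exact: sB.
by have /smooth_mx := sV; apply.
Qed.

(** The Leibniz rule. *)
Lemma derive_insert (B : V -> V -> R) (Vf : V -> V) x w :
  (forall U, derivable (B^~ U) x w) -> (forall y, O y -> scalar (B y)) ->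
  derivable Vf x w -> O x ->
  is_derive x w (fun y => B y (Vf y)) ('D_w (B^~ (Vf x)) x + B x ('D_w Vf x)).
Proof.
move=> dB lB dV Ox.
have dVi i : derivable (fun y => Vf y 0 i) x w by have /derivable_mxP := dV; apply.
have H i : is_derive x w (fun y => Vf y 0 i * B y (delta_mx 0 i))
    ('D_w (fun y => Vf y 0 i) x * B x (delta_mx 0 i)
      + Vf x 0 i * 'D_w (B^~ (delta_mx 0 i)) x).
  exact: is_derive_mul.
have [D E] := is_derive_big (index_enum 'I_6) (P := xpredT)
  (f := fun i y => Vf y 0 i * B y (delta_mx 0 i))
  (fun i _ => let: DeriveDef d _ := H i in d).
have [D' E'] := is_derive_big (index_enum 'I_6) (P := xpredT)
  (f := fun i y => Vf x 0 i * B y (delta_mx 0 i)) (x := x) (v := w)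
  (fun i _ => let: DeriveDef d _ := is_derive_mul (derivable_cst (Vf x 0 i) x w)
     (dB (delta_mx 0 i)) in d).
have E1 y : O y -> \sum_(i < 6) Vf y 0 i * B y (delta_mx 0 i) = B y (Vf y).
  by move=> Oy; rewrite -(scalar_coord _ (lB y Oy)).
have E2 y : O y -> \sum_(i < 6) Vf x 0 i * B y (delta_mx 0 i) = B y (Vf x).
  by move=> Oy; rewrite -(scalar_coord _ (lB y Oy)).
split; first exact: (open_eq_derivable oO E1 Ox D).
rewrite -(open_eq_derive w oO E1 Ox) E -(open_eq_derive w oO E2 Ox) E'.
rewrite (scalar_coord _ (lB x Ox)) -big_split/=; apply: eq_bigr => i _.
have [_ ->] := H i.
have [_ ->] := is_derive_mul (derivable_cst (Vf x 0 i) x w) (dB (delta_mx 0 i)).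
by rewrite derive_cst mul0r add0r addrC derive_mx// mxE.
Qed.

Lemma differentiable_mx (p q : nat) (A : V -> 'M[R]_(p, q)) x :
  (forall i j, differentiable (fun y => A y i j) x) -> differentiable A x.
Proof.
move=> dA; rewrite (_ : A = \sum_(i < p) \sum_(j < q)
  (fun y => A y i j *: delta_mx i j)).
  apply: differentiable_sum => i; apply: differentiable_sum => j.
  exact: differentiableZl.
apply/funext => y; rewrite fct_sumE {1}(matrix_sum_delta (A y)).
by apply: eq_bigr => i _; rewrite fct_sumE.
Qed.

Lemma smooth_differentiable (p q : nat) (A : V -> 'M[R]_(p, q)) x :
  smooth O A -> O x -> differentiable A x.
Proof.
move=> /smooth_mx sA Ox; apply: differentiable_mx => i j.
exact: C1_differentiable oO (sA i j 1%N) Ox.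
Qed.

Lemma is_derive_bilin (A : V -> 'M[R]_6) x w Y Z : derivable A x w ->
  is_derive x w (fun y => bilin (A y) Y Z) (bilin ('D_w A x) Y Z).
Proof.
move=> dA; have dAi i j : derivable (fun y => A y i j) x w.
  by have /derivable_mxP := dA; apply.
have E (B : 'M[R]_6) : bilin B Y Z = \sum_j \sum_i (Y 0 i * Z 0 j) * B i j.
  rewrite /bilin mxE; apply: eq_bigr => j _; rewrite mxE mulr_suml.
  by apply: eq_bigr => i _; rewrite mxE; ring.
have H i j : is_derive x w (fun y => (Y 0 i * Z 0 j) * A y i j)
    ((Y 0 i * Z 0 j) * 'D_w A x i j).
  have [d e] := is_derive_mul (derivable_cst (Y 0 i * Z 0 j) x w) (dAi i j).
  by split=> //; rewrite e derive_cst mul0r add0r derive_mx// mxE.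
have H2 j : is_derive x w (fun y => \sum_i (Y 0 i * Z 0 j) * A y i j)
    (\sum_i (Y 0 i * Z 0 j) * 'D_w A x i j).
  have [d e] := is_derive_big (index_enum 'I_6) (P := xpredT)
    (f := fun i y => (Y 0 i * Z 0 j) * A y i j)
    (fun i _ => let: DeriveDef d _ := H i j in d).
  by split=> //; rewrite e; apply: eq_bigr => i _; have [_ ->] := H i j.
have [d e] := is_derive_big (index_enum 'I_6) (P := xpredT)
    (f := fun j y => \sum_i (Y 0 i * Z 0 j) * A y i j)
    (fun j _ => let: DeriveDef d _ := H2 j in d).
rewrite E (_ : (fun y => bilin (A y) Y Z) =
  fun y => \sum_j \sum_i (Y 0 i * Z 0 j) * A y i j); last by apply/funext => y.
by split=> //; rewrite e; apply: eq_bigr => j _; have [_ ->] := H2 j.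
Qed.

Lemma smooth_bilin (A : V -> 'M[R]_6) Y Z : smooth O A ->
  smooth O (fun y => bilin (A y) Y Z).
Proof.
move=> /smooth_mx sA.
apply: (@smooth_ext (fun y => \sum_j \sum_i (Y 0 i * Z 0 j) * A y i j)).
  move=> y _; rewrite /bilin mxE; apply: eq_bigr => j _; rewrite mxE mulr_suml.
  by apply: eq_bigr => i _; rewrite mxE; ring.
do 2 (apply: smooth_sum => ? _).
by apply: smooth_mul; [exact: smooth_cst|exact: sA].
Qed.

Lemma smooth_mulmx (p q r : nat) (A : V -> 'M[R]_(p, q)) (B : V -> 'M[R]_(q, r)) :
  smooth O A -> smooth O B -> smooth O (fun y => A y *m B y).
Proof.
move=> /smooth_mx sA /smooth_mx sB; apply/smooth_mx => i j.
apply: (@smooth_ext (fun y => \sum_k A y i k * B y k j)).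
  by move=> y _; rewrite mxE.
by apply: smooth_sum => k _; exact: smooth_mul.
Qed.

Lemma smooth_cst_mx (p q : nat) (A : 'M[R]_(p, q)) : smooth O (fun=> A).
Proof. by apply/smooth_mx => i j; exact: smooth_cst. Qed.

Lemma smooth_mtrace (G : V -> 'M[R]_6) (phi : V -> V -> V -> R) :
  smooth O G -> (forall x, O x -> G x \in unitmx) ->
  (forall X Y, smooth O (fun y => phi y X Y)) ->
  smooth O (fun y => mtrace (G y) (phi y)).
Proof.
move=> /smooth_mx sG uG sphi; rewrite /mtrace; do 2 (apply: smooth_sum => ? _).
apply: smooth_mul; last exact: sphi.
by move=> k; apply: Ck_invmx => // i j; exact: sG.
Qed.

Lemma smooth_mtrace3 (G : V -> 'M[R]_6) (P Q : V -> V -> V -> V -> R) :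
  smooth O G -> (forall x, O x -> G x \in unitmx) ->
  (forall X Y Z, smooth O (fun y => P y X Y Z)) ->
  (forall X Y Z, smooth O (fun y => Q y X Y Z)) ->
  smooth O (fun y => mtrace3 (G y) (P y) (Q y)).
Proof.
move=> sG uG sP sQ; do 3 (apply: smooth_mtrace => // ? ?).
exact: smooth_mul.
Qed.

End SmoothTensors.

(** The structure equations in terms of a derivative D of beta and a torsion-free
    metric connection Ga; the terms in Ga disappear by symmetry. *)
Section ConnectionStructure.
Context {R : realType} (g J : 'M[R]_6).
Local Notation V := 'rV[R]_6.
Implicit Types (X Y Z W : V).
Hypothesis gJ : hermitian_pair g J.
Variables (B : V -> V -> V -> R) (mu : V -> R) (D : V -> V -> V -> V -> R).
Variables (Ga : V -> V -> V) (DJ : V -> 'M[R]_6).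
Hypothesis BP : W1 g J B.
Hypothesis lmu : scalar mu.
Hypothesis GaC : forall X Y, Ga X Y = Ga Y X.
Hypothesis GaD : forall Y a X X', Ga (a *: X + X') Y = a *: Ga X Y + Ga X' Y.
Hypothesis D1 : forall Y Z W, scalar (fun X => D X Y Z W).
Hypothesis D3 : forall X, trilinear (D X).
Hypothesis Dl : forall X Y Z W, D X Z Y W = - D X Y Z W.
Hypothesis Dr : forall X Y Z W, D X Y W Z = - D X Y Z W.
Hypothesis DT : forall X Y Z W,
  D X (Y *m J) (Z *m J) W + B (Y *m DJ X) (Z *m J) W + B (Y *m J) (Z *m DJ X) W
  = - D X Y Z W.

Let j X Y : V := Y *m DJ X + Ga X (Y *m J) - Ga X Y *m J.

Hypothesis jP : forall X Y Z,
  bilin g (j X Y) Z = B X Y Z + covector_part g J mu X Y Z.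

(** A torsion-free connection does not contribute to an exterior derivative. *)
Lemma alt4_symmetric (C : V -> V -> V -> R) X Y Z W :
  (forall X Y Z, C Y X Z = - C X Y Z) -> (forall X Y Z, C X Z Y = - C X Y Z) ->
  alt4 (fun X Y Z W => C (Ga X Y) Z W + C Y (Ga X Z) W + C Y Z (Ga X W)) X Y Z W = 0.
Proof.
move=> sl sr; rewrite /alt4.
rewrite (GaC Y X) (GaC Z X) (GaC W X) (GaC Z Y) (GaC W Y) (GaC W Z).
rewrite (sl (Ga X Z) Y) (sr Y (Ga X W) Z) (sl (Ga X W) Y Z) (sl (Ga Y Z) X W).
rewrite (sr X (Ga Y W) Z) (sr X (Ga Z W) Y).
ring.
Qed.

Lemma connection_structure : mtrace3 g B B != 0 ->
  exists2 xi : V -> R, scalar xi & forall X Y Z W,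
    alt4 D X Y Z W = wedge13 xi B X Y Z W /\
    alt4 (fun X Y Z W => - D X (Y *m J) Z W - B (Y *m DJ X) Z W) X Y Z W
      = wedge13 xi (hat J B) X Y Z W
      - 12^-1 * mtrace3 g B B * wedge22 (omega g J) (omega g J) X Y Z W.
Proof.
move=> N0; have [l1 l2 l3] := W1_trilinear BP; have [e eP] := exists_frame gJ.
pose b X Y Z W := D X Y Z W - (B (Ga X Y) Z W + B Y (Ga X Z) W + B Y Z (Ga X W)).
have GaD' a X Y Y' : Ga X (a *: Y + Y') = a *: Ga X Y + Ga X Y'.
  by rewrite !(GaC X); exact: GaD.
have N2 U S Q : B U (- S) Q = - B U S Q by exact: (scalarN S (l2 U Q)).
have N1 U S Q : B (- U) S Q = - B U S Q by exact: (scalarN U (l1 S Q)).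
have sh12 U S Q : B (U *m J) S Q = B U (S *m J) Q by exact: (W1_shift12 gJ BP).
have JJ (U : V) : U *m J *m J = - U by exact: (mulJJ gJ).
have B2 U S S' Q : B U (S + S') Q = B U S Q + B U S' Q.
  exact: (scalarD S S' (l2 U Q)).
have B1 U U' S Q : B (U + U') S Q = B U S Q + B U' S Q.
  exact: (scalarD U U' (l1 S Q)).
have sl := W1_swapl BP; have sr := W1_swapr BP.
have b1 Y Z W : scalar (fun X => b X Y Z W).
  move=> a X X'; rewrite /b !GaD.
  have -> := D1 Y Z W a X X'; have -> := l1 Z W a (Ga X Y) (Ga X' Y).
  have -> := l2 Y W a (Ga X Z) (Ga X' Z); have -> := l3 Y Z a (Ga X W) (Ga X' W).
  ring.
have b3 X : trilinear (b X).
  have [d1 d2 d3] := D3 X.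
  split=> [Y Z|Y Z|Y Z] a U U'; rewrite /b !GaD'.
  - have -> := d1 Y Z a U U'; have -> := l1 Y Z a (Ga X U) (Ga X U').
    have -> := l1 (Ga X Y) Z a U U'; have -> := l1 Y (Ga X Z) a U U'.
    ring.
  - have -> := d2 Y Z a U U'; have -> := l2 Y Z a (Ga X U) (Ga X U').
    have -> := l2 (Ga X Y) Z a U U'; have -> := l2 Y (Ga X Z) a U U'.
    ring.
  - have -> := d3 Y Z a U U'; have -> := l3 Y Z a (Ga X U) (Ga X U').
    have -> := l3 (Ga X Y) Z a U U'; have -> := l3 Y (Ga X Z) a U U'.
    ring.
have bl X Y Z W : b X Z Y W = - b X Y Z W.
  by rewrite /b Dl (sl Y (Ga X Z)) (sl (Ga X Y) Z) (sl Y Z); ring.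
have br X Y Z W : b X Y W Z = - b X Y Z W.
  by rewrite /b Dr (sr (Ga X Y)) (sr Y Z) (sr Y (Ga X Z)); ring.
have bJ X Y Z W : b X (Y *m J) (Z *m J) W + B (j X Y) (Z *m J) W
    + B (Y *m J) (j X Z) W = - b X Y Z W.
  have := DT X Y Z W; rewrite /b /j !B1 !B2 !N1 !N2.
  rewrite (sh12 (Ga X Y)) (sh12 Y (Ga X Z *m J)) (sh12 Y (Z *m J)) !JJ !N2.
  lra.
have u0 : B (e 0%N) (e 1%N) (e 2%N) * B (e 0%N) (e 1%N) (e 2%N) +
    - B (e 3%N) (e 1%N) (e 2%N) * - B (e 3%N) (e 1%N) (e 2%N) != 0.
  by move: N0; rewrite (W1_norm gJ BP eP) mulf_eq0 negb_or => /andP[].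
have [xi lxi xiP] := structure_equations gJ eP BP lmu jP b1 b3 bl br bJ u0.
exists xi => // X Y Z W; have [E1 E2] := xiP X Y Z W.
have hP := hat_W1 gJ BP.
have aG := alt4_symmetric X Y Z W sl sr.
have aH := alt4_symmetric X Y Z W (W1_swapl hP) (W1_swapr hP).
have hatE X' Y' Z' W' : - D X' (Y' *m J) Z' W' - B (Y' *m DJ X') Z' W'
   = bhat J B j b X' Y' Z' W' + (hat J B (Ga X' Y') Z' W' + hat J B Y' (Ga X' Z') W'
     + hat J B Y' Z' (Ga X' W')).
  by rewrite /bhat /b /hat /j !B1 !N1; ring.
split.
- rewrite -E1 -[LHS]subr0 -aG /alt4 /b; ring.
- have -> : 12^-1 * mtrace3 g B B = 2 * (B (e 0%N) (e 1%N) (e 2%N) * B (e 0%N) (e 1%N) (e 2%N) +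
     - B (e 3%N) (e 1%N) (e 2%N) * - B (e 3%N) (e 1%N) (e 2%N)).
    by rewrite (W1_norm gJ BP eP); field.
  rewrite -E2 -[RHS]addr0 -aH /alt4 !hatE.
  move: (bhat J B j b) (hat J B) => b' h; ring.
Qed.

End ConnectionStructure.

(** * Second exterior derivatives *)

Section ExteriorDerivative.
Context {R : realType}.

(** The derivative of d B = xi /\ B + C; H stands for the second derivatives of B,
    and their symmetry makes the left-hand side disappear. *)
Lemma alt5_identity (T : Type) (H dC : T -> T -> T -> T -> T -> R)
    (dX : T -> T -> R) (xi : T -> R) (dB C : T -> T -> T -> T -> R)
    (B : T -> T -> T -> R) a b c d e :
  (forall a b c d e, H a b c d e = H b a c d e) ->
  (forall a b c d e,
     H a b c d e - H a c b d e + H a d b c e - H a e b c d =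
     (dX a b * B c d e + xi b * dB a c d e) - (dX a c * B b d e + xi c * dB a b d e)
     + (dX a d * B b c e + xi d * dB a b c e) - (dX a e * B b c d + xi e * dB a b c d)
     + dC a b c d e) ->
  (forall a b c d, alt4 dB a b c d = wedge13 xi B a b c d + C a b c d) ->
  wedge23 (fun x y => dX x y - dX y x) B a b c d e - wedge14 xi C a b c d e
   + alt5 dC a b c d e = 0.
Proof.
move=> Hs E1 E2.
have C_E x y z w : C x y z w = alt4 dB x y z w - wedge13 xi B x y z w.
  by rewrite E2; ring.
have dC_E x y z w t : dC x y z w t =
     H x y z w t - H x z y w t + H x w y z t - H x t y z w -
     ((dX x y * B z w t + xi y * dB x z w t) - (dX x z * B y w t + xi z * dB x y w t)
     + (dX x w * B y z t + xi w * dB x y z t) - (dX x t * B y z w + xi t * dB x y z w)).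
  by rewrite E1; ring.
rewrite /alt5 /wedge14 /alt5 /wedge23 !C_E !dC_E /wedge13 /alt4.
rewrite (Hs b a) (Hs c a) (Hs d a) (Hs e a) (Hs c b) (Hs d b) (Hs e b) (Hs d c) (Hs e c).
rewrite (Hs e d).
ring.
Qed.

(** The exterior derivative of the square of a 2-form. *)
Lemma alt5_wedge22 (T : Type) (o : T -> T -> R) (w : T -> T -> T -> R) a b c d e :
  (forall x y z, w x z y = - w x y z) ->
  alt5 (fun a b c d e =>
    w a b c * o d e + o b c * w a d e - (w a b d * o c e + o b d * w a c e)
    + (w a b e * o c d + o b e * w a c d)
    + (w a c d * o b e + o c d * w a b e) - (w a c e * o b d + o c e * w a b d)
    + (w a d e * o b c + o d e * w a b c)) a b c d e
  = 2 * wedge23 o (cyclic_sum w) a b c d e.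
Proof.
move=> ws; rewrite /alt5 /wedge23 /cyclic_sum.
rewrite ?(ws _ a b) ?(ws _ a c) ?(ws _ a d) ?(ws _ a e) ?(ws _ b c) ?(ws _ b d).
rewrite ?(ws _ b e) ?(ws _ c d) ?(ws _ c e) ?(ws _ d e).
ring.
Qed.

Lemma wedge23_wedge12 (T : Type) (o : T -> T -> R) (t : T -> R) (B : T -> T -> T -> R)
    a b c d e : (forall x y, o y x = - o x y) ->
  wedge23 o (fun x y z => 3 * B x y z + wedge12 t o x y z) a b c d e
  = 3 * wedge23 o B a b c d e + wedge14 t (wedge22 o o) a b c d e.
Proof.
move=> os; rewrite /wedge23 /wedge14 /alt5 /wedge22 /wedge12.
rewrite (os b a) (os c a) (os d a) (os e a) (os c b) (os d b) (os e b) (os d c) (os e c).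
rewrite (os e d); ring.
Qed.

(** The derivative of d o = 3 B + t /\ o for a 2-form o; here w stands for the first
    and H for the second derivatives of o. *)
Lemma alt4_identity (T : Type) (H : T -> T -> T -> T -> R)
    (dt : T -> T -> R) (t : T -> R) (w : T -> T -> T -> R) (dB : T -> T -> T -> T -> R)
    (B : T -> T -> T -> R) (o : T -> T -> R) a b c d :
  (forall a b c d, H a b c d = H b a c d) ->
  (forall a b c d, H a b d c = - H a b c d) ->
  (forall x y, o y x = - o x y) ->
  (forall x y z, w x z y = - w x y z) ->
  (forall a b c d, H a b c d + H a c d b + H a d b c =
     3 * dB a b c d + (dt a b * o c d + t b * w a c d) + (dt a c * o d b + t c * w a d b)
     + (dt a d * o b c + t d * w a b c)) ->
  (forall a b c, cyclic_sum w a b c = 3 * B a b c + wedge12 t o a b c) ->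
  wedge22 (fun x y => dt x y - dt y x) o a b c d
  = 3 * (wedge13 t B a b c d - alt4 dB a b c d).
Proof.
move=> Hs Hk os ws E1 E2.
have BE x y z : 3 * B x y z = cyclic_sum w x y z - wedge12 t o x y z.
  by rewrite E2; ring.
have dBE x y z u : 3 * dB x y z u = H x y z u + H x z u y + H x u y z -
   ((dt x y * o z u + t y * w x z u) + (dt x z * o u y + t z * w x u y)
     + (dt x u * o y z + t u * w x y z)).
  by rewrite E1; ring.
rewrite /wedge13 /alt4.
have -> : 3 * (t a * B b c d - t b * B a c d + t c * B a b d - t d * B a b c -
   (dB a b c d - dB b a c d + dB c a b d - dB d a b c)) =
  t a * (3 * B b c d) - t b * (3 * B a c d) + t c * (3 * B a b d) - t d * (3 * B a b c) -
   (3 * dB a b c d - 3 * dB b a c d + 3 * dB c a b d - 3 * dB d a b c) by ring.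
rewrite !BE !dBE /wedge12 /cyclic_sum /wedge22.
rewrite (os b a) (os c a) (os d a) (os c b) (os d b) (os d c).
rewrite ?(ws _ a b) ?(ws _ a c) ?(ws _ a d) ?(ws _ b c) ?(ws _ b d) ?(ws _ c d).
rewrite ?(Hk _ _ a b) ?(Hk _ _ a c) ?(Hk _ _ a d) ?(Hk _ _ b c) ?(Hk _ _ b d) ?(Hk _ _ c d).
rewrite (Hs b a) (Hs c a) (Hs d a) (Hs c b) (Hs d b) (Hs d c).
ring.
Qed.

Section LinearRules.
Context (T : Type) (t xi : T -> R) (Q : T -> T -> T -> T -> R).
Context (r : T -> T -> T -> T -> T -> R) (k n : R) (a b c d e : T).

Lemma alt5_combination :
  alt5 (fun a b c d e => - (k * (t a * Q b c d e + n * r a b c d e))) a b c d e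
  = - (k * (wedge14 t Q a b c d e + n * alt5 r a b c d e)).
Proof. by rewrite /wedge14 /alt5; ring. Qed.

Lemma wedge14_scale :
  wedge14 t (fun a b c d => - (k * n * Q a b c d)) a b c d e
  = - (k * n * wedge14 t Q a b c d e).
Proof. by rewrite /wedge14 /alt5; ring. Qed.

Lemma wedge14_combination (u : T -> R) :
  wedge14 (fun x => n * (xi x - 2 * t x) - u x) Q a b c d e
  = n * (wedge14 xi Q a b c d e - 2 * wedge14 t Q a b c d e) - wedge14 u Q a b c d e.
Proof. by rewrite /wedge14 /alt5; ring. Qed.

End LinearRules.

End ExteriorDerivative.

Section DerivativesOfForms.
Context {R : realType} {V : normedModType R} {T : Type}.
Implicit Types (f g : V -> R) (x v : V).

Lemma is_derive_sum2 f g df dg x v : is_derive x v f df -> is_derive x v g dg ->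
  is_derive x v (fun y => f y + g y) (df + dg).
Proof. by move=> [d <-] [d' <-]; exact: is_derive_add. Qed.

Lemma is_derive_prod2 f g df dg x v : is_derive x v f df -> is_derive x v g dg ->
  is_derive x v (fun y => f y * g y) (df * g x + f x * dg).
Proof. by move=> [d <-] [d' <-]; exact: is_derive_mul. Qed.

Lemma is_derive_diff2 f g df dg x v : is_derive x v f df -> is_derive x v g dg ->
  is_derive x v (fun y => f y - g y) (df - dg).
Proof. by move=> Hf Hg; exact: is_deriveB. Qed.

Lemma is_derive_alt4 (Q : V -> T -> T -> T -> T -> R) dQ x v a b c d :
  (forall a b c d, is_derive x v (fun y => Q y a b c d) (dQ a b c d)) ->
  is_derive x v (fun y => alt4 (Q y) a b c d) (alt4 dQ a b c d).
Proof.
move=> H; exact: is_derive_diff2 (is_derive_sum2 (is_derive_diff2 (H a b c d) (H b a c d))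
  (H c a b d)) (H d a b c).
Qed.

Lemma is_derive_wedge13 (t : V -> T -> R) (B : V -> T -> T -> T -> R) dt dB x v a b c d :
  (forall a, is_derive x v (fun y => t y a) (dt a)) ->
  (forall a b c, is_derive x v (fun y => B y a b c) (dB a b c)) ->
  is_derive x v (fun y => wedge13 (t y) (B y) a b c d)
    (alt4 (fun a b c d => dt a * B x b c d + t x a * dB b c d) a b c d).
Proof.
move=> Ht HB; apply: (@is_derive_alt4 (fun y a b c d => t y a * B y b c d)) => a' b' c' d'.
exact: is_derive_prod2.
Qed.

Lemma is_derive_wedge22 (o : V -> T -> T -> R) w x v a b c d :
  (forall a b, is_derive x v (fun y => o y a b) (w a b)) ->
  is_derive x v (fun y => wedge22 (o y) (o y) a b c d)
    (w a b * o x c d + o x a b * w c d - (w a c * o x b d + o x a c * w b d)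
     + (w a d * o x b c + o x a d * w b c) + (w b c * o x a d + o x b c * w a d)
     - (w b d * o x a c + o x b d * w a c) + (w c d * o x a b + o x c d * w a b)).
Proof.
move=> H; rewrite /wedge22.
have P a' b' c' d' := is_derive_prod2 (H a' b') (H c' d').
exact: is_derive_sum2 (is_derive_diff2 (is_derive_sum2 (is_derive_sum2
  (is_derive_diff2 (P a b c d) (P a c b d)) (P a d b c)) (P b c a d)) (P b d a c))
  (P c d a b).
Qed.

End DerivativesOfForms.

(** The connections c and c' of g and f g differ by a multiple of df.  The change
    that this causes in the derivative of the Kaehler form, together with the
    derivative of the factor f, is a multiple of the W4 tensor of the covector
    theta J. *)
Section ConformalAlgebra.
Context {R : realType} (g J : 'M[R]_6).
Local Notation V := 'rV[R]_6.
Hypothesis gJ : hermitian_pair g J.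
Variables (theta : V -> R) (c c' : V -> V -> V) (dk f : R).
Hypothesis lth : scalar theta.

Lemma conformal_algebra X Y Z :
  (forall U S Q, bilin g (c' U S) Q = bilin g (c U S) Q
    - 2^-1 * (theta U * bilin g S Q + theta S * bilin g U Q - theta Q * bilin g U S)) ->
  f * (dk - theta X * - bilin g Y (Z *m J)) - - (f * bilin g (c' X Y) (Z *m J))
    - - (f * bilin g Y (c' X Z *m J))
  = f * (dk - - bilin g (c X Y) (Z *m J) - - bilin g Y (c X Z *m J)
     - covector_part g J (fun U => - 2^-1 * theta (U *m J)) X Y Z).
Proof.
move=> cE; have [gC _ _ gJi] := gJ.
have sh U S : bilin g U (S *m J) = - bilin g (U *m J) S.
  by rewrite -[bilin g (U *m J) S]gJi (mulJJ gJ) bilinNl opprK.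
have thJJ U : theta (U *m J *m J) = - theta U.
  by rewrite (mulJJ gJ); exact: (scalarN U lth).
rewrite (sh Y (c _ _)) (sh Y (c' _ _)).
rewrite (gC (Y *m J) (c _ _)) (gC (Y *m J) (c' _ _)) !cE /covector_part /= !thJJ.
by rewrite (gC Z (Y *m J)) (sh Y Z); field.
Qed.

End ConformalAlgebra.

(** * The Lee form of an almost Hermitian structure in a chart *)

Section ChartGeometry.
Context {R : realType}.
Local Notation V := 'rV[R]_6.
Variables (O : set V) (G J : V -> 'M[R]_6).
Hypothesis oO : open O.
Hypothesis sG : smooth O G.
Hypothesis sJ : smooth O J.
Hypothesis GJ : forall x, O x -> hermitian_pair (G x) (J x).
Implicit Types (x y U X Y Z W v w : V).

Definition kahler x X Y : R := bilin (kahler_form G J x) X Y.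

Definition dkahler x : V -> V -> V -> R :=
  cyclic_sum (fun X Y Z => 'D_X (fun y => kahler y Y Z) x).

Definition lee_form x : V -> R := lee (G x) (J x) (dkahler x).

(** The W1 part of the derivative of the Kaehler form, see nabla_decomposition. *)
Definition skew_part x X Y Z : R :=
  3^-1 * (dkahler x X Y Z - wedge12 (lee_form x) (kahler x) X Y Z).

Lemma kahlerE x X Y : kahler x X Y = omega (G x) (J x) X Y.
Proof. by rewrite /kahler /omega /kahler_form /bilin mulmxA. Qed.

Lemma kahler_skew x X Y : O x -> kahler x Y X = - kahler x X Y.
Proof. by move=> Ox; rewrite !kahlerE (omega_skew (GJ Ox)). Qed.

Lemma kahler_scalarl x Y : scalar (kahler x ^~ Y).
Proof. exact: scalar_bilinl. Qed.

Lemma kahler_scalarr x X : scalar (kahler x X).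
Proof. exact: scalar_bilinr. Qed.

Lemma metric_unitmx x : O x -> G x \in unitmx.
Proof. by move=> Ox; exact: metric_unit (GJ Ox). Qed.

Lemma metric_sym x : O x -> (G x)^T = G x.
Proof. by move=> Ox; exact: metric_tr (GJ Ox). Qed.

Lemma smooth_kahler_form : smooth O (kahler_form G J).
Proof. exact: smooth_mulmx. Qed.

Lemma smooth_kahler X Y : smooth O (fun y => kahler y X Y).
Proof. exact/smooth_bilin/smooth_kahler_form. Qed.

Lemma smooth_dkahler X Y Z : smooth O (fun y => dkahler y X Y Z).
Proof.
rewrite /dkahler /cyclic_sum.
by do ![apply: smooth_add => //]; apply: smooth_D; exact: smooth_kahler.
Qed.

Lemma derive_kahler x w X Y : O x ->
  'D_w (fun y => kahler y X Y) x = bilin ('D_w (kahler_form G J) x) X Y.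
Proof.
move=> Ox; have dK : derivable (kahler_form G J) x w.
  exact: (Ck_der (smooth_kahler_form 1%N) Ox).
by have [_ ->] := is_derive_bilin X Y dK.
Qed.

Lemma dkahler_scalar2 x X Z : O x -> scalar (fun Y => dkahler x X Y Z).
Proof.
move=> Ox a Y Y'; rewrite /dkahler /cyclic_sum.
have dl w Z' : 'D_w (fun y => kahler y (a *: Y + Y') Z') x =
    a * 'D_w (fun y => kahler y Y Z') x + 'D_w (fun y => kahler y Y' Z') x.
  by rewrite !derive_kahler// bilinDl bilinZl.
have dr w Z' : 'D_w (fun y => kahler y Z' (a *: Y + Y')) x =
    a * 'D_w (fun y => kahler y Z' Y) x + 'D_w (fun y => kahler y Z' Y') x.
  by rewrite !derive_kahler// bilinDr bilinZr.
have := smooth_derive_scalar oO (smooth_kahler Z X) Ox a Y Y'.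
have lin3 (A A' B B' C C' : R) : a * A + A' + (a * B + B') + (a * C + C') =
    a * (A + B + C) + (A' + B' + C') by ring.
by rewrite /= => ->; rewrite dl dr lin3.
Qed.

Lemma smooth_lee_form X : smooth O (fun y => lee_form y X).
Proof.
apply: smooth_mul => //; first exact: smooth_cst.
apply: smooth_mtrace => // [y Oy|Y Y']; first exact: metric_unitmx.
apply: (smooth_insert oO (B := fun y U => dkahler y Y U X) (Vf := fun y => Y' *m J y)).
- by move=> U; exact: smooth_dkahler.
- by move=> y Oy; exact: dkahler_scalar2.
- by apply: smooth_mulmx => //; exact: smooth_cst_mx.
Qed.

Lemma smooth_skew_part X Y Z : smooth O (fun y => skew_part y X Y Z).
Proof.
apply: smooth_mul => //; first exact: smooth_cst.
apply: smooth_sub => //; first exact: smooth_dkahler.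
rewrite /wedge12.
by do ![apply: smooth_add => //]; apply: smooth_mul => //;
  [exact: smooth_lee_form|exact: smooth_kahler|exact: smooth_lee_form
  |exact: smooth_kahler|exact: smooth_lee_form|exact: smooth_kahler].
Qed.

Lemma levi_civita x : O x ->
  (forall X Y, christoffel G x X Y = christoffel G x Y X) /\
  (forall X Y Z, bilin ('D_X G x) Y Z
     = bilin (G x) (christoffel G x X Y) Z + bilin (G x) Y (christoffel G x X Z)).
Proof.
move=> Ox; apply/(@levi_civita_unique R 6 G x (christoffel G x)) => //.
- exact: metric_unitmx.
- exact: smooth_differentiable sG Ox.
- by apply: (near_open (P := fun y => (G y)^T = G y) oO Ox) => y; exact: metric_sym.
Qed.

Lemma cyclic_nabla x X Y Z : O x ->
  cyclic_sum (nabla_kahler G J x) X Y Z = dkahler x X Y Z.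
Proof.
move=> Ox; have [tf _] := levi_civita Ox.
rewrite /cyclic_sum /nabla_kahler -!/(kahler _ _ _) /dkahler /cyclic_sum !derive_kahler//.
rewrite (tf Y X) (tf Z X) (tf Z Y).
rewrite (kahler_skew (christoffel G x X Y) Z Ox) (kahler_skew (christoffel G x X Z) Y Ox).
by rewrite (kahler_skew (christoffel G x Y Z) X Ox); ring.
Qed.

Hypothesis type14 : forall x, O x ->
  W1_plus_W4 (G x) (J x) (nabla_kahler G J x).

(** The decomposition is explicit: the Lee form is the trace of the derivative
    of the Kaehler form. *)
Lemma nabla_decomposition x : O x ->
  [/\ scalar (lee_form x), W1 (G x) (J x) (skew_part x) &
   forall X Y Z, nabla_kahler G J x X Y Z = skew_part x X Y Z +
     covector_part (G x) (J x) (fun U => - 2^-1 * lee_form x (U *m J x)) X Y Z].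
Proof.
move=> Ox; have gJ := GJ Ox.
have [beta [gamma [bP gP nE]]] := type14 Ox.
have [mu lmu gE] := W4_form gJ gP.
pose theta U := 2 * mu (U *m J x).
have lth : scalar theta.
  move=> a U S; rewrite /theta mulmxDl -scalemxAl.
  by have -> := lmu a (U *m J x) (S *m J x); ring.
have dE X Y Z : dkahler x X Y Z = 3 * beta X Y Z + wedge12 theta (omega (G x) (J x)) X Y Z.
  rewrite -cyclic_nabla// -(cyclic_sum_W1_W4 gJ mu X Y Z bP).
  by rewrite /cyclic_sum !nE !gE.
have lE U : lee_form x U = theta U.
  by rewrite /lee_form (eq_lee _ _ _ dE) (leeE gJ U bP lth).
have sE X Y Z : skew_part x X Y Z = beta X Y Z.
  by rewrite /skew_part dE /wedge12 !lE !kahlerE; field.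
have sE' : skew_part x = beta by do 3 (apply/funext => ?); exact: sE.
have lE' : lee_form x = theta by apply/funext => ?; exact: lE.
rewrite sE' lE'; split=> // X Y Z; rewrite nE gE; congr (_ + _).
have th' U : - 2^-1 * theta (U *m J x) = mu U.
  by rewrite /theta (mulJJ gJ) (scalarN _ lmu); field.
by rewrite /covector_part !th'.
Qed.

Local Notation beta := skew_part.
Local Notation theta := lee_form.

Definition D_skew x X Y Z W : R := 'D_X (fun y => beta y Y Z W) x.

Definition hat_part x : V -> V -> V -> R := hat (J x) (beta x).

Definition D_hat x X Y Z W : R := 'D_X (fun y => hat_part y Y Z W) x.

Definition skew_norm x : R := mtrace3 (G x) (beta x) (beta x).

(** The 1-form of the structure equations, see structure_on_support. *)
Definition xi_form x X : R :=
  2 / skew_norm x * mtrace3 (G x) (alt4 (D_skew x) X) (beta x).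

Let bP x : O x -> W1 (G x) (J x) (beta x).
Proof. by move=> /nabla_decomposition[]. Qed.

Lemma derive_lincomb (f g h : V -> R) (a : R) x w : smooth O f -> smooth O g ->
  (forall y, O y -> h y = a * f y + g y) -> O x ->
  'D_w h x = a * 'D_w f x + 'D_w g x.
Proof.
move=> sf sg hE Ox.
have df := smooth_derivable (v := w) sf Ox; have dg := smooth_derivable (v := w) sg Ox.
have [d1 e1] := is_derive_mul (derivable_cst a x w) df.
have [d2 e2] := is_derive_add d1 dg.
rewrite (open_eq_derive w oO hE Ox) e2 e1 derive_cst mul0r add0r.
by [].
Qed.

Lemma derive_opp_eq (f h : V -> R) x w : smooth O f ->
  (forall y, O y -> h y = - f y) -> O x -> 'D_w h x = - 'D_w f x.
Proof.
move=> sf hE Ox.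
rewrite (@derive_lincomb f (fun=> 0) h (-1) x w sf (smooth_cst _ _))//.
  by rewrite derive_cst addr0 mulN1r.
by move=> y Oy; rewrite hE// mulN1r addr0.
Qed.

Lemma D_skew_scalar x Y Z W : O x -> scalar (fun X => D_skew x X Y Z W).
Proof. by move=> Ox; apply: (smooth_derive_scalar oO _ Ox); exact: smooth_skew_part. Qed.

Lemma D_skew_trilinear x X : O x -> trilinear (D_skew x X).
Proof.
move=> Ox; split=> [Y Z|Y Z|Y Z] a U U'; rewrite /D_skew;
  apply: derive_lincomb => //; try exact: smooth_skew_part;
  move=> y Oy; have [l1 l2 l3] := W1_trilinear (bP Oy).
- exact: l1.
- exact: l2.
- exact: l3.
Qed.

Lemma D_skew_swapl x X Y Z W : O x -> D_skew x X Z Y W = - D_skew x X Y Z W.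
Proof.
move=> Ox; apply: derive_opp_eq => //; first exact: smooth_skew_part.
by move=> y Oy; exact: (W1_swapl (bP Oy)).
Qed.

Lemma D_skew_swapr x X Y Z W : O x -> D_skew x X Y W Z = - D_skew x X Y Z W.
Proof.
move=> Ox; apply: derive_opp_eq => //; first exact: smooth_skew_part.
by move=> y Oy; exact: (W1_swapr (bP Oy)).
Qed.

Lemma is_derive_mulmx_cst (A : V -> 'M[R]_6) Y x w : derivable A x w ->
  is_derive x w (fun y => Y *m A y) (Y *m 'D_w A x).
Proof.
move=> dA; have dAi i j : derivable (fun y => A y i j) x w.
  by have /derivable_mxP := dA; apply.
have H k : is_derive x w (fun y => (Y *m A y) 0 k) ((Y *m 'D_w A x) 0 k).
  have Hi i : is_derive x w (fun y => Y 0 i * A y i k) (Y 0 i * 'D_w A x i k).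
    have [d e] := is_derive_mul (derivable_cst (Y 0 i) x w) (dAi i k).
    by split=> //; rewrite e derive_cst mul0r add0r derive_mx// mxE.
  have [d e] := is_derive_big (index_enum 'I_6) (P := xpredT)
    (f := fun i y => Y 0 i * A y i k) (fun i _ => let: DeriveDef d _ := Hi i in d).
  rewrite (_ : (fun y => (Y *m A y) 0 k) = fun y => \sum_i Y 0 i * A y i k); last first.
    by apply/funext => y; rewrite mxE.
  by split=> //; rewrite e mxE; apply: eq_bigr => i _; have [_ ->] := Hi i.
have D : derivable (fun y => Y *m A y) x w.
  by apply/derivable_mxP => i k; rewrite !ord1; have [] := H k.
by split=> //; apply/rowP => k; rewrite derive_mx// mxE; have [_ ->] := H k.
Qed.

Let dJ x w : O x -> derivable J x w.
Proof. by move=> Ox; exact: (Ck_der (sJ 1%N) Ox). Qed.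

Lemma derive_skew_insert x w Z W (Y : V) : O x ->
  is_derive x w (fun y => beta y (Y *m J y) Z W)
   (D_skew x w (Y *m J x) Z W + beta x (Y *m 'D_w J x) Z W).
Proof.
move=> Ox; have [d e] := is_derive_mulmx_cst Y (@dJ x w Ox).
rewrite -e; apply: (derive_insert oO (B := fun y U => beta y U Z W)) => //.
  by move=> U; exact: (smooth_derivable (smooth_skew_part _ _ _) Ox).
by move=> y Oy; have [l1 _ _] := W1_trilinear (bP Oy); exact: l1.
Qed.

Lemma smooth_hat_part X Y Z : smooth O (fun y => hat_part y X Y Z).
Proof.
apply: smooth_opp => //.
apply: (smooth_insert oO (B := fun y U => beta y U Y Z) (Vf := fun y => X *m J y)).
- by move=> U; exact: smooth_skew_part.
- by move=> y Oy; have [l1 _ _] := W1_trilinear (bP Oy); exact: l1.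
- by apply: smooth_mulmx => //; exact: smooth_cst_mx.
Qed.

Lemma D_hatE x X Y Z W : O x ->
  D_hat x X Y Z W = - D_skew x X (Y *m J x) Z W - beta x (Y *m 'D_X J x) Z W.
Proof.
move=> Ox; have [d e] := derive_skew_insert X Z W Y Ox.
have sI : smooth O (fun y => beta y (Y *m J y) Z W).
  apply: (smooth_insert oO (B := fun y U => beta y U Z W) (Vf := fun y => Y *m J y)).
  - by move=> U; exact: smooth_skew_part.
  - by move=> y Oy; have [l1 _ _] := W1_trilinear (bP Oy); exact: l1.
  - by apply: smooth_mulmx => //; exact: smooth_cst_mx.
rewrite /D_hat (@derive_opp_eq (fun y => beta y (Y *m J y) Z W) _ x X sI)// e.
by rewrite opprD.
Qed.

(** The derivative of the identity that expresses the type of the skew part. *)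
Lemma D_skew_type x X Y Z W : O x ->
  D_skew x X (Y *m J x) (Z *m J x) W + beta x (Y *m 'D_X J x) (Z *m J x) W
  + beta x (Y *m J x) (Z *m 'D_X J x) W = - D_skew x X Y Z W.
Proof.
move=> Ox.
have tJ y : O y -> beta y (Y *m J y) (Z *m J y) W = - beta y Y Z W.
  move=> Oy; have [_ l2 _] := W1_trilinear (bP Oy).
  rewrite (W1_shift12 (GJ Oy) (bP Oy)) (mulJJ (GJ Oy)).
  exact: (scalarN Z (l2 Y W)).
have dE : 'D_X (fun y => beta y (Y *m J y) (Z *m J y) W) x = - D_skew x X Y Z W.
  by apply: derive_opp_eq => //; exact: smooth_skew_part.
rewrite -dE.
have inner U : is_derive x X (fun y => beta y U (Z *m J y) W)
   (D_skew x X U (Z *m J x) W + beta x U (Z *m 'D_X J x) W).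
  have [d e] := is_derive_mulmx_cst Z (@dJ x X Ox).
  rewrite -e; apply: (derive_insert oO (B := fun y S => beta y U S W)) => //.
    by move=> S; exact: (smooth_derivable (smooth_skew_part _ _ _) Ox).
  by move=> y Oy; have [_ l2 _] := W1_trilinear (bP Oy); exact: l2.
have [d e] := is_derive_mulmx_cst Y (@dJ x X Ox).
have [_ ->] : is_derive x X (fun y => beta y (Y *m J y) (Z *m J y) W)
   ('D_X (fun y => beta y (Y *m J x) (Z *m J y) W) x
    + beta x ('D_X (fun y => Y *m J y) x) (Z *m J x) W).
  apply: (derive_insert oO (B := fun y S => beta y S (Z *m J y) W)) => //.
  by move=> y Oy; have [l1 _ _] := W1_trilinear (bP Oy); exact: l1.
have [_ ->] := inner (Y *m J x).
by rewrite e addrAC.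
Qed.

Definition nabla_J x X Y : V :=
  Y *m 'D_X J x + christoffel G x X (Y *m J x) - christoffel G x X Y *m J x.

Lemma bilin_D_kahler x X Y Z : O x -> bilin ('D_X (kahler_form G J) x) Y Z =
  bilin (G x) (Y *m 'D_X J x) Z + bilin ('D_X G x) (Y *m J x) Z.
Proof.
move=> Ox; rewrite -derive_kahler//.
have dG : derivable G x X by exact: (Ck_der (sG 1%N) Ox).
have [d e] := is_derive_mulmx_cst Y (@dJ x X Ox).
have [_ <-] := is_derive_bilin (Y *m J x) Z dG.
rewrite addrC -e.
have [_ <-] : is_derive x X (fun y => bilin (G y) (Y *m J y) Z)
   ('D_X (fun y => bilin (G y) (Y *m J x) Z) x
    + bilin (G x) ('D_X (fun y => Y *m J y) x) Z).
  apply: (derive_insert oO (B := fun y S => bilin (G y) S Z)) => //.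
    by move=> S; have [dS _] := is_derive_bilin S Z dG; exact: dS.
  by move=> y _; exact: scalar_bilinl.
congr ('D_X _ x); apply/funext => y.
by rewrite /kahler /kahler_form /bilin mulmxA.
Qed.

Lemma nabla_JE x X Y Z : O x ->
  bilin (G x) (nabla_J x X Y) Z = nabla_kahler G J x X Y Z.
Proof.
move=> Ox; have [_ mc] := levi_civita Ox.
rewrite /nabla_kahler bilin_D_kahler// mc /nabla_J !bilinDl bilinNl.
rewrite -!/(kahler _ _ _) !kahlerE /omega.
have aux (a b c d : R) : a + b - c = a + (b + d) - c - d by ring.
exact: aux.
Qed.

Lemma christoffel_scalar x Y : O x -> forall a X X',
  christoffel G x (a *: X + X') Y = a *: christoffel G x X Y + christoffel G x X' Y.
Proof.
move=> Ox a X X'; have uG := metric_unitmx Ox; have dG := smooth_differentiable oO sG Ox.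
have sB U S : smooth O (fun y => bilin (G y) U S) by exact: smooth_bilin.
have dB U S w : bilin ('D_w G x) U S = 'D_w (fun y => bilin (G y) U S) x.
  have dGw : derivable G x w by exact: (Ck_der (sG 1%N) Ox).
  by have [_ ->] := is_derive_bilin U S dGw.
have lin3 (A A' B B' C C' h : R) : h * (a * A + A' + (a * B + B') - (a * C + C')) =
   a * (h * (A + B - C)) + h * (A' + B' - C') by ring.
apply: (bilin_inj uG) => Z.
rewrite bilinDl bilinZl (christoffelK X Y Z uG dG) (christoffelK X' Y Z uG dG).
rewrite (christoffelK (a *: X + X') Y Z uG dG) -lin3.
congr (_ * (_ + _ - _)); last 2 first.
- by rewrite bilinDl bilinZl.
- by rewrite bilinDl bilinZl.
apply: etrans (dB Y Z (a *: X + X')) _.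
apply: etrans (smooth_derive_scalar oO (sB Y Z) Ox a X X') _.
by congr (_ * _ + _); exact: esym (dB _ _ _).
Qed.

Lemma first_structure_equations x : O x -> skew_norm x != 0 ->
  exists2 xi : V -> R, scalar xi & forall X Y Z W,
    alt4 (D_skew x) X Y Z W = wedge13 xi (beta x) X Y Z W /\
    alt4 (D_hat x) X Y Z W = wedge13 xi (hat_part x) X Y Z W
      - 12^-1 * skew_norm x * wedge22 (kahler x) (kahler x) X Y Z W.
Proof.
move=> Ox N0; have gJ := GJ Ox; have bx := bP Ox.
have [lth _ nE] := nabla_decomposition Ox; have [tf _] := levi_civita Ox.
pose mu U := - 2^-1 * theta x (U *m J x).
have lmu : scalar mu.
  move=> a U S; rewrite /mu mulmxDl -scalemxAl.
  have -> := lth a (U *m J x) (S *m J x).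
  by move: (theta x _) (theta x _) => t t'; ring.
have jP X Y Z : bilin (G x) (nabla_J x X Y) Z =
    beta x X Y Z + covector_part (G x) (J x) mu X Y Z.
  by rewrite nabla_JE// nE.
have [xi lxi xiP] := connection_structure gJ bx lmu tf
  (fun Y => @christoffel_scalar x Y Ox) (fun Y Z W => D_skew_scalar Y Z W Ox)
  (fun X => D_skew_trilinear X Ox) (fun X Y Z W => D_skew_swapl X Y Z W Ox)
  (fun X Y Z W => D_skew_swapr X Y Z W Ox) (fun X Y Z W => D_skew_type X Y Z W Ox) jP N0.
exists xi => // X Y Z W; have [-> E2] := xiP X Y Z W; split => //.
have kE : kahler x = omega (G x) (J x) by do 2 (apply/funext => ?); exact: kahlerE.
rewrite kE; apply: etrans E2; rewrite /alt4.
by rewrite (D_hatE X Y Z W Ox) (D_hatE Y X Z W Ox) (D_hatE Z X Y W Ox) (D_hatE W X Y Z Ox).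
Qed.

Lemma xi_formE x xi : O x -> skew_norm x != 0 -> scalar xi ->
  (forall X Y Z W, alt4 (D_skew x) X Y Z W = wedge13 xi (beta x) X Y Z W) ->
  xi = xi_form x.
Proof.
move=> Ox N0 lxi E; apply/funext => X; rewrite /xi_form.
have -> : alt4 (D_skew x) X = wedge13 xi (beta x) X by do 3 (apply/funext => ?).
rewrite (wedge13_contraction (GJ Ox) (bP Ox) X lxi) -/(skew_norm x).
by move: (skew_norm x) N0 (xi X) => n n0 t; field.
Qed.

Definition skew_support : set V := [set x | O x /\ skew_norm x != 0].

Lemma smooth_skew_norm : smooth O skew_norm.
Proof.
by apply: smooth_mtrace3 => // [x Ox|X Y Z|X Y Z];
  [exact: metric_unitmx|exact: smooth_skew_part|exact: smooth_skew_part].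
Qed.

Lemma open_skew_support : open skew_support.
Proof.
rewrite openE => x [Ox N0].
have cN := smooth_continuous smooth_skew_norm Ox.
have : \forall y \near x, skew_norm y != 0.
  exact: cvgr_neq0 cN N0.
apply: filterS2 (open_nbhs_nbhs (conj oO Ox)) => y Oy Ny.
by split.
Qed.

Lemma smooth_sub_support (f : V -> R) : smooth O f -> smooth skew_support f.
Proof. by move=> sf k; apply: Ck_sub (sf k) => x []. Qed.

Lemma smooth_xi_form X : smooth skew_support (fun x => xi_form x X).
Proof.
have oS := open_skew_support.
apply: smooth_mul => //.
  apply: smooth_mul => //; first exact: smooth_cst.
  by apply: smooth_inv => // [x []//|]; exact: smooth_sub_support smooth_skew_norm.
apply: smooth_sub_support.
apply: smooth_mtrace3 => // [x Ox|A B C|A B C]; [exact: metric_unitmx| |exact: smooth_skew_part].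
by rewrite /alt4; do ?[apply: smooth_add|apply: smooth_sub|apply: smooth_opp] => //;
  apply: smooth_D; exact: smooth_skew_part.
Qed.

Lemma structure_on_support x X Y Z W : skew_support x ->
  [/\ scalar (xi_form x),
    alt4 (D_skew x) X Y Z W = wedge13 (xi_form x) (beta x) X Y Z W &
    alt4 (D_hat x) X Y Z W = wedge13 (xi_form x) (hat_part x) X Y Z W
      - 12^-1 * skew_norm x * wedge22 (kahler x) (kahler x) X Y Z W].
Proof.
move=> [Ox N0]; have [xi lxi xiP] := first_structure_equations Ox N0.
have <- : xi = xi_form x.
  by apply: (xi_formE Ox N0 lxi) => A B C D; have [] := xiP A B C D.
by have [] := xiP X Y Z W.
Qed.

Definition d_xi x X Y : R :=
  'D_X (fun y => xi_form y Y) x - 'D_Y (fun y => xi_form y X) x.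

Let is_derive_smooth (A : set V) (f : V -> R) x w : smooth A f -> A x ->
  is_derive x w f ('D_w f x).
Proof. by move=> sf Ax; split=> //; exact: smooth_derivable sf Ax. Qed.

Lemma kahler_omega x : kahler x = omega (G x) (J x).
Proof. by do 2 (apply/funext => ?); exact: kahlerE. Qed.

Lemma dkahler_swapr x X Y Z : O x ->
  'D_X (fun y => kahler y Z Y) x = - 'D_X (fun y => kahler y Y Z) x.
Proof.
move=> Ox; apply: derive_opp_eq => //; first exact: smooth_kahler.
by move=> y; exact: kahler_skew.
Qed.

Lemma dkahlerE x : dkahler x = fun X Y Z => 3 * beta x X Y Z + wedge12 (theta x) (kahler x) X Y Z.
Proof.
do 3 (apply/funext => ?); rewrite /skew_part.
by move: (dkahler _ _ _ _) (wedge12 _ _ _ _ _) => s t; field.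
Qed.

(** The derivatives of the two structure equations. *)
Lemma d_xi_skew x A B C D E : skew_support x ->
  wedge23 (d_xi x) (beta x) A B C D E = 0.
Proof.
move=> Sx; have oS := open_skew_support; have [Ox _] := Sx.
pose z4 := fun _ _ _ _ : V => 0 : R; pose z5 := fun _ _ _ _ _ : V => 0 : R.
have E0 : wedge14 (xi_form x) z4 A B C D E = 0 
  by rewrite /wedge14 /alt5 /z4; move: (xi_form x) => t; ring.
have E1 : alt5 z5 A B C D E = 0 by rewrite /alt5 /z5; ring.
have := @alt5_identity R V (fun a b c d e => 'D_a (fun y => D_skew y b c d e) x) z5
  (fun a b => 'D_a (fun y => xi_form y b) x) (xi_form x) (D_skew x) z4 (beta x) A B C D E.
rewrite E0 E1 subr0 addr0; apply.
- by move=> a b c d e; exact: (@smooth_schwarz R O oO _ x a b (smooth_skew_part c d e) Ox).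
- move=> a b c d e; rewrite /z5 addr0.
  have H p q r s : is_derive x a (fun y => D_skew y p q r s) ('D_a (fun y => D_skew y p q r s) x).
    by apply: is_derive_smooth Ox; apply: smooth_D; exact: smooth_skew_part.
  have Hx p : is_derive x a (fun y => xi_form y p) ('D_a (fun y => xi_form y p) x).
    exact: is_derive_smooth (smooth_xi_form p) Sx.
  have Hb p q r : is_derive x a (fun y => beta y p q r) (D_skew x a p q r).
    exact: is_derive_smooth (smooth_skew_part p q r) Ox.
  have [_ e1] := @is_derive_alt4 R V V (fun y => D_skew y) _ x a b c d e H.
  have [_ e2] := @is_derive_wedge13 R V V xi_form beta _ _ x a b c d e Hx Hb.
  refine (etrans (esym e1) (etrans _ e2)).
  apply: (open_eq_derive _ oS _ Sx) => y Sy.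
  by have [] := structure_on_support b c d e Sy.
- move=> a b c d; rewrite /z4 addr0.
  by have [] := structure_on_support a b c d Sx.
Qed.

Lemma d_xi_hat x A B C D E : skew_support x ->
  wedge23 (d_xi x) (hat_part x) A B C D E
  + 12^-1 * wedge14 (fun X => skew_norm x * (xi_form x X - 2 * theta x X) - 'D_X skew_norm x)
      (wedge22 (kahler x) (kahler x)) A B C D E
  + - (2^-1 * skew_norm x) * wedge23 (kahler x) (beta x) A B C D E = 0.
Proof.
move=> Sx; have oS := open_skew_support; have [Ox _] := Sx.
pose w a b c := 'D_a (fun y => kahler y b c) x.
pose w22 y := wedge22 (kahler y) (kahler y).
pose dw22 a b c d e := w a b c * kahler x d e + kahler x b c * w a d e
  - (w a b d * kahler x c e + kahler x b d * w a c e)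
  + (w a b e * kahler x c d + kahler x b e * w a c d)
  + (w a c d * kahler x b e + kahler x c d * w a b e)
  - (w a c e * kahler x b d + kahler x c e * w a b d)
  + (w a d e * kahler x b c + kahler x d e * w a b c).
pose C4 y a b c d := - (12^-1 * skew_norm y * w22 y a b c d).
pose dC a b c d e := - (12^-1 * ('D_a skew_norm x * w22 x b c d e + skew_norm x * dw22 a b c d e)).
have ws a b c : w a c b = - w a b c by exact: dkahler_swapr.
have a5 : alt5 dw22 A B C D E = 2 * (3 * wedge23 (kahler x) (beta x) A B C D E
    + wedge14 (theta x) (w22 x) A B C D E).
  have -> := alt5_wedge22 (kahler x) A B C D E ws.
  rewrite -(@wedge23_wedge12 R V (kahler x) (theta x) (beta x) A B C D E); last first.
    by move=> X Y; exact: kahler_skew.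
  by rewrite -dkahlerE.
have := @alt5_identity R V (fun a b c d e => 'D_a (fun y => D_hat y b c d e) x) dC
  (fun a b => 'D_a (fun y => xi_form y b) x) (xi_form x) (D_hat x) (C4 x) (hat_part x) A B C D E.
have -> : wedge14 (xi_form x) (C4 x) A B C D E =
    - (12^-1 * skew_norm x * wedge14 (xi_form x) (w22 x) A B C D E).
  exact: wedge14_scale.
have -> : alt5 dC A B C D E = - (12^-1 * (wedge14 (fun a => 'D_a skew_norm x) (w22 x) A B C D E
    + skew_norm x * alt5 dw22 A B C D E)).
  exact: (@alt5_combination R V (fun a => 'D_a skew_norm x)).
rewrite a5.
have -> : wedge14 (fun X => skew_norm x * (xi_form x X - 2 * theta x X) - 'D_X skew_norm x)
    (w22 x) A B C D E = skew_norm x * (wedge14 (xi_form x) (w22 x) A B C D E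
      - 2 * wedge14 (theta x) (w22 x) A B C D E)
    - wedge14 (fun X => 'D_X skew_norm x) (w22 x) A B C D E.
  exact: wedge14_combination.
move=> K; apply: etrans (K _ _ _).
- move: (wedge23 (d_xi _) _ _ _ _ _ _) (wedge14 (xi_form x) _ _ _ _ _ _) (wedge14 (theta x) _ _ _ _ _ _).
  move: (wedge14 _ _ _ _ _ _ _) (wedge23 _ _ _ _ _ _ _) (skew_norm x) => a b c d e f.
  by field.
- by move=> a b c d e; exact: (@smooth_schwarz R O oO _ x a b (smooth_hat_part c d e) Ox).
- move=> a b c d e.
  have H p q r s : is_derive x a (fun y => D_hat y p q r s) ('D_a (fun y => D_hat y p q r s) x).
    by apply: is_derive_smooth Ox; apply: smooth_D; exact: smooth_hat_part.
  have Hx p : is_derive x a (fun y => xi_form y p) ('D_a (fun y => xi_form y p) x).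
    exact: is_derive_smooth (smooth_xi_form p) Sx.
  have Hb p q r : is_derive x a (fun y => hat_part y p q r) (D_hat x a p q r).
    exact: is_derive_smooth (smooth_hat_part p q r) Ox.
  have HN : is_derive x a skew_norm ('D_a skew_norm x).
    exact: is_derive_smooth smooth_skew_norm Ox.
  have Hk p q : is_derive x a (fun y => kahler y p q) (w a p q).
    exact: is_derive_smooth (smooth_kahler p q) Ox.
  have H22 : is_derive x a (fun y => w22 y b c d e) (dw22 a b c d e).
    exact: (@is_derive_wedge22 R V V kahler _ x a b c d e Hk).
  have HC : is_derive x a (fun y => C4 y b c d e) (dC a b c d e).
    rewrite /C4 /dC.
    have c0 : is_derive x a (fun _ : V => - 12^-1 : R) 0 by exact: is_derive_cst.
    have := is_derive_prod2 c0 (is_derive_prod2 HN H22).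
    rewrite mul0r add0r mulNr.
    rewrite (_ : (fun y => _) = fun y => - (12^-1 * skew_norm y * w22 y b c d e))//.
    by apply/funext => y; move: (skew_norm y) (w22 y b c d e) => n q; ring.
  have [_ e1] := @is_derive_alt4 R V V (fun y => D_hat y) _ x a b c d e H.
  have [_ e2] := is_derive_sum2 (@is_derive_wedge13 R V V xi_form hat_part _ _ x a b c d e Hx Hb) HC.
  refine (etrans (esym e1) (etrans _ e2)).
  apply: (open_eq_derive _ oS _ Sx) => y Sy.
  by have [] := structure_on_support b c d e Sy.
- move=> a b c d.
  by have [] := structure_on_support a b c d Sx.
Qed.

Lemma D_skew_norm x X : skew_support x ->
  'D_X skew_norm x = skew_norm x * (xi_form x X - 2 * theta x X).
Proof.
move=> Sx; have [Ox _] := Sx; have [lth _ _] := nabla_decomposition Ox.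
have [lxi _ _] := structure_on_support 0 0 0 0 Sx.
apply: (@norm_derivative R _ _ (GJ Ox) _ (bP Ox) (d_xi x) _ _ (fun X => 'D_X skew_norm x)
  (- (2^-1 * skew_norm x)) lxi lth).
- exact: (smooth_derive_scalar oO smooth_skew_norm Ox).
- by move=> A B C D E; exact: d_xi_skew.
- by move=> A B C D E; have := d_xi_hat A B C D E Sx; rewrite kahler_omega.
Qed.

Definition d_lee x X Y : R :=
  'D_X (fun y => theta y Y) x - 'D_Y (fun y => theta y X) x.

(** Since xi is twice the Lee form plus the logarithmic derivative of the norm
    of the skew part. *)
Lemma d_xi_lee x X Y : skew_support x -> d_xi x X Y = 2 * d_lee x X Y.
Proof.
move=> Sx; have [Ox N0] := Sx; have oS := open_skew_support.
have D2 A B : 'D_A ('D_B skew_norm) x =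
   skew_norm x * (xi_form x A - 2 * theta x A) * (xi_form x B - 2 * theta x B)
   + skew_norm x * ('D_A (fun y => xi_form y B) x - 2 * 'D_A (fun y => theta y B) x).
  have HN : is_derive x A skew_norm (skew_norm x * (xi_form x A - 2 * theta x A)).
    by rewrite -(D_skew_norm A Sx); exact: is_derive_smooth smooth_skew_norm Ox.
  have Hx : is_derive x A (fun y => xi_form y B) ('D_A (fun y => xi_form y B) x).
    exact: is_derive_smooth (smooth_xi_form B) Sx.
  have Ht : is_derive x A (fun y => theta y B) ('D_A (fun y => theta y B) x).
    exact: is_derive_smooth (smooth_lee_form B) Ox.
  have c0 : is_derive x A (fun _ : V => 2 : R) 0 by exact: is_derive_cst.
  have [_ e] := is_derive_prod2 HN (is_derive_diff2 Hx (is_derive_prod2 c0 Ht)).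
  rewrite mul0r add0r in e; rewrite -e.
  by apply: (open_eq_derive _ oS _ Sx) => y Sy; exact: D_skew_norm.
have := etrans (esym (D2 X Y)) (etrans
  (@smooth_schwarz R O oO _ x X Y smooth_skew_norm Ox) (D2 Y X)).
have aux (n s t a b c d : R) : n != 0 ->
    n * s * t + n * (a - 2 * b) = n * t * s + n * (c - 2 * d) -> a - c = 2 * (b - d).
  by move=> n0 E; apply: (mulfI n0); lra.
exact: aux N0.
Qed.

(** This is d d omega = 0. *)
Lemma wedge_d_lee x X Y Z W : O x ->
  wedge22 (d_lee x) (kahler x) X Y Z W
  = 3 * (wedge13 (theta x) (beta x) X Y Z W - alt4 (D_skew x) X Y Z W).
Proof.
move=> Ox.
pose w a b c := 'D_a (fun y => kahler y b c) x.
apply: (@alt4_identity R V (fun a b c d => 'D_a (fun y => 'D_b (fun z => kahler z c d) y) x)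
  (fun a b => 'D_a (fun y => theta y b) x) (theta x) w).
- by move=> a b c d; exact: (@smooth_schwarz R O oO _ x a b (smooth_kahler c d) Ox).
- move=> a b c d.
  apply: (@derive_opp_eq (fun y => 'D_b (fun z => kahler z c d) y)) => //.
    by apply: smooth_D; exact: smooth_kahler.
  by move=> y; exact: dkahler_swapr.
- by move=> a b; exact: kahler_skew.
- by move=> a b c; exact: dkahler_swapr.
- move=> a b c d.
  have Hk p q r : is_derive x a (fun y => 'D_p (fun z => kahler z q r) y)
      ('D_a (fun y => 'D_p (fun z => kahler z q r) y) x).
    by apply: is_derive_smooth Ox; apply: smooth_D; exact: smooth_kahler.
  have Hw p q : is_derive x a (fun y => kahler y p q) (w a p q).
    exact: is_derive_smooth (smooth_kahler p q) Ox.
  have Ht p : is_derive x a (fun y => theta y p) ('D_a (fun y => theta y p) x).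
    exact: is_derive_smooth (smooth_lee_form p) Ox.
  have Hb p q r : is_derive x a (fun y => beta y p q r) (D_skew x a p q r).
    exact: is_derive_smooth (smooth_skew_part p q r) Ox.
  have c0 : is_derive x a (fun _ : V => 3 : R) 0 by exact: is_derive_cst.
  have [_ e1] := is_derive_sum2 (is_derive_sum2 (Hk b c d) (Hk c d b)) (Hk d b c).
  have P p q r := is_derive_prod2 (Ht p) (Hw q r).
  have [_ e2] := is_derive_sum2 (is_derive_prod2 c0 (Hb b c d))
     (is_derive_sum2 (is_derive_sum2 (P b c d) (P c d b)) (P d b c)).
  rewrite mul0r add0r !addrA in e2; rewrite !addrA -e1 -e2.
  apply: (open_eq_derive _ oO _ Ox) => y Oy.
  by have := congr1 (fun f => f b c d) (dkahlerE y).
- by move=> a b c; have := congr1 (fun f => f a b c) (dkahlerE x).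
Qed.

Lemma smooth_d_lee X Y : smooth O (fun y => d_lee y X Y).
Proof. by apply: smooth_sub => //; apply: smooth_D; exact: smooth_lee_form. Qed.

(** Where the skew part vanishes identically, wedging with the Kaehler form is
    injective on 2-forms; where it does not vanish, the structure equations apply;
    both sets together are dense. *)
Lemma lee_closed x X Y : O x ->
  'D_X (fun y => theta y Y) x = 'D_Y (fun y => theta y X) x.
Proof.
move=> Ox; apply/eqP; rewrite -subr_eq0 -/(d_lee x X Y); apply: contraT => n0.
have ls y : O y -> forall Z, scalar ((d_lee y)^~ Z).
  move=> Oy Z a A B; rewrite /d_lee.
  have lin (k p p' q q' : R) : (k * p + p') - (k * q + q') = k * (p - q) + (p' - q') by ring.
  rewrite -lin; congr (_ - _).
    exact: (smooth_derive_scalar oO (smooth_lee_form Z) Oy a A B).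
  apply: derive_lincomb => //; try exact: smooth_lee_form.
  by move=> z Oz; have [lth _ _] := nabla_decomposition Oz; exact: lth.
have sk y A B : d_lee y B A = - d_lee y A B by rewrite /d_lee opprB.
have off y : skew_support y -> d_lee y X Y = 0.
  move=> Sy; have [Oy N0] := Sy.
  apply: (@lee_derivative_eq0 R _ _ (GJ Oy) _ (bP Oy) (d_lee y)
    (fun U => theta y U - xi_form y U) (ls y Oy) (sk y) N0).
  - move=> A B C D E.
    have := d_xi_skew A B C D E Sy; rewrite /wedge23 !(d_xi_lee _ _ Sy).
    by move: (d_lee y) (beta y) => s b; lra.
  - move=> A B C D; rewrite -kahler_omega wedge_d_lee//.
    have [_ -> _] := structure_on_support A B C D Sy.
    by rewrite /wedge13 /alt4; move: (theta y) (xi_form y) (beta y) => t z b; ring.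
have near0 : \forall y \near x, skew_norm y = 0.
  have cs := smooth_continuous (smooth_d_lee X Y) Ox.
  have : \forall y \near x, d_lee y X Y != 0 by exact: cvgr_neq0 cs n0.
  apply: filterS2 (open_nbhs_nbhs (conj oO Ox)) => y Oy; apply: contraNeq => N0.
  by apply/eqP; apply: off; split.
have b0 y A B C : O y -> skew_norm y = 0 -> beta y A B C = 0.
  by move=> Oy N0; exact: (W1_norm_eq0 (GJ Oy) (bP Oy) N0).
have Db0 A B C D : D_skew x A B C D = 0.
  have c0 : 'D_A (fun _ : V => 0 : R) x = 0 by exact: derive_cst.
  rewrite /D_skew -[RHS]c0; apply: near_eq_derive.
  by apply: filterS2 near0 (open_nbhs_nbhs (conj oO Ox)) => y N0 Oy; exact: b0.
have xN0 : skew_norm x = 0 by exact: nbhs_singleton near0.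
have K := @wedge_omega_inj R _ _ (GJ Ox) (d_lee x) (ls x Ox) (sk x).
case/negP: n0; apply/eqP/K => A B C D; rewrite -kahler_omega wedge_d_lee//.
rewrite /wedge13 /alt4 !Db0 !b0//.
by move: (theta x) => t; ring.
Qed.

(** When the logarithmic derivative of f is - theta, scaling the metric by f
    removes the W4 part of the derivative of the Kaehler form. *)
Section ConformalChange.
Variable f : V -> R.
Hypothesis sf : smooth O f.
Hypothesis f0 : forall x, O x -> 0 < f x.
Hypothesis df : forall x v, O x -> 'D_v f x = - f x * theta x v.

Let fG y := f y *: G y.

Lemma smooth_scale_mx (A : V -> 'M[R]_6) : smooth O A -> smooth O (fun y => f y *: A y).
Proof.
move=> /smooth_mx sA; apply/smooth_mx => // i j.
apply: (@smooth_ext _ _ oO (fun y => f y * A y i j)) => [y _|]; first by rewrite mxE.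
by apply: smooth_mul => //; exact: sA.
Qed.

Lemma derive_scale_mx (A : V -> 'M[R]_6) x w X Y : smooth O A -> O x ->
  bilin ('D_w (fun y => f y *: A y) x) X Y =
  f x * (bilin ('D_w A x) X Y - theta x w * bilin (A x) X Y).
Proof.
move=> sA Ox; have dA : derivable A x w by exact: (Ck_der (sA 1%N) Ox).
have dfA : derivable (fun y => f y *: A y) x w.
  by exact: (Ck_der (smooth_scale_mx sA 1%N) Ox).
have [_ <-] := is_derive_bilin X Y dfA.
have hf : is_derive x w f (- f x * theta x w).
  by rewrite -df//; exact: is_derive_smooth sf Ox.
have [_ e] := is_derive_prod2 hf (is_derive_bilin X Y dA).
transitivity ('D_w (fun y => f y * bilin (A y) X Y) x).
  by congr ('D_w _ x); apply/funext => y; rewrite /bilin -scalemxAr -scalemxAl mxE.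
rewrite e; move: (f x) (theta x w) (bilin _ _ _) (bilin _ _ _) => a b c d; ring.
Qed.

Lemma hermitian_scale x : O x -> hermitian_pair (fG x) (J x).
Proof.
move=> Ox; have [gC gp JJ gJ] := GJ Ox.
have E X Y : bilin (fG x) X Y = f x * bilin (G x) X Y.
  by rewrite /fG /bilin -scalemxAr -scalemxAl mxE.
split=> [X Y|X X0||X Y]; rewrite ?E ?gJ //; first by rewrite gC.
by rewrite mulr_gt0// ?f0// gp.
Qed.

Lemma nabla_scale x X Y Z : O x ->
  nabla_kahler fG J x X Y Z = f x * beta x X Y Z.
Proof.
move=> Ox; have [lth _ nE] := nabla_decomposition Ox; have gJ := GJ Ox.
have sfG : smooth O fG by exact: smooth_scale_mx.
have [_ _ _ gJi] := gJ; have gC U S : bilin (G x) U S = bilin (G x) S U by case: gJ.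
have fx0 : f x != 0 by rewrite gt_eqF// f0.
have E U S : bilin (fG x) U S = f x * bilin (G x) U S.
  by rewrite /fG /bilin -scalemxAr -scalemxAl mxE.
have kE U S : bilin (kahler_form fG J x) U S = - (f x * bilin (G x) U (S *m J x)).
  have -> : bilin (kahler_form fG J x) U S = bilin (fG x) (U *m J x) S.
    by rewrite /bilin /kahler_form mulmxA.
  rewrite E -gJi (mulJJ gJ) bilinNl; ring.
have kE' U S : bilin (kahler_form G J x) U S = - bilin (G x) U (S *m J x).
  have -> : bilin (kahler_form G J x) U S = bilin (G x) (U *m J x) S.
    by rewrite /bilin /kahler_form mulmxA.
  by rewrite -gJi (mulJJ gJ) bilinNl.
have DK U S : bilin ('D_X (kahler_form fG J) x) U S = f x *
    (bilin ('D_X (kahler_form G J) x) U S - theta x X * bilin (kahler_form G J x) U S).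
  have kfE : kahler_form fG J = fun y => f y *: kahler_form G J y.
    by apply/funext => y; rewrite /kahler_form /fG -scalemxAr.
  by rewrite kfE; exact: derive_scale_mx smooth_kahler_form Ox.
have ufG : fG x \in unitmx by exact: metric_unit (hermitian_scale Ox).
have uG := metric_unitmx Ox; have dG := smooth_differentiable oO sG Ox.
have dfG := smooth_differentiable oO sfG Ox.
have DG w U S : bilin ('D_w fG x) U S =
    f x * (bilin ('D_w G x) U S - theta x w * bilin (G x) U S).
  exact: derive_scale_mx.
have Ga U S Q : bilin (G x) (christoffel fG x U S) Q = bilin (G x) (christoffel G x U S) Q
    - 2^-1 * (theta x U * bilin (G x) S Q + theta x S * bilin (G x) U Q
      - theta x Q * bilin (G x) U S).
  apply: (mulfI fx0); apply: etrans (esym (E _ _)) _.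
  apply: etrans (christoffelK U S Q ufG dfG) _.
  have aux (n a b c p q r s t u : R) : 2^-1 * (n * (a - p * q) + n * (b - r * s) - n * (c - t * u))
     = n * (2^-1 * (a + b - c) - 2^-1 * (p * q + r * s - t * u)) by ring.
  rewrite (christoffelK U S Q uG dG) -aux.
  congr (_ * (_ + _ - _)); exact: DG.
have K1 : beta x X Y Z = nabla_kahler G J x X Y Z -
   covector_part (G x) (J x) (fun U => - 2^-1 * theta x (U *m J x)) X Y Z.
  by rewrite nE addrK.
rewrite K1 /nabla_kahler DK !kE !kE'.
exact: (@conformal_algebra R _ _ gJ _ _ _ _ _ lth X Y Z Ga).
Qed.

Lemma conformal_W1 x : O x -> W1 (fG x) (J x) (nabla_kahler fG J x).
Proof.
move=> Ox; have [_ [[[l1 l2 l3] sr tJ] sl] _] := nabla_decomposition Ox.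
have lin (c k a b : R) : c * (k * a + b) = k * (c * a) + c * b by ring.
have nE := nabla_scale _ _ _ Ox.
split; last by move=> X Y Z; rewrite !nE sl mulrN.
split=> [|X Y Z|X Y Z]; last 2 first.
- by rewrite !nE sr mulrN.
- by rewrite !nE tJ mulrN.
split=> [Y Z|X Z|X Y] k U U'; rewrite /= !nE -lin; congr (_ * _).
- exact: l1.
- exact: l2.
- exact: l3.
Qed.

End ConformalChange.

End ChartGeometry.

(** * Invariance of the Lee form under changes of charts *)

Section ChangeOfChart.
Context {R : realType}.
Local Notation V := 'rV[R]_6.
Variables (O1 O2 : set V) (G1 J1 G2 J2 : V -> 'M[R]_6) (tau : V -> V).
Hypotheses (oO1 : open O1) (oO2 : open O2).
Hypotheses (sG1 : smooth O1 G1) (sJ1 : smooth O1 J1).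
Hypotheses (sG2 : smooth O2 G2) (sJ2 : smooth O2 J2).
Hypothesis GJ1 : forall x, O1 x -> hermitian_pair (G1 x) (J1 x).
Hypothesis GJ2 : forall x, O2 x -> hermitian_pair (G2 x) (J2 x).
Hypothesis stau : smooth O1 tau.
Hypothesis tauO : forall x, O1 x -> O2 (tau x).
Hypothesis GE : forall x, O1 x -> G1 x = 'J tau x *m G2 (tau x) *m ('J tau x)^T.
Hypothesis JE : forall x, O1 x -> J1 x *m 'J tau x = 'J tau x *m J2 (tau x).
Implicit Types (x y X Y Z W v w : V).

Let dtau x : O1 x -> differentiable tau x.
Proof. by move=> Ox; refine (@smooth_differentiable R O1 oO1 1 6 tau x stau Ox).
Qed.

Let tauE x X : O1 x -> X *m 'J tau x = 'D_X tau x.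
Proof. by move=> /dtau d; rewrite deriveEjacobian. Qed.

Lemma differentiable_pullback (f : V -> R) x : smooth O2 f -> O1 x ->
  differentiable (fun y => f (tau y)) x.
Proof.
move=> sf Ox; have df := C1_differentiable oO2 (sf 1%N) (tauO Ox).
by apply: (@differentiable_comp _ _ _ _ tau f) => //; exact: dtau.
Qed.

Lemma is_derive_pullback (f : V -> R) x w : smooth O2 f -> O1 x ->
  is_derive x w (fun y => f (tau y)) ('D_('D_w tau x) f (tau x)).
Proof.
move=> sf Ox; have dt := dtau Ox; have dc := differentiable_pullback sf Ox.
have df := C1_differentiable oO2 (sf 1%N) (tauO Ox).
split; first exact: diff_derivable.
transitivity ('D_w (f \o tau) x) => //.
by rewrite deriveE// diff_comp//= [in RHS]deriveE// [in RHS]deriveE.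
Qed.

Lemma bilin_pullback x X Y : O1 x ->
  bilin (G1 x) X Y = bilin (G2 (tau x)) ('D_X tau x) ('D_Y tau x).
Proof. by move=> Ox; rewrite -!tauE// bilin_mul -GE. Qed.

Lemma derive_J_pullback x X : O1 x -> 'D_(X *m J1 x) tau x = 'D_X tau x *m J2 (tau x).
Proof. by move=> Ox; rewrite -!tauE// -!mulmxA JE. Qed.

Lemma kahler_pullback x X Y : O1 x ->
  kahler G1 J1 x X Y = kahler G2 J2 (tau x) ('D_X tau x) ('D_Y tau x).
Proof. by move=> Ox; rewrite !kahlerE /omega bilin_pullback// derive_J_pullback. Qed.

Let derive_coord (F : V -> V) x v i : derivable F x v ->
  'D_v F x 0 i = 'D_v (fun y => F y 0 i) x.
Proof. by move=> dF; rewrite derive_mx// mxE. Qed.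

Let hess x X Y : V := 'D_X ('D_Y tau) x.

Let derivable_dtau x X Y : O1 x -> derivable ('D_Y tau) x X.
Proof. by move=> Ox; have [_ /(_ Y)[_ [_ /(_ X)[d _]]]] := stau 2%N; exact: d. Qed.

Let hessC x X Y : O1 x -> hess x X Y = hess x Y X.
Proof.
move=> Ox; apply/rowP => i.
have si : smooth O1 (fun y => tau y 0 i) by have /smooth_mx := stau; apply.
have E Z y : O1 y -> 'D_Z tau y 0 i = 'D_Z (fun y => tau y 0 i) y.
  by move=> Oy; apply: derive_coord; exact: diff_derivable (dtau Oy).
have H A B : hess x A B 0 i = 'D_A ('D_B (fun y => tau y 0 i)) x.
  rewrite /hess; apply: etrans (derive_coord i (@derivable_dtau x A B Ox)) _.
  exact: (open_eq_derive A oO1 (E B) Ox).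
exact: (etrans (H X Y) (etrans (@smooth_schwarz R O1 oO1 _ x X Y si Ox) (esym (H Y X)))).
Qed.

Lemma derive_kahler_pullback x X Y Z : O1 x ->
  'D_X (fun y => kahler G1 J1 y Y Z) x =
    'D_('D_X tau x) (fun y => kahler G2 J2 y ('D_Y tau x) ('D_Z tau x)) (tau x)
    + kahler G2 J2 (tau x) ('D_Y tau x) (hess x X Z)
    + kahler G2 J2 (tau x) (hess x X Y) ('D_Z tau x).
Proof.
move=> Ox; have sk U S : smooth O2 (fun y => kahler G2 J2 y U S) by exact: smooth_kahler.
pose K y := kahler G2 J2 (tau y).
have dY := @derivable_dtau x X Y Ox; have dZ := @derivable_dtau x X Z Ox.
have inner U : is_derive x X (fun y => K y U ('D_Z tau y))
    ('D_('D_X tau x) (fun y => kahler G2 J2 y U ('D_Z tau x)) (tau x) + K x U (hess x X Z)).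
  have [_ <-] := is_derive_pullback X (sk U ('D_Z tau x)) Ox.
  apply: (derive_insert oO1 (B := fun y S => K y U S)) => // [S|y _].
    by have [d _] := is_derive_pullback X (sk U S) Ox; exact: d.
  exact: kahler_scalarr.
transitivity ('D_X (fun y => K y ('D_Y tau y) ('D_Z tau y)) x).
  by apply: (open_eq_derive _ oO1 _ Ox) => y; exact: kahler_pullback.
have [_ e1] := inner ('D_Y tau x).
have [_ e2] : is_derive x X (fun y => K y ('D_Y tau y) ('D_Z tau y))
    ('D_X (fun y => K y ('D_Y tau x) ('D_Z tau y)) x + K x ('D_X ('D_Y tau) x) ('D_Z tau x)).
  refine (@derive_insert R O1 oO1 (fun y S => K y S ('D_Z tau y)) ('D_Y tau) x X _ _ dY Ox).
    by move=> S; have [d _] := inner S; exact: d.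
  by move=> y _; exact: kahler_scalarl.
exact: (etrans e2 (congr1 (fun r => r + K x ('D_X ('D_Y tau) x) ('D_Z tau x)) e1)).
Qed.

(** The second derivatives of tau cancel because they are symmetric and the Kaehler
    form is antisymmetric. *)
Lemma dkahler_pullback x X Y Z : O1 x ->
  dkahler G1 J1 x X Y Z = dkahler G2 J2 (tau x) ('D_X tau x) ('D_Y tau x) ('D_Z tau x).
Proof.
move=> Ox; have sk U S := kahler_skew GJ2 U S (tauO Ox).
have aux (a b c a' b' c' p q r p' q' r' : R) :
    a' = a + p + q -> b' = b + q' + r -> c' = c + r' + p' -> p' = - p -> q' = - q -> r' = - r ->
    a' + b' + c' = a + b + c.
  by move=> -> -> -> -> -> ->; ring.
apply: (aux _ _ _ _ _ _ _ _ _ _ _ _ (derive_kahler_pullback X Y Z Ox)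
  (derive_kahler_pullback Y Z X Ox) (derive_kahler_pullback Z X Y Ox)).
- by rewrite (hessC Z X Ox); exact: sk.
- by rewrite (hessC Y X Ox); exact: sk.
- by rewrite (hessC Z Y Ox); exact: sk.
Qed.

(** The differential of tau maps unitary frames to unitary frames. *)
Lemma lee_form_pullback x X : O1 x ->
  lee_form G1 J1 x X = lee_form G2 J2 (tau x) ('D_X tau x).
Proof.
move=> Ox; have Otx := tauO Ox; have [e eP] := exists_frame (GJ1 Ox).
have e'P : unitary_frame (G2 (tau x)) (J2 (tau x)) (fun i => 'D_(e i) tau x).
  case: eP => e3 e4 e5 eo; split; rewrite ?e3 ?e4 ?e5 ?derive_J_pullback//.
  by move=> i k i6 k6; rewrite -bilin_pullback// eo.
have dk_cyc (G J : V -> 'M[R]_6) y U S Q : dkahler G J y U S Q = dkahler G J y Q U S.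
  by rewrite /dkahler /cyclic_sum addrC addrA.
have tr_r (O : set V) (G J : V -> 'M[R]_6) y U S : open O -> smooth O G -> smooth O J -> O y ->
    scalar (fun Y => dkahler G J y S (Y *m J y) U).
  move=> oO sG sJ Oy a A B.
  by rewrite mulmxDl -scalemxAl; exact: (dkahler_scalar2 oO sG sJ).
have tr_l (O : set V) (G J : V -> 'M[R]_6) y U S : open O -> smooth O G -> smooth O J -> O y ->
    scalar (fun Y => dkahler G J y Y (S *m J y) U).
  move=> oO sG sJ Oy a A B.
  by rewrite !(dk_cyc _ _ y _ (S *m J y)); exact: (dkahler_scalar2 oO sG sJ).
have a1 S := tr_l _ _ _ x X S oO1 sG1 sJ1 Ox; have a2 S := tr_r _ _ _ x X S oO1 sG1 sJ1 Ox.
have b1 S := tr_l _ _ _ (tau x) ('D_X tau x) S oO2 sG2 sJ2 Otx.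
have b2 S := tr_r _ _ _ (tau x) ('D_X tau x) S oO2 sG2 sJ2 Otx.
rewrite /lee_form /lee (mtraceE (GJ1 Ox) eP a1 a2) (mtraceE (GJ2 Otx) e'P b1 b2).
congr (_ * _); apply: eq_bigr => i _.
apply: etrans (dkahler_pullback _ _ _ Ox) _.
exact: (congr1 (fun W => dkahler G2 J2 (tau x) _ W _) (derive_J_pullback (e i) Ox)).
Qed.

End ChangeOfChart.

(** * The conformal factor on the manifold *)

Section ChartDomains.
Context {R : realType} {m : nat} (M : manifold R m).

Lemma open_preimage (S T : topologicalType) (D : set S) (f : S -> T) (B : set T) :
  open D -> (forall p, D p -> {for p, continuous f}) -> open B ->
  open (D `&` f @^-1` B).
Proof.
move=> oD cf oB; rewrite openE => p [Dp Bp]; apply: filterI.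
  exact: open_nbhs_nbhs (conj oD Dp).
exact: (cf p Dp B (open_nbhs_nbhs (conj oB Bp))).
Qed.

Lemma open_chart_image (c : chart R m M) (U : set M) : open U ->
  open (chart_map c @` (chart_dom c `&` U)).
Proof.
move=> oU.
have -> : chart_map c @` (chart_dom c `&` U) =
    (chart_map c @` chart_dom c) `&` chart_inv c @^-1` U.
  apply/seteqP; split=> x.
    by case=> p [cp Up] <-; split; [exists p|rewrite /= chart_mapK].
  by case=> -[p cp <-] /=; rewrite chart_mapK// => Up; exists p.
apply: open_preimage oU; first exact: chart_image_open.
exact: chart_inv_continuous.
Qed.

End ChartDomains.

Section ExponentialFactor.
Context {R : realType} {V : normedModType R}.

Lemma is_derive_expR_comp (h : V -> R) x v : differentiable h x ->
  is_derive x v (fun y => expR (h y)) ('D_v h x * expR (h x)).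
Proof.
move=> dh.
have de : differentiable (expR : R -> R) (h x) by apply/derivable1_diffP.
have dc : differentiable (expR \o h) x by exact: differentiable_comp.
split; first exact: diff_derivable.
transitivity ('D_v (expR \o h) x) => //.
rewrite deriveE// diff_comp//= deriveE//.
have -> : 'd h x v = 'd h x v *: (1 : R) by rewrite [_ *: _]mulr1.
rewrite linearZ/= -(deriveE _ de).
have [_ ->] := is_derive_expR (h x).
by rewrite [_ *: (1 : R)]mulr1.
Qed.

End ExponentialFactor.

Section LocallyConformal.
Context {R : realType} (M : manifold R 6) (g J : components M).
Local Notation V := 'rV[R]_6.
Hypothesis ahM : almost_hermitian setT g J.
Hypothesis type14 : of_type W1_plus_W4 setT g J.
Implicit Types (c d : chart R 6 M) (p q : M) (x y X v : V).

Let image c (U : set M) : set V := chart_map c @` (chart_dom c `&` U).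

Section Chart.
Variables (d : chart R 6 M) (A : set V).
Hypothesis dM : atlas M d.
Hypothesis AT : A `<=` image d setT.

Lemma chart_metric_smooth : smooth A (g d).
Proof. by move=> k; apply: Ck_sub (metric_smooth ahM dM k). Qed.

Lemma chart_acs_smooth : smooth A (J d).
Proof. by move=> k; apply: Ck_sub (acs_smooth ahM dM k). Qed.

Lemma chart_hermitian x : A x -> hermitian_pair (g d x) (J d x).
Proof. by move=> /AT[p [dp _] <-]; exact: (fiber_hermitian ahM dM dp I). Qed.

Lemma chart_type x : A x -> W1_plus_W4 (g d x) (J d x) (nabla_kahler (g d) (J d) x).
Proof. by move=> /AT[p [dp _] <-]; exact: (type14 dM dp I). Qed.

End Chart.

(** On a ball in a chart the Lee form has a primitive P; the conformal factor is
    exp(- P).  In another chart it satisfies the linear equation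
    Df = - f theta, by invariance of the Lee form, and is therefore smooth. *)
Section Ball.
Variables (c : chart R 6 M) (B : set V) (P : V -> R).
Hypothesis cM : atlas M c.
Hypothesis oB : open B.
Hypothesis BT : B `<=` image c setT.
Hypothesis sP : smooth B P.
Hypothesis dP : forall z v, B z -> is_derive z v P (lee_form (g c) (J c) z v).

Let U : set M := chart_dom c `&` chart_map c @^-1` B.
Let f q : R := expR (- P (chart_map c q)).

Lemma conformal_domain_open : open U.
Proof.
apply: open_preimage oB; first exact: chart_dom_open.
exact: chart_map_continuous.
Qed.

Section OtherChart.
Variable d : chart R 6 M.
Hypothesis dM : atlas M d.

Let A := image d U.
Let tau := transition d c.

Let oA : open A. Proof. exact: open_chart_image conformal_domain_open. Qed.
Let AT : A `<=` image d setT. Proof. by move=> _ [p [dp _] <-]; exists p. Qed.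

Let stau : smooth A tau.
Proof.
move=> k; apply: Ck_sub (atlas_smooth dM cM k) => _ [p [dp [cp _]] <-].
by exists p.
Qed.

Let tauB x : A x -> B (tau x).
Proof. by case=> p [dp [_ Bp]] <-; rewrite /tau /transition/= chart_mapK. Qed.

Let metricE x : A x -> g d x = 'J tau x *m g c (tau x) *m ('J tau x)^T.
Proof.
case=> p [dp [cp _]] <-; rewrite [tau _]/transition/= chart_mapK//.
exact: (metric_change ahM dM cM dp cp I).
Qed.

Let acsE x : A x -> J d x *m 'J tau x = 'J tau x *m J c (tau x).
Proof.
case=> p [dp [cp _]] <-; rewrite [tau _]/transition/= chart_mapK//.
exact: (acs_change ahM dM cM dp cp I).
Qed.

Lemma conformal_factor_derive x v : A x ->
  is_derive x v (f \o chart_inv d) (- lee_form (g d) (J d) x v * (f \o chart_inv d) x).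
Proof.
move=> Ax; have Bt := tauB Ax.
have [dPt ePt] := is_derive_pullback oA oB stau tauB v sP Ax.
have sAg := chart_metric_smooth dM AT; have sAJ := chart_acs_smooth dM AT.
have sBg := chart_metric_smooth cM BT; have sBJ := chart_acs_smooth cM BT.
have lE := lee_form_pullback oA oB sAg sAJ sBg sBJ (chart_hermitian dM AT)
  (chart_hermitian cM BT) stau tauB metricE acsE v Ax.
have [_ e1] := dP ('D_v tau x) Bt.
have dh : differentiable (fun y => - P (tau y)) x.
  by apply: differentiableN; exact: (@differentiable_pullback R A B tau oA oB stau tauB P x sP Ax).
have [de ee] := is_derive_expR_comp v dh.
split; first exact: de.
apply: etrans ee _; congr (_ * _).
have dN : is_derive x v (fun y => - P (tau y)) (- 'D_v (fun y => P (tau y)) x).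
  exact: is_deriveN (DeriveDef dPt erefl).
have [_ e2] := dN; apply: etrans e2 _; congr (- _).
exact: etrans ePt (etrans e1 (esym lE)).
Qed.

Lemma smooth_conformal_factor : smooth A (f \o chart_inv d).
Proof.
apply: (@smooth_of_linear_ode R 6 A _ (fun x v => - lee_form (g d) (J d) x v) oA).
- move=> x Ax.
  have dh : differentiable (fun y => - P (tau y)) x.
    by apply: differentiableN; exact: (@differentiable_pullback R A B tau oA oB stau tauB P x sP Ax).
  have de : differentiable (expR : R -> R) (- P (tau x)) by apply/derivable1_diffP.
  have dc := differentiable_comp dh de.
  exact: differentiable_continuous dc.
- move=> v; apply: smooth_opp => //.
  exact: (smooth_lee_form oA (chart_metric_smooth dM AT) (chart_acs_smooth dM AT)
    (chart_hermitian dM AT)).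
- by move=> x v Ax; exact: conformal_factor_derive.
Qed.

Let fder x v : A x -> 'D_v (f \o chart_inv d) x =
  - (f \o chart_inv d) x * lee_form (g d) (J d) x v.
Proof.
move=> Ax; have [_ e] := conformal_factor_derive v Ax.
have aux (a b : R) : - a * b = - b * a by ring.
exact: etrans e (aux _ _).
Qed.

Let fpos x : A x -> 0 < (f \o chart_inv d) x.
Proof. by move=> _; exact: expR_gt0. Qed.

Lemma conformal_metric_smooth : smooth A (conformal f g d).
Proof.
exact: (smooth_scale_mx oA smooth_conformal_factor (chart_metric_smooth dM AT)).
Qed.

Lemma conformal_hermitian x : A x -> hermitian_pair (conformal f g d x) (J d x).
Proof. exact: (hermitian_scale (chart_hermitian dM AT) fpos). Qed.

Lemma conformal_type x : A x ->
  W1 (conformal f g d x) (J d x) (nabla_kahler (conformal f g d) (J d) x).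
Proof.
exact: (conformal_W1 oA (chart_metric_smooth dM AT) (chart_acs_smooth dM AT)
  (chart_hermitian dM AT) (chart_type dM AT) smooth_conformal_factor fpos fder).
Qed.

End OtherChart.

Lemma conformal_nearly_kahler : nearly_kahler U (conformal f g) J.
Proof.
have mapU d q : chart_dom d q -> U q -> image d U (chart_map d q).
  by move=> dq Uq; exists q.
split; last by move=> d q dM dq Uq; apply: conformal_type => //; exact: mapU.
split.
- by move=> d dM; exact: conformal_metric_smooth.
- move=> d dM; apply: (chart_acs_smooth dM).
  by move=> _ [q [dq _] <-]; exists q.
- by move=> d q dM dq Uq; apply: conformal_hermitian => //; exact: mapU.
- move=> d e q dM eM dq eq Uq /=; rewrite /conformal !chart_mapK//.
  by rewrite (metric_change ahM dM eM dq eq I) -scalemxAr -scalemxAl.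
- by move=> d e q dM eM dq eq Uq; exact: (acs_change ahM dM eM dq eq I).
Qed.

End Ball.
End LocallyConformal.

Theorem mainTheorem1 (R : realType) (M : manifold R 6) (g J : components M) :
  almost_hermitian setT g J ->
  of_type W1_plus_W4 setT g J ->
  forall p : M, exists (U : set M) (f : M -> R),
    [/\ open U, U p, smooth_function U f,
        forall q, U q -> 0 < f q &
        nearly_kahler U (conformal f g) J].
Proof.
move=> ahM type14 p; have [c cM cp] := atlas_cover p.
pose x0 := chart_map c p; pose O := chart_map c @` (chart_dom c `&` setT).
have oO : open O by apply: open_chart_image; exact: openT.
have Ox0 : O x0 by exists p.
have [r r0 rO] : exists2 r : R, 0 < r & ball x0 r `<=` O.
  have /nbhs_ballP[r r0 rO] := open_nbhs_nbhs (conj oO Ox0).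
  by exists r.
pose B : set 'rV[R]_6 := [set z | `|z - x0| < r].
have BE : B = ball x0 r.
  by apply/seteqP; split => z; rewrite -ball_normE/= /B/= distrC.
have oB : open B by rewrite BE; exact: ball_open.
have BT : B `<=` O by rewrite BE.
have sg := chart_metric_smooth ahM cM BT; have sJ := chart_acs_smooth ahM cM BT.
have gJ := chart_hermitian ahM cM BT; have t14 := chart_type type14 cM BT.
pose theta := lee_form (g c) (J c).
have th1 z : B z -> scalar (theta z).
  by move=> Bz; have [] := nabla_decomposition oB sg sJ gJ t14 Bz.
have ths v : smooth B (fun z => theta z v) by exact: (smooth_lee_form oB sg sJ gJ v).
have thc u v z : B z -> 'D_u (theta^~ v) z = 'D_v (theta^~ u) z.
  by move=> Bz; exact: (lee_closed oB sg sJ gJ t14 u v Bz).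
have [P cP dP] := @poincare R 6 x0 r theta th1 (fun v => ths v 1%N) thc.
have sP : smooth B P.
  elim=> [|k IH]; first by split.
  apply: CkS => // [v z Bz|v]; first by have [] := dP z v Bz.
  apply: Ck_ext (ths v k) => // z Bz.
  by have [_ ->] := dP z v Bz.
exists (chart_dom c `&` chart_map c @^-1` B), (fun q => expR (- P (chart_map c q))).
split.
- exact: conformal_domain_open.
- by split=> //=; rewrite /B/= subrr normr0.
- by move=> d dM; exact: (smooth_conformal_factor ahM cM oB BT sP dP dM).
- by move=> q _; exact: expR_gt0.
- exact: (conformal_nearly_kahler ahM type14 cM oB BT sP dP).
Qed.
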